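(* Let $(G_i)_{i\in I}$ be a finite or countably infinite collection of countable discrete Abelian groups with a common subgroup $H$, and let $G=\star_H G_i$ be the amalgamated free product of the $G_i$ with amalgamation over $H$. Then there is an isomorphism of von Neumann algebras $$L(G)\xrightarrow{\ \sim\ } L\big(\star(G_i/H)\big)\,\bar\otimes\, L^\infty(\hat H),$$ where $\star(G_i/H)$ is the free product of the quotient groups $G_i/H$ and $\bar\otimes$ is the spatial tensor product of von Neumann algebras.
   Context: For a discrete group $\Gamma$, $L(\Gamma)=C^*_r(\Gamma)''\subseteq B(\ell^2(\Gamma))$ is the group von Neumann algebra, i.e. the von Neumann algebra generated by the left regular representation. For a discrete Abelian group $H$, $\hat H$ is its dual group (the compact Hausdorff group of characters $H\to\mathbb{T}$ with pointwise convergence), and $L^\infty(\hat H)$ is taken with respect to Haar measure on $\hat H$. *)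

(* Defs.v *)
From HB Require Import structures.
From mathcomp Require Import all_boot all_order all_algebra.
From mathcomp Require Import complex ring.
From mathcomp Require Import all_classical all_reals all_analysis.
Set Implicit Arguments.
Unset Strict Implicit.
Unset Printing Implicit Defensive.
Import Order.TTheory GRing.Theory Num.Theory.
Import numFieldNormedType.Exports.
Local Open Scope classical_set_scope.
Local Open Scope ring_scope.

Section Presentation.
Variables (S : choiceType) (rel : seq S -> seq S -> Prop).

(* A letter [(b, s)] stands for [s] when [b] is false, for [s^-1] when [b] is
   true.  Relations only involve positive words. *)
Definition letter : Type := (bool * S)%type.
Definition pos_word (u : seq S) : seq letter := [seq (false, s) | s <- u].
Definition inv_word (w : seq letter) : seq letter :=
  rev [seq (~~ l.1, l.2) | l <- w].

Inductive word_congr : seq letter -> seq letter -> Prop :=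
| WordRefl w : word_congr w w
| WordSym w w' : word_congr w w' -> word_congr w' w
| WordTrans w w' w'' :
    word_congr w w' -> word_congr w' w'' -> word_congr w w''
| WordCat u u' v v' :
    word_congr u u' -> word_congr v v' -> word_congr (u ++ v) (u' ++ v')
| WordCancel b s : word_congr [:: (b, s); (~~ b, s)] [::]
| WordRel u v : rel u v -> word_congr (pos_word u) (pos_word v).

Definition word_eqv (w w' : seq letter) : bool := `[< word_congr w w' >].

Let word_eqv_refl : reflexive word_eqv.
Proof. by move=> w; apply/asboolP/WordRefl. Qed.

Let word_eqv_sym : symmetric word_eqv.
Proof. by move=> w w'; apply/asboolP/asboolP; exact: WordSym. Qed.

Let word_eqv_trans : transitive word_eqv.
Proof.
by move=> w w' w'' /asboolP h /asboolP h'; apply/asboolP; exact: WordTrans h h'.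
Qed.

Canonical word_eqv_canonical :=
  EquivRel word_eqv word_eqv_refl word_eqv_sym word_eqv_trans.

Definition presented : Type := {eq_quot word_eqv}%qT.
HB.instance Definition _ := Choice.on presented.
HB.instance Definition _ := EqQuotient.on presented.

Definition class_of_word (w : seq letter) : presented := \pi_presented%qT w.

Lemma class_of_wordP w w' :
  class_of_word w = class_of_word w' <-> word_congr w w'.
Proof.
split=> [/eqP|h]; first by rewrite eqmodE => /asboolP.
by apply/eqP; rewrite eqmodE; apply/asboolP.
Qed.

Lemma class_of_word_repr x : class_of_word (repr x) = x.
Proof. exact: reprK. Qed.

Lemma inv_word_cat u v : inv_word (u ++ v) = inv_word v ++ inv_word u.
Proof. by rewrite /inv_word map_cat rev_cat. Qed.

Lemma inv_wordK : involutive inv_word.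
Proof.
move=> w; rewrite /inv_word map_rev revK -map_comp -[RHS]map_id.
by apply: eq_map => -[b s] /=; rewrite negbK.
Qed.

Lemma word_catV w : word_congr (w ++ inv_word w) [::].
Proof.
elim: w => [|[b s] w IH]; first exact: WordRefl.
rewrite -cat1s inv_word_cat -catA (catA w).
apply: WordTrans (WordCancel b s).
rewrite -[[:: _; _]]/([:: (b, s)] ++ [::] ++ [:: (~~ b, s)]).
by apply: WordCat (WordRefl _) _; apply: WordCat IH (WordRefl _).
Qed.

Lemma word_catVw w : word_congr (inv_word w ++ w) [::].
Proof. by have := word_catV (inv_word w); rewrite inv_wordK. Qed.

Lemma inv_word_congr w w' :
  word_congr w w' -> word_congr (inv_word w) (inv_word w').
Proof.
move=> h; have h1 : word_congr (inv_word w) (inv_word w ++ (w' ++ inv_word w')).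
  rewrite -[X in word_congr X _]cats0.
  exact: WordCat (WordRefl _) (WordSym (word_catV w')).
apply: (WordTrans h1); rewrite catA -[X in word_congr _ X]cat0s.
apply: WordCat (WordRefl _); apply: WordTrans (word_catVw w).
exact: WordCat (WordRefl _) (WordSym h).
Qed.

Definition pres_mul (x y : presented) := class_of_word (repr x ++ repr y).
Definition pres_one := class_of_word [::].
Definition pres_inv (x : presented) := class_of_word (inv_word (repr x)).

Lemma class_of_word_cat u v :
  class_of_word (u ++ v) = pres_mul (class_of_word u) (class_of_word v).
Proof.
by apply/class_of_wordP/WordCat;
  apply/class_of_wordP; rewrite class_of_word_repr.
Qed.

Lemma class_of_word_inv u :
  class_of_word (inv_word u) = pres_inv (class_of_word u).
Proof.
by apply/class_of_wordP/inv_word_congr/class_of_wordP;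
  rewrite class_of_word_repr.
Qed.

Lemma pres_mulA : associative pres_mul.
Proof.
move=> x y z; rewrite -(class_of_word_repr x) -(class_of_word_repr y).
by rewrite -(class_of_word_repr z) -!class_of_word_cat catA.
Qed.

Lemma pres_mul1 : left_id pres_one pres_mul.
Proof.
by move=> x; rewrite -(class_of_word_repr x) -class_of_word_cat.
Qed.

Lemma pres_mulr1 : right_id pres_one pres_mul.
Proof.
by move=> x; rewrite -(class_of_word_repr x) -class_of_word_cat cats0.
Qed.

Lemma pres_mulV : left_inverse pres_one pres_inv pres_mul.
Proof.
move=> x; rewrite -(class_of_word_repr x) -class_of_word_inv.
by rewrite -class_of_word_cat; apply/class_of_wordP/word_catVw.
Qed.

Lemma pres_mulrV : right_inverse pres_one pres_inv pres_mul.
Proof.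
move=> x; rewrite -(class_of_word_repr x) -class_of_word_inv.
by rewrite -class_of_word_cat; apply/class_of_wordP/word_catV.
Qed.

HB.instance Definition _ := isGroup.Build presented
  pres_mulA pres_mul1 pres_mulr1 pres_mulV pres_mulrV.

End Presentation.

Section FreeProducts.
Variables (I : choiceType) (A : I -> groupType).

Inductive free_product_rel : seq {i : I & A i} -> seq {i : I & A i} -> Prop :=
| FreeMul i (x y : A i) :
    free_product_rel [:: Tagged A x; Tagged A y] [:: Tagged A (x * y)%g].

Definition free_product : Type := presented free_product_rel.
HB.instance Definition _ := Group.on free_product.

Variables (B : groupType) (f : forall i, B -> A i).

(* The colimit of the diagram of the [f i]: the letters of [B] are kept as
   generators, so that the amalgam is [B] itself when [I] is empty. *)
Inductive amalgam_rel :
    seq (B + {i : I & A i})%type -> seq (B + {i : I & A i})%type -> Prop :=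
| AmalgamMulB (b c : B) : amalgam_rel [:: inl b; inl c] [:: inl (b * c)%g]
| AmalgamMul i (x y : A i) :
    amalgam_rel [:: inr (Tagged A x); inr (Tagged A y)]
                [:: inr (Tagged A (x * y)%g)]
| AmalgamGlue i (b : B) : amalgam_rel [:: inl b] [:: inr (Tagged A (f i b))].

Definition amalgam : Type := presented amalgam_rel.
HB.instance Definition _ := Group.on amalgam.

End FreeProducts.

Section Quotient.
Variables (H G : zmodType) (iota : {additive H -> G}).

Definition image_pred : {pred G} := fun x => `[< exists h, iota h = x >].

Lemma image_pred_zmod : zmod_closed image_pred.
Proof.
split=> [|x y /asboolP[h <-] /asboolP[k <-]]; apply/asboolP.
  by exists 0; rewrite raddf0.
by exists (h - k); rewrite raddfB.
Qed.

HB.instance Definition _ := GRing.isZmodClosed.Build G image_pred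
  image_pred_zmod.

Definition quotient_by : zmodType := Quotient.quot image_pred.

End Quotient.

(* Inner products are linear in the first argument.  Completeness is kept as a
   separate predicate, [hilbert] below; the spaces [L2_space mu] satisfy it by
   the Riesz-Fischer theorem. *)
Record innerSpace (C : numClosedFieldType) := InnerSpace {
  inner_sort :> lmodType C ;
  inner : {dot inner_sort for Num.conj}
}.

Local Notation "''[' u , v ]" := (inner _ u v) : ring_scope.

Section Operators.
Variable C : numClosedFieldType.
Implicit Types U V W : innerSpace C.

Definition bounded_op U (T : U -> U) :=
  linear T /\ exists M : C, forall x, '[T x, T x] <= M * '[x, x].

Definition adjoint_op U (T T' : U -> U) :=
  forall x y, '[T x, y] = '[x, T' y].

Definition commutant U (S : set (U -> U)) : set (U -> U) :=
  [set T | bounded_op T /\ forall A, S A -> T \o A = A \o T].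

Definition vN_generated U (S : set (U -> U)) : set (U -> U) :=
  commutant (commutant (S `|` [set T' | exists2 T, S T & adjoint_op T T'])).

Definition vN_isomorphic U V (M : set (U -> U)) (N : set (V -> V)) :=
  exists phi : (U -> U) -> (V -> V),
    [/\ set_bij M N phi,
        forall (c : C) A B, M A -> M B ->
          phi (c \*: A \+ B) = c \*: phi A \+ phi B,
        forall A B, M A -> M B -> phi (A \o B) = phi A \o phi B &
        forall A B, M A -> M B -> adjoint_op A B -> adjoint_op (phi A) (phi B)].

Definition cauchy_seq U (u : nat -> U) :=
  forall e : C, 0 < e -> exists N, forall m n, (N <= m)%N -> (N <= n)%N ->
    '[u m - u n, u m - u n] < e.

Definition converges_to U (u : nat -> U) (l : U) :=
  forall e : C, 0 < e -> exists N, forall n, (N <= n)%N ->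
    '[u n - l, u n - l] < e.

Definition hilbert U :=
  forall u : nat -> U, cauchy_seq u -> exists l, converges_to u l.

(* [t] exhibits [W] as the Hilbert space tensor product of [U] and [V]; such a
   pair [(W, t)] is unique up to a unitary compatible with [t]. *)
Definition hilbert_tensor U V W (t : {bilinear U -> V -> W}) :=
  [/\ hilbert W,
      forall u u' v v', '[t u v, t u' v'] = '[u, u'] * '[v, v'] &
      forall (w : W) (e : C), 0 < e -> exists s : seq (U * V),
        let r := w - \sum_(p <- s) t p.1 p.2 in '[r, r] < e].

(* An operator [T] as below is [A (x) B], which is determined by its values on
   the [t u v] since these span a dense subspace. *)
Definition vN_tensor U V W (t : {bilinear U -> V -> W})
    (M : set (U -> U)) (N : set (V -> V)) : set (W -> W) :=
  vN_generated [set T | bounded_op T /\ exists A B,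
    [/\ M A, N B & forall u v, T (t u v) = t (A u) (B v)]].

End Operators.

Section L2.
Context d (T : measurableType d) (R : realType).
Variable mu : {measure set T -> \bar R}.
Local Notation C := R[i].
Local Notation Re := (@complex.Re R).
Local Notation Im := (@complex.Im R).

Definition sqintegrable : {pred T -> C} :=
  fun f => (Re \o f \in Lfun mu 2%:E) && (Im \o f \in Lfun mu 2%:E).

Lemma Lfun2D (f g : T -> R) : f \in Lfun mu 2%:E -> g \in Lfun mu 2%:E ->
  (fun x => f x + g x) \in Lfun mu 2%:E.
Proof. exact: (Lfun_addr_closed mu (lee1n 2)).2. Qed.

Lemma Lfun2Z (a : R) (f : T -> R) : f \in Lfun mu 2%:E ->
  (fun x => a * f x) \in Lfun mu 2%:E.
Proof.
move=> hf; rewrite (_ : (fun x => _) = a \o* f); last first.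
  by apply/funext => x /=; rewrite mulrC.
by apply: Lfun_scale => //; rewrite ler1n.
Qed.

Lemma Lfun20 : (fun=> 0) \in Lfun mu 2%:E.
Proof. exact: (Lfun_addr_closed mu (lee1n 2)).1. Qed.

Lemma ReZD (a z w : C) : Re (a * z + w) = Re a * Re z + (- Im a) * Im z + Re w.
Proof. by case: a z w => ? ? [? ?] [? ?] /=; rewrite mulNr. Qed.

Lemma ImZD (a z w : C) : Im (a * z + w) = Re a * Im z + Im a * Re z + Im w.
Proof. by case: a z w => ? ? [? ?] [? ?] /=. Qed.

Lemma sqintegrable_submod : submod_closed sqintegrable.
Proof.
split; first by apply/andP; split; exact: Lfun20.
move=> a f g /andP[fr fi] /andP[gr gi]; apply/andP; split.
- rewrite (_ : _ \o _ = fun x => Re a * Re (f x) + (- Im a) * Im (f x)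
      + Re (g x)); last by apply/funext => x /=; exact: ReZD.
  by apply: Lfun2D => //; apply: Lfun2D; exact: Lfun2Z.
- rewrite (_ : _ \o _ = fun x => Re a * Im (f x) + Im a * Re (f x)
      + Im (g x)); last by apply/funext => x /=; exact: ImZD.
  by apply: Lfun2D => //; apply: Lfun2D; exact: Lfun2Z.
Qed.

HB.instance Definition _ :=
  GRing.isSubmodClosed.Build _ _ sqintegrable sqintegrable_submod.

Record L2fun := L2Fun { L2fun_val :> T -> C ; _ : L2fun_val \in sqintegrable }.
HB.instance Definition _ := [isSub for L2fun_val].
HB.instance Definition _ := [Choice of L2fun by <:].
HB.instance Definition _ := [SubChoice_isSubLmodule of L2fun by <:].

Definition ae_null : {pred L2fun} :=
  fun f => `[< {ae mu, forall x, (f : T -> C) x = 0} >].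

Lemma ae_null_submod : submod_closed ae_null.
Proof.
split; first by apply/asboolP/aeW.
move=> a f g /asboolP f0 /asboolP g0; apply/asboolP.
apply: filterS2 f0 g0 => x fx gx.
by rewrite -[LHS]/(a * (f : T -> C) x + (g : T -> C) x) fx gx mulr0 addr0.
Qed.

HB.instance Definition _ := GRing.isSubmodClosed.Build _ _ ae_null
  ae_null_submod.

Definition L2 : Type := Quotient.quot ae_null.
HB.instance Definition _ := GRing.Zmodule.on L2.
HB.instance Definition _ := EqQuotient.on L2.

Definition L2_class (f : L2fun) : L2 := \pi_L2%qT f.

Lemma L2_class_repr (x : L2) : L2_class (repr x) = x.
Proof. exact: reprK. Qed.

Lemma L2_class_surj (x : L2) : exists f, x = L2_class f.
Proof. by exists (repr x); rewrite L2_class_repr. Qed.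

Lemma L2_classP (f g : L2fun) :
  L2_class f = L2_class g <-> {ae mu, forall x, L2fun_val f x = L2fun_val g x}.
Proof.
rewrite /L2_class (rwP eqP) -Quotient.idealrBE; split=> [/asboolP|h].
  by apply: filterS => x; rewrite -[L2fun_val _ x]/(f x - g x) => /subr0_eq.
apply/asboolP; apply: filterS h => x fg.
by rewrite -[LHS]/(f x - g x) fg subrr.
Qed.

Lemma L2_classD (f g : L2fun) : L2_class (f + g) = L2_class f + L2_class g.
Proof. by rewrite /L2_class !piE. Qed.

Definition L2_scale (a : C) (x : L2) : L2 := L2_class (a *: repr x).

Lemma L2_scaleE a f : L2_scale a (L2_class f) = L2_class (a *: f).
Proof.
apply/L2_classP; have /L2_classP := L2_class_repr (L2_class f).
apply: filterS => x fx.
by rewrite -[RHS]/(a * L2fun_val f x) -fx.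
Qed.

Lemma L2_scaleA a b x : L2_scale a (L2_scale b x) = L2_scale (a * b) x.
Proof. by have [f ->] := L2_class_surj x; rewrite !L2_scaleE scalerA. Qed.

Lemma L2_scale1 : left_id 1 L2_scale.
Proof. by move=> x; have [f ->] := L2_class_surj x; rewrite L2_scaleE scale1r. Qed.

Lemma L2_scaleDr : right_distributive L2_scale +%R.
Proof.
move=> a x y; have [[f ->] [g ->]] := (L2_class_surj x, L2_class_surj y).
by rewrite -L2_classD !L2_scaleE scalerDr L2_classD.
Qed.

Lemma L2_scaleDl x : {morph L2_scale^~ x : a b / a + b}.
Proof.
by move=> a b; have [f ->] := L2_class_surj x; rewrite !L2_scaleE scalerDl L2_classD.
Qed.

HB.instance Definition _ := GRing.Zmodule_isLmodule.Build C L2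
  L2_scaleA L2_scale1 L2_scaleDr L2_scaleDl.

Definition cintegral (h : T -> C) : C :=
  Complex (\int[mu]_x Re (h x)) (\int[mu]_x Im (h x)).

Definition cintegrable (h : T -> C) : Prop :=
  Re \o h \in Lfun mu 1 /\ Im \o h \in Lfun mu 1.

Lemma Lfun1D (f g : T -> R) : f \in Lfun mu 1 -> g \in Lfun mu 1 ->
  (fun x => f x + g x) \in Lfun mu 1.
Proof. exact: (Lfun_addr_closed mu (@lexx _ _ 1%E)).2. Qed.

Lemma Lfun1Z (a : R) (f : T -> R) : f \in Lfun mu 1 ->
  (fun x => a * f x) \in Lfun mu 1.
Proof.
move=> hf; rewrite (_ : (fun x => _) = a \o* f); last first.
  by apply/funext => x /=; rewrite mulrC.
exact: Lfun_scale.
Qed.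

Lemma RintegralZD (a b : R) (f g h : T -> R) :
  f \in Lfun mu 1 -> g \in Lfun mu 1 -> h \in Lfun mu 1 ->
  \int[mu]_x (a * f x + b * g x + h x) =
  a * (\int[mu]_x f x) + b * (\int[mu]_x g x) + \int[mu]_x h x.
Proof.
move=> hf hg hh; rewrite RintegralD//; last 2 first.
- by apply/Lfun1_integrable/Lfun1D; exact: Lfun1Z.
- exact/Lfun1_integrable.
rewrite RintegralD// ?RintegralZl//; apply/Lfun1_integrable => //; exact: Lfun1Z.
Qed.

Lemma cintegralZD (a : C) h k : cintegrable h -> cintegrable k ->
  cintegral (fun x => a * h x + k x) = a * cintegral h + cintegral k.
Proof.
move=> [hr hi] [kr ki].
apply/eqP; rewrite eq_complex ReZD ImZD /= -!RintegralZD//.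
by apply/andP; split; apply/eqP; apply: eq_Rintegral => x _;
  rewrite ?ReZD ?ImZD.
Qed.

Definition L2fun_inner (f g : T -> C) : C := cintegral (fun x => f x * (g x)^*).

Lemma ReMconj (z w : C) : Re (z * w^*) = Re z * Re w + Im z * Im w.
Proof. by case: z w => ? ? [? ?] /=; rewrite mulrN opprK. Qed.

Lemma ImMconj (z w : C) : Im (z * w^*) = (-1) * (Re z * Im w) + Im z * Re w.
Proof. by case: z w => ? ? [? ?] /=; rewrite mulrN mulN1r. Qed.

Lemma cintegrable_inner (f g : L2fun) : cintegrable (fun x => f x * (g x)^*).
Proof.
case: f g => f /andP[fr fi] [g /andP[gr gi]] /=; split.
- rewrite (_ : _ \o _ = fun x => Re (f x) * Re (g x) + Im (f x) * Im (g x)).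
    by apply: Lfun1D; exact: Lfun2_mul_Lfun1.
  by apply/funext => x /=; exact: ReMconj.
- rewrite (_ : _ \o _ = fun x => (-1) * (Re (f x) * Im (g x)) + Im (f x) * Re (g x)).
    apply: Lfun1D; last exact: Lfun2_mul_Lfun1.
    exact: (Lfun1Z (-1) (Lfun2_mul_Lfun1 fr gi)).
  by apply/funext => x /=; exact: ImMconj.
Qed.

Lemma L2fun_innerC (f g : L2fun) : L2fun_inner f g = (L2fun_inner g f)^*.
Proof.
apply/eqP; rewrite eq_complex /=; apply/andP; split; apply/eqP.
  by apply: eq_Rintegral => x _; rewrite !ReMconj mulrC [X in _ + X]mulrC.
have [_ /Lfun1_integrable ig] := cintegrable_inner g f.
rewrite -mulN1r -RintegralZl//; apply: eq_Rintegral => x _.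
rewrite !ImMconj; ring.
Qed.

Lemma L2fun_innerZD (a : C) (f g h : L2fun) :
  L2fun_inner (a *: f + g) h = a * L2fun_inner f h + L2fun_inner g h.
Proof.
rewrite -cintegralZD; [|exact: cintegrable_inner..].
congr cintegral; apply/funext => x.
by rewrite -[X in X * _]/(a * f x + g x) mulrDl mulrA.
Qed.

Lemma L2fun_inner_eq0 (f g : L2fun) : f \in ae_null -> L2fun_inner f g = 0.
Proof.
move=> /asboolP f0; have [hr hi] := cintegrable_inner f g.
have E (u : T -> R) : u \in Lfun mu 1 -> {ae mu, forall x, u x = 0} ->
    \int[mu]_x u x = 0.
  move=> /Lfun1_integrable /integrableP[mu_ _] u0.
  rewrite /Rintegral (ae_eq_integral (cst 0%E))// ?integral0//.
  by apply: filterS u0 => x /= -> _.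
rewrite /L2fun_inner /cintegral !E//.
- by apply: filterS f0 => x fx; rewrite /= fx mul0r.
- by apply: filterS f0 => x fx; rewrite /= fx mul0r.
Qed.

Definition L2_inner (x y : L2) : C := L2fun_inner (repr x) (repr y).

Lemma L2_innerE (f g : L2fun) :
  L2_inner (L2_class f) (L2_class g) = L2fun_inner f g.
Proof.
have inl (f1 f2 h : L2fun) : L2_class f1 = L2_class f2 ->
    L2fun_inner f1 h = L2fun_inner f2 h.
  move=> /L2_classP f12.
  rewrite -[f1](subrK f2) -[_ - _]scale1r L2fun_innerZD L2fun_inner_eq0.
    by rewrite mulr0 add0r.
  apply/asboolP; apply: filterS f12 => x fx.
  by rewrite -[LHS]/(f1 x - f2 x) fx subrr.
rewrite /L2_inner (inl _ f) ?L2_class_repr//.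
by rewrite L2fun_innerC (inl _ g) ?L2_class_repr// -L2fun_innerC.
Qed.

Lemma L2_innerC x y : L2_inner x y = (L2_inner y x)^*.
Proof. exact: L2fun_innerC. Qed.

Lemma L2_innerZD a x y z :
  L2_inner (a *: x + y) z = a * L2_inner x z + L2_inner y z.
Proof.
have [[f ->] [g ->]] := (L2_class_surj x, L2_class_surj y).
have [h ->] := L2_class_surj z.
by rewrite [a *: _]L2_scaleE -L2_classD !L2_innerE L2fun_innerZD.
Qed.

Lemma L2_inner_bilinear :
  bilinear_for *%R (Num.conj \; *%R) (L2_inner : L2 -> L2 -> C).
Proof.
split=> [z a x y|z a x y]; first exact: L2_innerZD.
by rewrite L2_innerC L2_innerZD rmorphD rmorphM /= -!L2_innerC.
Qed.

HB.instance Definition _ := bilinear_isBilinear.Build C L2 L2 C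
  *%R (Num.conj \; *%R) L2_inner L2_inner_bilinear.

Lemma L2_inner_hermitian x y :
  L2_inner x y = (-1) ^+ false * (L2_inner y x)^*.
Proof. by rewrite mul1r -L2_innerC. Qed.

HB.instance Definition _ := isHermitianSesquilinear.Build C L2 false Num.conj
  L2_inner L2_inner_hermitian.

Lemma L2_inner_gt0 (x : L2) : x != 0 -> 0 < L2_inner x x.
Proof.
have [f ->] := L2_class_surj x; rewrite L2_innerE => f0.
have [hr _] := cintegrable_inner f f.
have hE y : Re (f y * (f y)^*) = Re (f y) ^+ 2 + Im (f y) ^+ 2.
  by rewrite ReMconj !expr2.
have h0 y : 0 <= Re (f y * (f y)^*) by rewrite hE addr_ge0 ?sqr_ge0.
rewrite ltcE /=; apply/andP; split.
  apply/eqP; rewrite /Rintegral integral0_eq// => y _.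
  rewrite ImMconj; congr (_%:E); ring.
rewrite lt_neqAle eq_sym Rintegral_ge0// andbT.
apply: contra f0 => /eqP I0; apply/eqP.
have <- : L2_class 0 = 0.
  by apply: (addrI (L2_class 0)); rewrite addr0 -L2_classD addr0.
apply/L2_classP.
have /Lfun1_integrable ir := hr.
have : (\int[mu]_y (Re (f y * (f y)^*))%:E = 0)%E.
  by rewrite -[LHS]fineK ?integrable_fin_num//; congr (_%:E).
move=> J0.
have : (\int[mu]_y `|(Re (f y * (f y)^*))%:E| = 0)%E.
  by rewrite -[RHS]J0; apply: eq_integral => y _; rewrite gee0_abs ?lee_fin.
case/integrableP: ir => mr _.
move=> /(ae_eq_integral_abs mu measurableT mr).
apply: filterS => y /= /(_ I) [] /eqP.
rewrite hE paddr_eq0 ?sqr_ge0// !sqrf_eq0 => /andP[/eqP fr /eqP fi].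
by rewrite -[RHS]/(0:C); apply/eqP; rewrite eq_complex fr fi !eqxx.
Qed.

HB.instance Definition _ := isDotProduct.Build C L2 L2_inner L2_inner_gt0.

Definition L2_space : innerSpace C := InnerSpace L2_inner.

(* The class of a square-integrable function; 0 on the other functions. *)
Definition L2_of (f : T -> C) : L2 := oapp L2_class 0 (insub f).

Definition L2_repr (x : L2) : T -> C := L2fun_val (repr x).

(* [L^oo(mu)] acting on [L^2(mu)] by multiplication; products of essentially
   bounded and square-integrable functions are square-integrable. *)
Definition Linfty : set (L2 -> L2) :=
  [set A | exists f : T -> C,
    [/\ measurable_fun setT (Re \o f), measurable_fun setT (Im \o f),
        exists M : C, {ae mu, forall x, `|f x| <= M} &
        A = fun x => L2_of (fun t => f t * L2_repr x t)]].

End L2.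
Arguments Linfty {d T R} mu.
Arguments L2_of {d T R} mu f.

Definition discrete_group (Gamma : groupType) : Type := Gamma.

Section DiscreteGroup.
Variable Gamma : groupType.

HB.instance Definition _ := Group.on (discrete_group Gamma).
HB.instance Definition _ := isPointed.Build (discrete_group Gamma) 1%g.
HB.instance Definition _ := @isMeasurable.Build default_measure_display
  (discrete_group Gamma) discrete_measurable discrete_measurable0
  discrete_measurableC discrete_measurableU.

End DiscreteGroup.

Section GroupVonNeumann.
Variables (R : realType) (Gamma : groupType).

Definition ell2 : innerSpace R[i] :=
  L2_space (@counting (discrete_group Gamma) R).

(* Translates of square-summable functions are square-summable, so that the
   default value of [L2_of] is never used. *)
Definition left_regular (g : Gamma) (x : ell2) : ell2 :=
  L2_of _ (fun h : discrete_group Gamma => L2_repr x (g^-1 * h)%g).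

Definition group_vN : set (ell2 -> ell2) := vN_generated (range left_regular).

End GroupVonNeumann.
Arguments group_vN : clear implicits.

Section Dual.
Variables (R : realType) (H : zmodType).

Definition is_character (chi : H -> R[i]) :=
  (forall x y, chi (x + y) = chi x * chi y) /\ forall x, `|chi x| = 1.

Record character := Character {
  character_val :> H -> R[i] ; character_valP : `[< is_character character_val >] }.
HB.instance Definition _ := [isSub for character_val].
HB.instance Definition _ := [Choice of character by <:].

Lemma is_character1 : `[< is_character (fun=> 1) >].
Proof. by apply/asboolP; split=> *; rewrite ?mulr1 ?normr1. Qed.

Lemma is_characterM (chi psi : character) :
  `[< is_character (fun x => chi x * psi x) >].
Proof.
have [/asboolP[chiD chi1] /asboolP[psiD psi1]] :=
  (character_valP chi, character_valP psi).
apply/asboolP; split=> [x y|x]; first by rewrite chiD psiD mulrACA.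
by rewrite normrM chi1 psi1 mulr1.
Qed.

Definition character1 := Character is_character1.
Definition character_mul chi psi := Character (is_characterM chi psi).

HB.instance Definition _ := isPointed.Build character character1.

Definition dual : Type := initial_topology
  (character_val : character -> {ptws H -> (R[i] : numFieldType)}).
HB.instance Definition _ := Topological.on dual.
HB.instance Definition _ := Pointed.on dual.

Definition borel_dual := g_sigma_algebraType (@open dual).

(* [dual] is a compact group, so local finiteness means finite total mass.  No
   normalisation is imposed.  Regularity is not required: it is automatic when
   [H] is countable, since [dual] is then metrizable. *)
Definition haar (mu : {measure set borel_dual -> \bar R}) :=
  [/\ (0 < mu setT)%E, (mu setT < +oo)%E &
      forall (psi : character) (A : set borel_dual), measurable A ->
        mu [set character_mul psi chi | chi in (A : set character)] = mu A].

End Dual.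

(* Main.v *)
(* Every G_i being abelian, the image of H is central in G, and G is an
   extension of the free product Q of the G_i/H by H.  The group of Borel
   functions from the dual of H to the circle is divisible, so h |-> (chi |->
   chi h) extends to every G_i, and these extensions glue to a homomorphism psi
   on G.  The vectors delta_(p g) (x) psi g, with p : G -> Q, form, up to
   normalisation, an orthonormal basis of l^2(Q) (x) L^2: characters of H are
   orthogonal for Haar measure, and total by a monotone class argument.  The
   resulting unitary turns the translation by g into lambda(p g) (x) psi g.  An
   operator commuting with all of these commutes with the characters of H, hence
   with 1 (x) L^oo by monotone classes, hence with every lambda(q) (x) 1; so both
   von Neumann algebras have the same commutant. *)
Require Import Defs.
From HB Require Import structures.
From mathcomp Require Import all_boot all_order all_algebra.
From mathcomp Require Import complex ring lra.
From mathcomp Require Import all_classical all_reals all_analysis.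
From mathcomp Require Import measurable_realfun.
Set Implicit Arguments.
Unset Strict Implicit.
Unset Printing Implicit Defensive.
Import Order.TTheory GRing.Theory Num.Theory.
Import numFieldNormedType.Exports.
Local Open Scope classical_set_scope.
Local Open Scope ring_scope.

(** The extension of [Q] by [H] need not split, so the group alone offers no product decomposition.
    What replaces a splitting is [psi]: over circle-valued functions on the dual, the tautological
    character of [H] extends to all of [G], because divisible groups are injective. The functions
    are Borel and not continuous, since a continuous circle-valued function may have no continuous
    root, whereas a Borel branch of the angle always provides one. Countability of [H] makes
    countably many evaluations generate the Borel sets of the dual, and a monotone class argument
    then plays the part of Stone-Weierstrass and Plancherel. Von Neumann algebras are double
    commutants by definition, so no closure has to be computed: it suffices to match first
    commutants, and this is tested on matrix coefficients of [T] between elementary tensors.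
    Operator identities thus reduce to the vanishing of bounded scalar forms on total families. Haar
    measure is finite and nonzero but not normalised, whence a constant [c] with [|c| ^ 2] the
    inverse of the total mass. *)

Local Notation "''[' u , v ]" := (inner _ u v) : ring_scope.

(** * Inner product spaces *)

Section InnerSpaces.
Variable C : numClosedFieldType.
Implicit Types U V W : innerSpace C.

Lemma ipC U (x y : U) : '[x, y] = ('[y, x])^*.
Proof. by rewrite (hermC (inner U)) expr0 mul1r. Qed.

Lemma ip0l U (y : U) : '[0, y] = 0. Proof. exact: linear0l. Qed.
Lemma ip0r U (y : U) : '[y, 0] = 0. Proof. exact: linear0r. Qed.
Lemma ipDl U (x y z : U) : '[x + y, z] = '[x, z] + '[y, z].
Proof. exact: linearDl. Qed.
Lemma ipDr U (x y z : U) : '[z, x + y] = '[z, x] + '[z, y].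
Proof. exact: linearDr. Qed.
Lemma ipBl U (x y z : U) : '[x - y, z] = '[x, z] - '[y, z].
Proof. exact: linearBl. Qed.
Lemma ipBr U (x y z : U) : '[z, x - y] = '[z, x] - '[z, y].
Proof. exact: linearBr. Qed.
Lemma ipZl U a (x z : U) : '[a *: x, z] = a * '[x, z].
Proof. exact: linearZl_LR. Qed.
Lemma ipZr U a (x z : U) : '[z, a *: x] = a^* * '[z, x].
Proof. by rewrite ipC ipZl rmorphM /= -ipC. Qed.
Lemma ip_suml U (J : Type) (s : seq J) (F : J -> U) z :
  '[\sum_(i <- s) F i, z] = \sum_(i <- s) '[F i, z].
Proof. exact: linear_sumlz. Qed.
Lemma ip_sumr U (J : Type) (s : seq J) (F : J -> U) z :
  '[z, \sum_(i <- s) F i] = \sum_(i <- s) '[z, F i].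
Proof. exact: linear_sumr. Qed.

Lemma ip_ge0 U (x : U) : 0 <= '[x, x]. Proof. exact: dnorm_ge0. Qed.
Lemma ip_eq0 U (x : U) : '[x, x] = 0 -> x = 0.
Proof. by move/eqP; rewrite dnorm_eq0 => /eqP. Qed.

Lemma ip_extl U (x y : U) : (forall z, '[x, z] = '[y, z]) -> x = y.
Proof.
by move=> h; apply/subr0_eq/ip_eq0; rewrite ipBl h subrr.
Qed.

Lemma ip_extr U (x y : U) : (forall z, '[z, x] = '[z, y]) -> x = y.
Proof. by move=> h; apply: ip_extl => z; rewrite ipC h -ipC. Qed.

Lemma cauchy_schwarz U (x y : U) : `|'[x, y]| ^+ 2 <= '[x, x] * '[y, y].
Proof.
have [->|y0] := eqVneq y 0; first by rewrite !ip0r normr0 expr0n mulr0.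
have yy : 0 < '[y, y] by rewrite dnorm_gt0.
(* This is [<y, y>] times the component of [x] orthogonal to [y]; the scaling keeps the computation
   free of division. *)
have := ip_ge0 ('[y, y] *: x - '[x, y] *: y).
rewrite ipBl !ipBr !ipZl !ipZr normCK.
have -> : ('[y, y])^* = '[y, y] by rewrite -ipC.
rewrite [X in _ - (_ * (_ * X) - _)]ipC.
set a := '[x, y]; set b := '[y, y]; set c := '[x, x].
have -> : b * (b * c) - b * (a^* * a) - (a * (b * a^*) - a * (a^* * b)) =
   b * (c * b - a * a^*) by ring.
by rewrite pmulr_rge0// subr_ge0.
Qed.

(** The triangle inequality in squared form, from the parallelogram identity; its factor 2 is why
    later errors are split into quarters. *)
Lemma ip_sqD U (x y : U) : '[x + y, x + y] <= 2 * ('[x, x] + '[y, y]).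
Proof.
have := ip_ge0 (x - y).
rewrite ipBl !ipBr ipDl !ipDr => h.
rewrite -subr_ge0.
by rewrite [X in 0 <= X](_ : _ = '[x, x] - '[x, y] - ('[y, x] - '[y, y]))//; ring.
Qed.

Definition bounded_map U V (f : U -> V) :=
  linear f /\ exists2 M : C, 0 <= M & forall x, '[f x, f x] <= M * '[x, x].

Lemma bounded_opP U (T : U -> U) : bounded_op T <-> bounded_map T.
Proof.
split=> -[lT]; last by move=> [M _ h]; split=> //; exists M.
move=> [M h]; split=> //; have [hM|] := boolP (0 <= M); first by exists M.
(* A constant [M] that is not nonnegative bounds an operator only on the zero space: any nonzero [x]
   gives [0 <= M * <x, x>]. *)
have [x0|] := pselect (forall x : U, x = 0).
  by move=> _; exists 0 => // x; rewrite (x0 (T x)) ip0l mul0r.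
move=> /existsNP[x /eqP x0]; case/negP.
have xx : 0 < '[x, x] by rewrite dnorm_gt0.
rewrite -(pmulr_lge0 _ xx); exact: le_trans (ip_ge0 _) (h x).
Qed.

Lemma lin_D U V (f : U -> V) : linear f -> forall x y, f (x + y) = f x + f y.
Proof. by move=> lf x y; have := lf 1 x y; rewrite !scale1r. Qed.
Lemma lin_0 U V (f : U -> V) : linear f -> f 0 = 0.
Proof.
move=> lf; have := lin_D lf 0 0; rewrite addr0 => /eqP.
by rewrite -subr_eq subrr => /eqP.
Qed.
Lemma lin_Z U V (f : U -> V) : linear f -> forall a x, f (a *: x) = a *: f x.
Proof. by move=> lf a x; have := lf a x 0; rewrite !addr0 (lin_0 lf) addr0. Qed.
Lemma lin_B U V (f : U -> V) : linear f -> forall x y, f (x - y) = f x - f y.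
Proof.
by move=> lf x y; rewrite (lin_D lf) -scaleN1r (lin_Z lf) scaleN1r.
Qed.
Lemma lin_sum U V (f : U -> V) : linear f -> forall (J : Type) (s : seq J) F,
  f (\sum_(i <- s) F i) = \sum_(i <- s) f (F i).
Proof.
move=> lf J s F; elim: s => [|i s IH]; first by rewrite !big_nil lin_0.
by rewrite !big_cons (lin_D lf) IH.
Qed.

Lemma bounded_comp U V W (f : V -> W) (g : U -> V) :
  bounded_map f -> bounded_map g -> bounded_map (f \o g).
Proof.
move=> [lf [M M0 hf]] [lg [N N0 hg]]; split=> [a x y|].
  by rewrite /= lg lf.
exists (M * N) => [|x]; first exact: mulr_ge0.
by apply: le_trans (hf _) _; rewrite -mulrA ler_wpM2l.
Qed.

(** Bounded functionals as plain scalar functions: most operator identities below are proved by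
    pairing both sides with a vector and showing that the difference of the two forms vanishes on a
    total family. *)
Definition bounded_form U (D : U -> C) :=
  (forall a x y, D (a *: x + y) = a * D x + D y) /\
  exists2 K : C, 0 <= K & forall x, `|D x| ^+ 2 <= K * '[x, x].

Lemma bounded_form_ip U (z : U) : bounded_form (fun x => '[x, z]).
Proof.
split=> [a x y|]; first by rewrite ipDl ipZl.
by exists '[z, z] => [|x]; [exact: ip_ge0|rewrite mulrC; exact: cauchy_schwarz].
Qed.

Lemma bounded_form_comp U V (f : U -> V) (D : V -> C) :
  bounded_map f -> bounded_form D -> bounded_form (D \o f).
Proof.
move=> [lf [M M0 hf]] [lD [K K0 hD]]; split=> [a x y|]; first by rewrite /= lf lD.
exists (K * M) => [|x]; first exact: mulr_ge0.
by apply: le_trans (hD _) _; rewrite -mulrA ler_wpM2l.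
Qed.

Lemma bounded_formB U (D E : U -> C) :
  bounded_form D -> bounded_form E -> bounded_form (fun x => D x - E x).
Proof.
move=> [lD [K K0 hD]] [lE [L L0 hE]]; split=> [a x y|].
  by rewrite lD lE; ring.
exists (2 * (K + L)) => [|x]; first by rewrite mulr_ge0// addr_ge0.
rewrite -mulrA (mulrDl K).
apply: (@le_trans _ _ (2 * (`|D x| ^+ 2 + `|E x| ^+ 2))); last first.
  by rewrite ler_wpM2l// lerD.
apply: (@le_trans _ _ ((`|D x| + `|E x|) ^+ 2)).
  by rewrite lerXn2r ?nnegrE ?addr_ge0// ler_normB.
have : 0 <= (`|D x| - `|E x|) ^+ 2.
  by rewrite real_exprn_even_ge0// rpredB ?normr_real.
by move=> h; rewrite -subr_ge0 [X in 0 <= X](_ : _ = (`|D x| - `|E x|) ^+ 2)//; ring.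
Qed.

Lemma bounded_form0 U (D : U -> C) : bounded_form D -> D 0 = 0.
Proof. by case=> lD _; have := lD (-1) 0 0; rewrite scaler0 addr0 mulN1r addNr. Qed.

Lemma bounded_form_B U (D : U -> C) : bounded_form D ->
  forall x y, D (x - y) = D x - D y.
Proof.
case=> lD _ x y; have := lD (-1) y x.
by rewrite scaleN1r mulN1r ![- _ + _]addrC.
Qed.

Lemma bounded_form_sum U (D : U -> C) : bounded_form D ->
  forall (J : Type) (s : seq J) F,
  D (\sum_(i <- s) F i) = \sum_(i <- s) D (F i).
Proof.
move=> hD J s F; elim: s => [|i s IH]; first by rewrite !big_nil bounded_form0.
by rewrite !big_cons -IH -[F i]scale1r hD.1 scale1r mul1r.
Qed.

Lemma bounded_form_dense U (D : U -> C) x : bounded_form D ->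
  (forall e : C, 0 < e -> exists2 y, '[x - y, x - y] < e & D y = 0) -> D x = 0.
Proof.
move=> hD h; have [lD [K K0 hK]] := hD.
apply/eqP; rewrite -normr_eq0 -sqrf_eq0; apply/negPn/negP => n0.
have Dx : 0 < `|D x| ^+ 2 by rewrite lt_def n0 exprn_ge0.
(* [K + 1] and not [K], since the bound [K] may be 0. *)
have K1 : 0 < K + 1 by rewrite ltr_wpDl.
have [y hy Dy] := h (`|D x| ^+ 2 / (K + 1)) (divr_gt0 Dx K1).
have := hK (x - y); rewrite bounded_form_B// Dy subr0 => h1.
move: hy; rewrite ltr_pdivlMr// => hy.
suff /le_lt_trans/(_ hy) : K * '[x - y, x - y] <= '[x - y, x - y] * (K + 1).
  by move/(le_lt_trans h1); rewrite ltxx.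
by rewrite mulrC ler_wpM2l ?ip_ge0// lerDl.
Qed.

(** * Totality of elementary tensors *)

Section Tensor.
Variables (U V W : innerSpace C) (t : {bilinear U -> V -> W}).
Hypothesis ht : hilbert_tensor t.

Lemma tensor_form_ext (D : W -> C) : bounded_form D ->
  (forall u v, D (t u v) = 0) -> forall w, D w = 0.
Proof.
move=> hD h w; apply: bounded_form_dense => // e e0.
have [_ _ /(_ w e e0)[s hs]] := ht; eexists; first exact: hs.
by rewrite bounded_form_sum// big1.
Qed.

Lemma tensor_ext (w w' : W) :
  (forall u v, '[t u v, w] = '[t u v, w']) -> w = w'.
Proof.
move=> h; apply: ip_extr => z; apply/subr0_eq.
apply: (tensor_form_ext (D := fun z => '[z, w] - '[z, w'])).
  by apply: bounded_formB; exact: bounded_form_ip.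
by move=> u v; rewrite h subrr.
Qed.

Lemma ip_tensor u u' v v' : '[t u v, t u' v'] = '[u, u'] * '[v, v'].
Proof. by case: ht. Qed.

Lemma bounded_tensorl v : bounded_map (t ^~ v).
Proof.
split=> [a x y|]; first by rewrite linearPl.
exists '[v, v] => [|x]; first exact: ip_ge0.
by rewrite ip_tensor mulrC.
Qed.

Lemma bounded_tensorr u : bounded_map (t u).
Proof.
split=> [a x y|]; first by rewrite linearPr.
by exists '[u, u] => [|x]; rewrite ?ip_ge0// ip_tensor.
Qed.

End Tensor.
End InnerSpaces.

(** * Square-summable functions on a countable group *)

Section NormSq.
Variable R : realType.
Local Notation C := R[i].
Local Notation Re := (@complex.Re R).
Local Notation Im := (@complex.Im R).

(** The squared modulus as a real number: integrals are taken of real functions, while the norm of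
    [R[i]] has its values in [R[i]]. *)
Definition normsq (z : C) : R := Re z ^+ 2 + Im z ^+ 2.

Lemma normsq_ge0 z : 0 <= normsq z.
Proof. by rewrite addr_ge0 ?sqr_ge0. Qed.

Lemma normsqE z : (normsq z)%:C%C = `|z| ^+ 2.
Proof. exact: add_Re2_Im2. Qed.

Lemma normsq_conj z : (z * z^*) = (normsq z)%:C%C.
Proof. by rewrite normsqE normCK. Qed.

Lemma sum_normsqE (J : Type) (s : seq J) (c : J -> C) :
  (\sum_(i <- s) normsq (c i))%:C%C = \sum_(i <- s) `|c i| ^+ 2.
Proof. by rewrite rmorph_sum /=; apply: eq_bigr => i _; rewrite normsqE. Qed.

Lemma normsqM z w : normsq (z * w) = normsq z * normsq w.
Proof. by apply: complexI; rewrite rmorphM /= !normsqE normrM exprMn. Qed.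

Lemma normsqD z w : normsq (z + w) <= 2 * (normsq z + normsq w).
Proof.
case: z w => [a b] [c d]; rewrite /normsq /=.
have : 0 <= (a - c) ^+ 2 + (b - d) ^+ 2 by rewrite addr_ge0 ?sqr_ge0.
by nra.
Qed.

End NormSq.

Section L2Facts.
Context d (T : measurableType d) (R : realType).
Variable mu : {measure set T -> \bar R}.
Local Notation C := R[i].
Local Notation Re := (@complex.Re R).
Local Notation Im := (@complex.Im R).
Local Notation L2s := (L2_space mu).
Implicit Types f g : T -> C.

Lemma Lfun2P (f : T -> R) : measurable_fun setT f ->
  (\int[mu]_x ((f x) ^+ 2)%:E < +oo)%E -> f \in Lfun mu 2%:E.
Proof.
move=> mf h; apply/andP; split; first by rewrite inE.
rewrite inE /= /finite_norm unlock /Lnorm poweR_lty//.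
by under eq_integral => x _ do rewrite -[(_ `^ _)%E]/((`|f x| `^ 2)%:E)
  powR_mulrn// real_normK ?num_real//.
Qed.

Lemma measurable_normsq f : measurable_fun setT (Re \o f) ->
  measurable_fun setT (Im \o f) -> measurable_fun setT (fun x => normsq (f x)).
Proof.
by move=> mr mi; apply: measurable_funD; exact: measurable_funX.
Qed.

Lemma sqintegrableP f : measurable_fun setT (Re \o f) ->
  measurable_fun setT (Im \o f) ->
  (\int[mu]_x (normsq (f x))%:E < +oo)%E -> f \in sqintegrable mu.
Proof.
move=> mr mi h; apply/andP; split; apply: Lfun2P => //.
- apply: le_lt_trans h; apply: ge0_le_integral => //.
  + by move=> x _; rewrite lee_fin sqr_ge0.
  + by apply/measurable_EFinP; exact: measurable_funX.
  + by apply/measurable_EFinP; exact: measurable_normsq.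
  + by move=> x _; rewrite lee_fin lerDl sqr_ge0.
- apply: le_lt_trans h; apply: ge0_le_integral => //.
  + by move=> x _; rewrite lee_fin sqr_ge0.
  + by apply/measurable_EFinP; exact: measurable_funX.
  + by apply/measurable_EFinP; exact: measurable_normsq.
  + by move=> x _; rewrite lee_fin lerDr sqr_ge0.
Qed.

Lemma sqintegrable_measurable f : f \in sqintegrable mu ->
  measurable_fun setT (Re \o f) /\ measurable_fun setT (Im \o f).
Proof. by case/andP=> /andP[/[!inE] mr _] /andP[/[!inE] mi _]. Qed.

Lemma L2_ofE f (hf : f \in sqintegrable mu) : L2_of mu f = L2_class (L2Fun hf).
Proof.
rewrite /L2_of; case: insubP => [u _ e|]; last by rewrite hf.
by congr L2_class; exact: val_inj.
Qed.

Lemma L2_repr_sq (x : L2 mu) : L2_repr x \in sqintegrable mu.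
Proof. by rewrite /L2_repr; case: (repr x). Qed.

Lemma L2_of_repr (x : L2 mu) : L2_of mu (L2_repr x) = x.
Proof.
rewrite (L2_ofE (L2_repr_sq x)) -[RHS]L2_class_repr; congr L2_class.
exact: val_inj.
Qed.

Lemma L2_of_eq f g : f \in sqintegrable mu -> g \in sqintegrable mu ->
  L2_of mu f = L2_of mu g <-> {ae mu, forall x, f x = g x}.
Proof. by move=> hf hg; rewrite !L2_ofE; exact: L2_classP. Qed.

Lemma L2_repr_of f : f \in sqintegrable mu ->
  {ae mu, forall x, L2_repr (L2_of mu f) x = f x}.
Proof.
by move=> hf; apply/L2_of_eq => //; [exact: L2_repr_sq|rewrite L2_of_repr].
Qed.

Lemma L2_of_lin (a : C) f g : f \in sqintegrable mu -> g \in sqintegrable mu ->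
  L2_of mu (fun x => a * f x + g x) = a *: L2_of mu f + L2_of mu g.
Proof.
move=> hf hg.
have h : (fun x => a * f x + g x) \in sqintegrable mu.
  by have := (sqintegrable_submod mu).2 a f g hf hg.
rewrite !L2_ofE [a *: _]L2_scaleE -L2_classD; congr L2_class.
exact: val_inj.
Qed.

Lemma ip_L2_of f g : f \in sqintegrable mu -> g \in sqintegrable mu ->
  inner L2s (L2_of mu f) (L2_of mu g) = L2fun_inner mu f g.
Proof. by move=> hf hg; rewrite !L2_ofE; exact: L2_innerE. Qed.

Lemma L2_normE f : f \in sqintegrable mu ->
  (\int[mu]_x (normsq (f x))%:E < +oo)%E /\
  inner L2s (L2_of mu f) (L2_of mu f) = (\int[mu]_x (normsq (f x)))%:C%C.
Proof.
move=> hf; split.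
  have [mr mi] := sqintegrable_measurable hf.
  move: hf => /andP[/Lfun2_integrable_sqr /integrableP[_ hr]
    /Lfun2_integrable_sqr /integrableP[_ hi]].
  under eq_integral => x _ do rewrite EFinD.
  rewrite ge0_integralD//; last 4 first.
  - by move=> x _; rewrite lee_fin sqr_ge0.
  - by apply/measurable_EFinP; exact: measurable_funX.
  - by move=> x _; rewrite lee_fin sqr_ge0.
  - by apply/measurable_EFinP; exact: measurable_funX.
  rewrite lte_add_pinfty//.
    apply: le_lt_trans hr; under eq_integral => x _ do
      rewrite -[(_ ^+ 2)%R]ger0_norm ?sqr_ge0//; exact: lexx.
  apply: le_lt_trans hi; under eq_integral => x _ do
      rewrite -[(_ ^+ 2)%R]ger0_norm ?sqr_ge0//; exact: lexx.
rewrite ip_L2_of//; apply/eqP; rewrite eq_complex /=; apply/andP; split; apply/eqP.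
  by apply: eq_Rintegral => x _; rewrite normsq_conj.
rewrite /Rintegral integral0_eq// => x _; by rewrite normsq_conj.
Qed.

Lemma L2_normE_fin f : f \in sqintegrable mu ->
  (\int[mu]_x (normsq (f x))%:E =
    (Re (inner L2s (L2_of mu f) (L2_of mu f)))%:E)%E.
Proof.
move=> hf; have [h ->] := L2_normE hf; rewrite /= /Rintegral fineK//.
by rewrite ge0_fin_numE// integral_ge0// => x _; rewrite lee_fin normsq_ge0.
Qed.

End L2Facts.

Class countable_group (Gamma : groupType) : Prop :=
  countable_groupP : exists pk : Gamma -> nat, injective pk.

Section Ell2.
Variables (R : realType) (Gamma : groupType).
Context {Gamma_countable : countable_group Gamma}.
Local Notation C := R[i].
Local Notation Re := (@complex.Re R).
Local Notation Im := (@complex.Im R).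
Local Notation T := (discrete_group Gamma).
Local Notation ct := (@counting T R).
Local Notation E := (ell2 R Gamma).

Lemma counting1 (g : T) : ct [set g] = 1%E.
Proof.
by rewrite /counting /= asboolT// fset_set1 finmap.cardfs1.
Qed.

(** The finite sum is the integral of [f] cut down to the points of [s]; as [s] has no repetition,
    the cut-down function stays below [f]. *)
Lemma integral_count_ge (f : T -> R) (s : seq T) : (forall x, 0 <= f x) -> uniq s ->
  ((\sum_(g <- s) f g)%:E <= \int[ct]_x (f x)%:E)%E.
Proof.
move=> f0 us.
pose h (g x : T) : \bar R := ((f g)%:E * (\1_[set g] x)%:E)%E.
have h0 g x : (0 <= h g x)%E by rewrite mule_ge0 ?lee_fin.
have hE g : (\int[ct]_x h g x = (f g)%:E)%E.
  rewrite ge0_integralZl//; last by rewrite lee_fin.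
  by rewrite integral_indic//= setIT counting1 mule1.
apply: (@le_trans _ _ (\int[ct]_x (\sum_(g <- s) h g x))%E).
  by rewrite ge0_integral_sum// -sumEFin (eq_bigr _ (fun g _ => hE g)).
apply: ge0_le_integral => //.
- by move=> x _; exact: sume_ge0.
move=> x _; elim: s us => [|g s IH] /=; first by rewrite big_nil lee_fin.
case/andP=> gs us; rewrite big_cons {1}/h indicE.
have [xg|xg] := eqVneq x g; last first.
  by rewrite memNset ?mule0 ?add0e ?IH// => /= /eqP; rewrite (negbTE xg).
rewrite mem_set// mule1 xg big1_seq ?adde0// => k /andP[_ ks].
rewrite /h indicE memNset ?mule0//= => gk.
by rewrite gk ks in gs.
Qed.

Lemma integral_count_le (f : T -> R) (M : R) : (forall x, 0 <= f x) ->
  (forall s : seq T, uniq s -> \sum_(g <- s) f g <= M) ->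
  (\int[ct]_x (f x)%:E <= M%:E)%E.
Proof.
move=> f0 h; have [pk pkI] := Gamma_countable.
(* The fibres of [pk] cut the group into countably many sets with at most one point, so the integral
   becomes a series whose partial sums are sums over duplicate-free lists. *)
pose F (k : nat) : set T := [set x | pk x = k].
have FT : setT = \bigcup_k F k by apply/seteqP; split=> // x _; exists (pk x).
rewrite FT ge0_integral_bigcup//; last first.
- by move=> i j _ _ [x [/= <- <-]].
- by move=> x _; rewrite lee_fin.
pose upk (k : nat) : option T :=
  if pselect (exists x, pk x = k) is left e then Some (projT1 (cid e)) else None.
have upkP k x : upk k = Some x -> pk x = k.
  by rewrite /upk; case: pselect => // e [<-]; case: cid.
have upkN k : upk k = None -> F k = set0.
  rewrite /upk; case: pselect => // e _; apply/seteqP; split=> // x /= xk.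
  by apply: e; exists x.
have IF k : (\int[ct]_(x in F k) (f x)%:E = (oapp f 0 (upk k))%:E)%E.
  case e: (upk k) => [x|/=]; last by rewrite upkN// integral_set0.
  have -> : F k = [set x].
    apply/seteqP; split=> y; first by rewrite /F /= -(upkP _ _ e) => /pkI.
    by move=> /= ->; exact: upkP e.
  rewrite (eq_integral (cst (f x)%:E)); last by move=> y; rewrite inE /= => ->.
  by rewrite integral_cst// [X in (_ * X)%E]counting1 mule1.
apply: lime_le.
  apply: is_cvg_nneseries => n _ _.
  by rewrite integral_ge0// => *; rewrite lee_fin.
apply: nearW => n.
under eq_bigr => i _ do rewrite IF.
rewrite sumEFin lee_fin big_mkord -(big_mkord xpredT (fun k => oapp f 0 (upk k))).
rewrite (_ : \sum_(0 <= i < n) _ = \sum_(g <- pmap upk (index_iota 0 n)) f g); last first.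
  elim: (index_iota 0 n) => [|k s IH] /=; first by rewrite !big_nil.
  by rewrite big_cons IH; case: (upk k) => [x|] /=; rewrite ?big_cons ?add0r.
apply: h; have : uniq (index_iota 0 n) by exact: iota_uniq.
elim: (index_iota 0 n) => //= k s IH /andP[ks us].
case e: (upk k) => [x|] /=; last exact: IH.
rewrite IH// andbT mem_pmap; apply: contra ks => /mapP[j js ej].
by rewrite -(upkP _ _ e) (upkP _ _ (esym ej)).
Qed.

Lemma ell2_sq (c : T -> C) (M : R) :
  (forall s : seq T, uniq s -> \sum_(g <- s) normsq (c g) <= M) ->
  c \in sqintegrable ct.
Proof.
move=> h; apply: sqintegrableP => //.
apply: le_lt_trans (ltry M); apply: integral_count_le => // x; exact: normsq_ge0.
Qed.

Definition delta_fun (g : Gamma) : T -> C := fun x => (x == g)%:R.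

Lemma delta_sq g : delta_fun g \in sqintegrable ct.
Proof.
apply: sqintegrableP => //.
rewrite (eq_integral (fun x : T => (\1_[set g] x)%:E)) => [|x _].
  by rewrite integral_indic//= setIT counting1 ltry.
rewrite indicE /delta_fun /normsq; case: eqVneq => [->|xg] /=.
  by rewrite mem_set// expr0n expr1n addr0.
by rewrite memNset ?expr0n ?addr0//= => /eqP; rewrite (negbTE xg).
Qed.

Definition delta (g : Gamma) : E := L2_of ct (delta_fun g).

Lemma ip_L2_of_delta (c : T -> C) g : c \in sqintegrable ct ->
  '[L2_of ct c : E, delta g] = c g.
Proof.
move=> hc; rewrite ip_L2_of ?delta_sq// /L2fun_inner.
have E1 (u : T -> R) : (forall x, x != g -> u x = 0) -> \int[ct]_x u x = u g.
  move=> u0; rewrite /Rintegral.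
  have -> : (\int[ct]_x (u x)%:E)%E = (\int[ct]_(x in [set g]) (u x)%:E)%E.
    rewrite [RHS]integral_mkcond; apply: eq_integral => x _.
    rewrite patchE; case: ifPn => // /negP xg.
    by rewrite u0//; apply: contra_notN xg => /eqP ->; rewrite inE.
  rewrite (eq_integral (cst (u g)%:E)); last by move=> y; rewrite inE /= => ->.
  by rewrite integral_cst// [X in (_ * X)%E]counting1 mule1.
apply/eqP; rewrite eq_complex /= !E1.
- by rewrite /delta_fun eqxx rmorph1 mulr1 !eqxx.
- by move=> x /negbTE xg; rewrite /delta_fun xg rmorph0 mulr0.
- by move=> x /negbTE xg; rewrite /delta_fun xg rmorph0 mulr0.
Qed.

Lemma ip_delta (x : E) g : '[x, delta g] = L2_repr x g.
Proof. by rewrite -{1}(L2_of_repr x) ip_L2_of_delta ?L2_repr_sq. Qed.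

Lemma ip_deltas g k : '[delta g, delta k] = (g == k)%:R.
Proof. by rewrite ip_L2_of_delta ?delta_sq// /delta_fun eq_sym. Qed.

Lemma ell2_ext (x y : E) : (forall g, '[x, delta g] = '[y, delta g]) -> x = y.
Proof.
move=> h; rewrite -(L2_of_repr x) -(L2_of_repr y); congr L2_of.
by apply/funext => g; rewrite -!ip_delta.
Qed.

(** Riesz-Fischer in coordinates: this is how vectors, and hence operators into [ell2], are built
    from prescribed coefficients. *)
Lemma ell2_mk (c : Gamma -> C) (M : C) :
  (forall s : seq Gamma, uniq s -> \sum_(g <- s) `|c g| ^+ 2 <= M) ->
  {x : E | (forall g, '[x, delta g] = c g) & '[x, x] <= M}.
Proof.
move=> h.
have M0 : 0 <= M by have := h [::] isT; rewrite big_nil.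
have ME : M = (Re M)%:C%C by rewrite RRe_real// ger0_real.
have h' (s : seq T) : uniq s -> \sum_(g <- s) normsq (c g) <= Re M.
  by move=> /h; rewrite -lecR sum_normsqE -ME.
have hc := ell2_sq h'.
exists (L2_of ct (c : T -> C)) => [g|]; first exact: ip_L2_of_delta.
have [hfin ->] := L2_normE hc; rewrite ME lecR /Rintegral.
have := integral_count_le (fun x => normsq_ge0 (c x)) h'.
move: hfin; case e : integral => [r| |] //=.
by move=> _ _; rewrite -lecR -ME.
Qed.

Lemma ell2_normE (x : E) :
  (\int[ct]_g (normsq ('[x, delta g]))%:E = (Re '[x, x])%:E)%E.
Proof.
rewrite -[in RHS](L2_of_repr x) -(L2_normE_fin (L2_repr_sq x)).
by apply: eq_integral => g _; rewrite ip_delta.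
Qed.

Lemma ip_delta_sum (s : seq Gamma) (c : Gamma -> C) g : uniq s ->
  '[\sum_(k <- s) c k *: delta k, delta g] = if g \in s then c g else 0.
Proof.
move=> us; rewrite ip_suml.
under eq_bigr => k _ do rewrite ipZl ip_deltas.
case: ifPn => gs.
  rewrite (bigD1_seq g)//= eqxx mulr1 big1 ?addr0// => k /negbTE ->.
  by rewrite mulr0.
rewrite big1_seq// => k /= ks; case: eqVneq => [kg|_]; last by rewrite mulr0.
by rewrite -kg ks in gs.
Qed.

(** If every finite truncation missed by at least [e], all finite sums of squared coefficients would
    be at most [<x, x> - e], and so would their supremum, which is [<x, x>]. *)
Lemma ell2_approx (x : E) (e : C) : 0 < e -> exists2 s : seq Gamma, uniq s &
  let r := x - \sum_(g <- s) '[x, delta g] *: delta g in '[r, r] < e.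
Proof.
move=> e0; apply: contrapT => /forall2NP hN.
have eE : e = (Re e)%:C%C by rewrite RRe_real// gtr0_real.
have re0 : 0 < Re e by rewrite -ltcR -eE.
have xE : '[x, x] = (Re '[x, x])%:C%C by rewrite RRe_real// ger0_real// ip_ge0.
have h (s : seq T) : uniq s ->
    \sum_(g <- s) normsq ('[x, delta g]) <= Re '[x, x] - Re e.
  move=> us; have [//|] := hN s.
  pose y : E := \sum_(g <- s) '[x, delta g] *: delta g; cbv zeta; rewrite -/y => hlt.
  have yd : '[x, y] = \sum_(g <- s) `|'[x, delta g]| ^+ 2.
    by rewrite ip_sumr; apply: eq_bigr => g _; rewrite ipZr mulrC normCK.
  have yy : '[y, y] = '[x, y].
    rewrite [in LHS]/y [LHS]ip_sumr [RHS]ip_sumr; apply: eq_big_seq => g gs.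
    by rewrite !ipZr ip_delta_sum// gs.
  have yx : '[y, x] = '[x, y].
    rewrite ipC yd rmorph_sum /=; apply: eq_bigr => g _.
    by apply: conj_Creal; rewrite rpredX// normr_real.
  move: hlt; rewrite ipBl !ipBr yy yx subrr subr0 => hlt.
  have dE : '[x, x] - '[x, y] = (Re '[x, x] - \sum_(g <- s) normsq ('[x, delta g]))%:C%C.
    by rewrite {1}xE yd -sum_normsqE -rmorphB.
  move/negP: hlt; rewrite dE eE ltcR -leNgt; lra.
have := integral_count_le (fun g => normsq_ge0 ('[x, delta g])) h.
rewrite ell2_normE lee_fin; lra.
Qed.

Lemma bessel_delta (x : E) (s : seq Gamma) : uniq s ->
  \sum_(g <- s) `|'[x, delta g]| ^+ 2 <= '[x, x].
Proof.
move=> us; have := integral_count_ge (fun g => normsq_ge0 ('[x, delta g])) us.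
rewrite ell2_normE lee_fin -lecR sum_normsqE => /le_trans; apply.
by rewrite RRe_real ?ger0_real ?ip_ge0.
Qed.

Lemma ell2_form_ext (D : E -> C) : bounded_form D ->
  (forall g, D (delta g) = 0) -> forall x, D x = 0.
Proof.
move=> hD h x; apply: bounded_form_dense => // e e0.
have [s us hs] := ell2_approx x e0; eexists; first exact: hs.
rewrite bounded_form_sum// big1// => g _.
have := hD.1 '[x, delta g] (delta g) 0; rewrite addr0 => ->.
by rewrite h bounded_form0// mulr0 addr0.
Qed.

End Ell2.

(** * Operators on [ell2] and unitary equivalence *)

Section LeftRegular.
Variables (R : realType) (Gamma : groupType).
Context {Gamma_countable : countable_group Gamma}.
Local Notation C := R[i].
Local Notation T := (discrete_group Gamma).
Local Notation ct := (@counting T R).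
Local Notation E := (ell2 R Gamma).
Local Notation Re := (@complex.Re R).

Lemma translate_sq (g : Gamma) (x : E) :
  (fun h : T => L2_repr x (g^-1 * h)%g) \in sqintegrable ct.
Proof.
apply: (ell2_sq (M := Re '[x, x])) => s us.
rewrite -lecR sum_normsqE RRe_real ?ger0_real ?ip_ge0//.
have us' : uniq [seq (g^-1 * h)%g | h <- s] by rewrite map_inj_uniq//; exact: mulgI.
have := bessel_delta x us'; rewrite big_map => hb; apply: le_trans hb.
by apply: ler_sum => h _; rewrite -ip_delta.
Qed.

Lemma left_regular_delta (g h : Gamma) (x : E) :
  '[left_regular g x, delta R h] = '[x, delta R (g^-1 * h)%g].
Proof. by rewrite ip_L2_of_delta ?translate_sq// ip_delta. Qed.

Lemma left_regular_linear (g : Gamma) : linear (left_regular g : E -> E).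
Proof.
move=> a x y; apply: ell2_ext => h.
by rewrite left_regular_delta !ipDl !ipZl !left_regular_delta.
Qed.

(** Bessel over the translated list bounds the coefficients of [left_regular g x]; some vector has
    these coefficients and the right norm, and coefficients determine vectors. *)
Lemma left_regular_contract (g : Gamma) (x : E) :
  '[left_regular g x, left_regular g x] <= '[x, x].
Proof.
set y : E := left_regular g x.
have [z hz zx] : {z : E | (forall h, '[z, delta R h] = '[y, delta R h]) &
    '[z, z] <= '[x, x]}.
  apply: ell2_mk => s us.
  have us' : uniq [seq (g^-1 * h)%g | h <- s] by rewrite map_inj_uniq//; exact: mulgI.
  have := bessel_delta x us'; rewrite big_map => hb; apply: le_trans hb.
  by apply: ler_sum => h _; rewrite left_regular_delta.
by rewrite -(ell2_ext hz).
Qed.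

Lemma left_regular_bounded (g : Gamma) : bounded_map (left_regular g : E -> E).
Proof.
split; first exact: left_regular_linear.
by exists (1 : C) => // x; rewrite mul1r; exact: left_regular_contract.
Qed.

Lemma left_regular_deltaE (g h : Gamma) :
  left_regular g (delta R h) = delta R (g * h)%g :> E.
Proof.
apply: ell2_ext => k; rewrite left_regular_delta !ip_deltas.
suff -> : (h == g^-1 * k)%g = (g * h == k)%g by [].
apply/eqP/eqP => e; [rewrite e|rewrite -e].
  by rewrite mulVKg.
by rewrite mulKg.
Qed.

Lemma left_regular_adj (g : Gamma) :
  adjoint_op (left_regular g : E -> E) (left_regular g^-1%g).
Proof.
move=> x y; apply/subr0_eq; move: x.
apply: ell2_form_ext.
  apply: bounded_formB; last exact: bounded_form_ip.
  exact: (bounded_form_comp (left_regular_bounded g) (bounded_form_ip y)).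
move=> h; rewrite left_regular_deltaE ipC [X in _ - X]ipC left_regular_delta.
by rewrite invgK subrr.
Qed.

(** * Adjoints of operators defined on [ell2] *)

Section Adjoint.
Variables (V : innerSpace C) (Y : E -> V).
Hypothesis Ybd : bounded_map Y.

(** Test [Y] on the combination [z] of the [delta R g] with coefficients [<w, Y (delta R g)>]: then
    [<w, Y z> = <z, z> = S], Cauchy-Schwarz gives [S ^ 2 <= <w, w> * M * S], and [S] cancels. *)
Lemma adjoint_bessel (M : C) (w : V) (s : seq Gamma) : 0 <= M ->
  (forall x, '[Y x, Y x] <= M * '[x, x]) -> uniq s ->
  \sum_(g <- s) `|'[w, Y (delta R g)]| ^+ 2 <= M * '[w, w].
Proof.
move=> M0 hM us; set S := \sum_(g <- s) _.
pose c g := '[w, Y (delta R g)].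
pose z : E := \sum_(g <- s) c g *: delta R g.
have wz : '[w, Y z] = S.
  rewrite /z (lin_sum Ybd.1) ip_sumr; apply: eq_bigr => g _.
  by rewrite (lin_Z Ybd.1) ipZr mulrC normCK.
have zz : '[z, z] = S.
  rewrite {2}/z ip_sumr; apply: eq_big_seq => g gs.
  by rewrite ipZr ip_delta_sum// gs mulrC normCK.
have S0 : 0 <= S by rewrite -zz ip_ge0.
have [->|Sn0] := eqVneq S 0; first by rewrite mulr_ge0// ip_ge0.
have Sp : 0 < S by rewrite lt_def Sn0.
rewrite -(ler_pM2r Sp).
have := cauchy_schwarz w (Y z); rewrite wz ger0_norm// expr2 => /le_trans; apply.
by rewrite -mulrA (mulrC M) -mulrA ler_wpM2l ?ip_ge0// mulrC -zz.
Qed.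

(** The adjoint is written down through its coefficients [<w, Y (delta R g)>]. It serves for
    operators on [ell2] and for the slice maps from [ell2] into the tensor product. *)
Lemma adjoint_exists : exists2 Z : V -> E, bounded_map Z &
  forall x w, '[Y x, w] = '[x, Z w].
Proof.
have [lY [M M0 hM]] := Ybd.
have mk (w : V) : {x : E | (forall g, '[x, delta R g] = '[w, Y (delta R g)]) &
    '[x, x] <= M * '[w, w]}.
  by apply: ell2_mk => s; exact: adjoint_bessel.
pose Z w := s2val (mk w).
have Zd w g : '[Z w, delta R g] = '[w, Y (delta R g)] by rewrite /Z; case: (mk w).
exists Z.
  split=> [a v w|]; first by apply: ell2_ext => g; rewrite !(ipDl, ipZl, Zd).
  by exists M => // w; rewrite /Z; case: (mk w).
move=> x w; apply/subr0_eq; move: x.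
apply: ell2_form_ext.
  apply: bounded_formB; last exact: bounded_form_ip.
  exact: (bounded_form_comp Ybd (bounded_form_ip w)).
by move=> g; rewrite ipC [X in _ - X]ipC Zd subrr.
Qed.

End Adjoint.

(** * Orthonormal bases and the unitary onto [ell2] *)

Section Parseval.
Variables (W : innerSpace C) (e : Gamma -> W).
Hypothesis W_hilbert : hilbert W.
Hypothesis e_ortho : forall g h, '[e g, e h] = (g == h)%:R.
Hypothesis e_total : forall w, (forall g, '[w, e g] = 0) -> w = 0.

Lemma ip_sum_ortho (s : seq Gamma) (c : Gamma -> C) : uniq s ->
  (forall g, '[\sum_(k <- s) c k *: e k, e g] = if g \in s then c g else 0) /\
  '[\sum_(k <- s) c k *: e k, \sum_(k <- s) c k *: e k] =
  \sum_(k <- s) `|c k| ^+ 2.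
Proof.
move=> us.
have h g : '[\sum_(k <- s) c k *: e k, e g] = if g \in s then c g else 0.
  rewrite ip_suml.
  under eq_bigr => k _ do rewrite ipZl e_ortho.
  case: ifPn => gs.
    rewrite (bigD1_seq g)//= eqxx mulr1 big1 ?addr0// => k /negbTE ->.
    by rewrite mulr0.
  rewrite big1_seq// => k /= ks; case: eqVneq => [kg|_]; last by rewrite mulr0.
  by rewrite -kg ks in gs.
split=> //; rewrite ip_sumr; apply: eq_big_seq => k ks.
by rewrite ipZr h ks mulrC normCK.
Qed.

Lemma bessel (w : W) (s : seq Gamma) : uniq s ->
  \sum_(g <- s) `|'[w, e g]| ^+ 2 <= '[w, w].
Proof.
move=> us; have [h1 h2] := ip_sum_ortho (fun g => '[w, e g]) us.
set y := \sum_(k <- s) _ in h1 h2.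
have := ip_ge0 (w - y); rewrite ipBl !ipBr h2.
have -> : '[w, y] = \sum_(k <- s) `|'[w, e k]| ^+ 2.
  by rewrite ip_sumr; apply: eq_bigr => g _; rewrite ipZr mulrC normCK.
have -> : '[y, w] = \sum_(k <- s) `|'[w, e k]| ^+ 2.
  rewrite ip_suml; apply: eq_bigr => g _.
  by rewrite ipZl [X in _ * X]ipC normCK.
by rewrite subrr subr0 subr_ge0.
Qed.

Lemma ip_small (U : innerSpace C) (y : U) :
  (forall eps : C, 0 < eps -> '[y, y] < eps) -> y = 0.
Proof.
move=> h; apply: ip_eq0; apply/eqP/negPn/negP => y0.
by have := h '[y, y]; rewrite ltxx lt_def y0 ip_ge0 => /(_ isT).
Qed.

Lemma inv_small (eps : C) : 0 < eps ->
  exists N, forall n, (N <= n)%N -> n.+1%:R^-1 < eps.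
Proof.
move=> e0; have eE : eps = (Re eps)%:C%C by rewrite RRe_real// gtr0_real.
have re0 : 0 < Re eps by rewrite -ltcR -eE.
have [N hN] : exists N : nat, (Re eps)^-1 < N%:R.
  by exists (Num.bound (Re eps)^-1); apply: archi_boundP; rewrite invr_ge0 ltW.
exists N => n Nn; rewrite eE.
rewrite [X in X^-1](_ : _ = (n.+1%:R : R)%:C%C); last by rewrite rmorph_nat.
rewrite -fmorphV ltcR invf_plt ?posrE ?ltr0n//.
by rewrite (lt_le_trans hN)// ler_nat ltnW.
Qed.

Lemma analysis_exists : {V : W -> E | bounded_map V &
  forall w g, '[V w, delta R g] = '[w, e g]}.
Proof.
have mk (w : W) : {x : E | (forall g, '[x, delta R g] = '[w, e g]) &
    '[x, x] <= '[w, w]}.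
  by apply: ell2_mk => s; exact: bessel.
pose V w := s2val (mk w).
have Vd w g : '[V w, delta R g] = '[w, e g] by rewrite /V; case: (mk w).
exists V => //; split=> [a v w|].
  by apply: ell2_ext => g; rewrite !(ipDl, ipZl, Vd).
by exists (1 : C) => // w; rewrite mul1r /V; case: (mk w).
Qed.

(** Finite sums of the [e g] are isometric to the same sums of the [delta R g], so truncations of
    [x] give a Cauchy sequence in [W]; its limit has the coefficients of [x] because the analysis
    map is continuous. The approximations of [l] are kept for the proof that this map is
    isometric. *)
Lemma synthesis (x : E) : exists2 l : W, (forall g, '[l, e g] = '[x, delta R g]) &
  forall eps : C, 0 < eps -> exists2 s, uniq s &
    let r := l - \sum_(g <- s) '[l, e g] *: e g in '[r, r] < eps.
Proof.
have n0 n : (0 : C) < n.+1%:R^-1 by rewrite invr_gt0 ltr0n.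
have ap n : {s : seq Gamma | uniq s &
    let r := x - \sum_(g <- s) '[x, delta R g] *: delta R g in
    '[r, r] < n.+1%:R^-1}.
  by apply/cid2; apply: ell2_approx.
pose s n := s2val (ap n).
have us n : uniq (s n) := s2valP (ap n).
pose c g := '[x, delta R g].
pose z n : E := \sum_(g <- s n) c g *: delta R g.
have hs n : '[x - z n, x - z n] < n.+1%:R^-1 := s2valP' (ap n).
pose w n : W := \sum_(g <- s n) c g *: e g.
have wz n m : '[w n, w m] = '[z n, z m].
  rewrite ip_sumr [RHS]ip_sumr; apply: eq_bigr => g _.
  by rewrite !ipZr (ip_sum_ortho _ (us n)).1 ip_delta_sum.
have wzB n m : '[w n - w m, w n - w m] = '[z n - z m, z n - z m].
  by rewrite !(ipBl, ipBr) !wz.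
have [l hl] : exists l, converges_to w l.
  apply: W_hilbert => eps e0; have e4 : 0 < eps / 4 by rewrite divr_gt0// ltr0n.
  have [N hN] := inv_small e4; exists N => m n Nm Nn; rewrite wzB.
  have -> : z m - z n = (x - z n) + (z m - x) by rewrite [RHS]addrC subrKA.
  apply: le_lt_trans (ip_sqD _ _) _.
  have -> : '[z m - x, z m - x] = '[x - z m, x - z m].
    by rewrite -opprB; exact: hnormN.
  rewrite (_ : eps = 2 * (eps / 4 + eps / 4)); last by field.
  by rewrite ltr_pM2l ?ltr0n// ltrD// (lt_trans (hs _))// hN.
have hl' (eps : C) : 0 < eps -> exists N, forall n, (N <= n)%N -> '[l - w n, l - w n] < eps.
  move=> /hl[N hN]; exists N => n Nn; rewrite -[l - _]opprB.
  by rewrite [X in X < _](_ : _ = '[w n - l, w n - l]) ?hN//; exact: hnormN.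
have [V [lV [M M0 hM]] Vd] := analysis_exists.
have Vw n : V (w n) = z n.
  by apply: ell2_ext => g; rewrite Vd (ip_sum_ortho _ (us n)).1 ip_delta_sum.
have lx : V l = x.
  apply/subr0_eq/ip_small => eps e0.
  have e4 : 0 < eps / 4 by rewrite divr_gt0// ltr0n.
  have M1 : 0 < M + 1 by rewrite ltr_wpDl.
  have [N1 h1] := hl' _ (divr_gt0 e4 M1); have [N2 h2] := inv_small e4.
  pose n := maxn N1 N2.
  have -> : V l - x = (V l - V (w n)) + (z n - x) by rewrite Vw subrKA.
  apply: le_lt_trans (ip_sqD _ _) _.
  have -> : '[z n - x, z n - x] = '[x - z n, x - z n].
    by rewrite -opprB; exact: hnormN.
  rewrite (_ : eps = 2 * (eps / 4 + eps / 4)); last by field.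
  rewrite ltr_pM2l ?ltr0n// ltrD//; last by rewrite (lt_trans (hs _))// h2// leq_maxr.
  rewrite -(lin_B lV); apply: le_lt_trans (hM _) _.
  have := h1 n (leq_maxl _ _); rewrite ltr_pdivlMr// => h1n; apply: le_lt_trans h1n.
  by rewrite mulrC ler_wpM2l ?ip_ge0// lerDl.
have lc g : '[l, e g] = c g by rewrite -Vd lx.
exists l => // eps /hl'[N hN]; exists (s N); first exact: us.
rewrite /= (_ : \sum_(g <- s N) _ = w N) ?hN//.
by apply: eq_bigr => g _; rewrite lc.
Qed.

Lemma parseval : exists V : W -> E, exists V' : E -> W,
  [/\ cancel V V', cancel V' V, linear V,
      forall w w', '[V w, V w'] = '[w, w'] &
      forall w g, '[V w, delta R g] = '[w, e g]].
Proof.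
have [V Vb Vd] := analysis_exists; have lV := Vb.1.
pose V' x := s2val (cid2 (synthesis x)).
have V'd x g : '[V' x, e g] = '[x, delta R g] by rewrite /V'; case: cid2.
have VK : cancel V' V by move=> x; apply: ell2_ext => g; rewrite Vd V'd.
have V'K : cancel V V'.
  move=> w; apply/subr0_eq/e_total => g.
  by rewrite ipBl V'd Vd subrr.
exists V, V'; split=> // w w'; apply/eqP; rewrite eq_sym -subr_eq0; apply/eqP.
apply: (bounded_form_dense (D := fun w => '[w, w'] - '[V w, V w'])).
  apply: bounded_formB; first exact: bounded_form_ip.
  exact: (bounded_form_comp Vb (bounded_form_ip _)).
(* Totality identifies [w] with the vector synthesised from its coefficients, so [w] is a limit of
   finite sums of the [e g], on which [V] is isometric by orthonormality. *)
move=> eps e0; have [l lc /(_ eps e0)[s us hs]] := synthesis (V w).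
have lw : l = w.
  by apply/subr0_eq/e_total => g; rewrite ipBl lc Vd subrr.
rewrite lw in hs; eexists; first exact: hs.
rewrite (lin_sum lV) !ip_suml -sumrB big1// => g _.
rewrite (lin_Z lV) !ipZl -mulrBr.
have -> : V (e g) = delta R g.
  by apply: ell2_ext => h; rewrite Vd e_ortho ip_deltas.
have -> : '[e g, w'] = '[delta R g, V w'] by rewrite ipC [RHS]ipC Vd.
by rewrite subrr mulr0.
Qed.

End Parseval.
End LeftRegular.

(** * Conjugation by a unitary *)

Section Transport.
Variables (C : numClosedFieldType) (U W : innerSpace C).
Variables (V : W -> U) (V' : U -> W).
Hypotheses (VK : cancel V V') (V'K : cancel V' V) (lV : linear V).
Hypothesis Viso : forall w w', '[V w, V w'] = '[w, w'].

Let phi (A : U -> U) : W -> W := V' \o A \o V.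
Let psi (B : W -> W) : U -> U := V \o B \o V'.

Let lV' : linear V'.
Proof. by move=> a x y; apply: (can_inj VK); rewrite lV !V'K. Qed.

Let V'iso x y : '[V' x, V' y] = '[x, y].
Proof. by rewrite -Viso !V'K. Qed.

Let phiK : cancel phi psi.
Proof. by move=> A; apply/funext => x; rewrite /psi /phi /= !V'K. Qed.

Let psiK : cancel psi phi.
Proof. by move=> A; apply/funext => x; rewrite /psi /phi /= !VK. Qed.

Let phi_bounded A : bounded_op A -> bounded_op (phi A).
Proof.
move=> [lA [M hM]]; split=> [a x y|]; first by rewrite /phi /= lV lA lV'.
by exists M => x; rewrite /phi /= V'iso -[X in _ <= M * X]Viso.
Qed.

Let psi_bounded A : bounded_op A -> bounded_op (psi A).
Proof.
move=> [lA [M hM]]; split=> [a x y|]; first by rewrite /psi /= lV' lA lV.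
by exists M => x; rewrite /psi /= Viso -[X in _ <= M * X]V'iso.
Qed.

Let phiM A B : phi (A \o B) = phi A \o phi B.
Proof. by apply/funext => x; rewrite /phi /= V'K. Qed.

Let psiM A B : psi (A \o B) = psi A \o psi B.
Proof. by apply/funext => x; rewrite /psi /= VK. Qed.

(** A generated algebra is the commutant of the commutant of its generators and their adjoints, so
    it is enough that conjugation matches these inner commutants. *)
Lemma vN_isomorphic_unitary (S1 : set (U -> U)) (S2 : set (W -> W)) :
  (forall T : W -> W, bounded_op T ->
    commutant (S2 `|` [set B | exists2 A, S2 A & adjoint_op A B]) T <->
    commutant (S1 `|` [set B | exists2 A, S1 A & adjoint_op A B]) (V \o T \o V')) ->
  vN_isomorphic (vN_generated S1) (vN_generated S2).
Proof.
rewrite /vN_generated; set c1 := commutant (S1 `|` _).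
set c2 := commutant (S2 `|` _) => hc.
have M12 A : commutant c1 A -> commutant c2 (phi A).
  move=> [bA hA]; split; first exact: phi_bounded.
  move=> T c2T; have [bT _] := c2T.
  by have /hA e := (hc T bT).1 c2T; rewrite -[T]psiK -!phiM -e.
have M21 B : commutant c2 B -> commutant c1 (psi B).
  move=> [bB hB]; split; first exact: psi_bounded.
  move=> T c1T; have [bT _] := c1T.
  have /hB e : c2 (phi T).
    by apply/hc; [exact: phi_bounded|rewrite -[V \o _ \o _]/(psi (phi T)) phiK].
  by rewrite -[T]phiK -!psiM e.
exists phi; split.
- split=> [A|A B _ _ e|B hB]; first exact: M12.
  + by rewrite -[A]phiK e phiK.
  + by exists (psi B); [exact: M21|exact: psiK].
- move=> c A B _ _; apply/funext => x; rewrite /phi /=.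
  by have := lV' c (A (V x)) (B (V x)).
- by move=> A B _ _; exact: phiM.
- move=> A B _ _ h x y; rewrite /phi /= -[in LHS]Viso V'K h -[in RHS]Viso.
  by rewrite V'K.
Qed.

End Transport.

(** * The amalgam as a central extension of the free product *)

Section Words.
Variables (S : choiceType) (rel : seq S -> seq S -> Prop).
Local Notation P := (presented rel).

Definition gen (s : S) : P := class_of_word rel [:: (false, s)].

Lemma gen_inv s : class_of_word rel [:: (true, s)] = (gen s)^-1%g.
Proof. exact: (class_of_word_inv rel [:: (false, s)]). Qed.

Lemma presented_ind (Q : P -> Prop) : Q 1%g -> (forall s, Q (gen s)) ->
  (forall x y, Q x -> Q y -> Q (x * y)%g) -> (forall x, Q x -> Q x^-1%g) ->
  forall x, Q x.
Proof.
move=> Q1 Qg QM QV x; rewrite -(class_of_word_repr x).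
elim: (repr x) => [//|[b s] w IH].
rewrite -cat1s class_of_word_cat; apply: QM => //.
by case: b; [rewrite gen_inv; exact: QV|exact: Qg].
Qed.

Lemma gen_rel u v : rel u v ->
  class_of_word rel (pos_word u) = class_of_word rel (pos_word v).
Proof. by move=> h; apply/class_of_wordP/WordRel. Qed.

Variables (K : groupType) (f : S -> K) (sim : K -> K -> Prop).
Hypothesis sim_refl : forall x, sim x x.
Hypothesis sim_sym : forall x y, sim x y -> sim y x.
Hypothesis sim_trans : forall x y z, sim x y -> sim y z -> sim x z.
Hypothesis simM : forall x x' y y', sim x x' -> sim y y' -> sim (x * y)%g (x' * y')%g.

Definition word_eval (w : seq (letter S)) : K :=
  foldr (fun l a => ((if l.1 then (f l.2)^-1 else f l.2) * a)%g) 1%g w.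

Hypothesis sim_rel : forall u v, rel u v ->
  sim (word_eval (pos_word u)) (word_eval (pos_word v)).

Lemma word_eval_cat u v : word_eval (u ++ v) = (word_eval u * word_eval v)%g.
Proof. by elim: u => [|l u IH] /=; rewrite ?mul1g// IH mulgA. Qed.

Lemma word_eval_inv u : word_eval (inv_word u) = (word_eval u)^-1%g.
Proof.
elim: u => [|[b s] u IH]; first by rewrite invg1.
rewrite -cat1s inv_word_cat word_eval_cat IH /= !mulg1 invgM; congr (_ * _)%g.
by case: b => //=; rewrite invgK.
Qed.

(** Relations are respected only up to a congruence [sim] on the target. Equality gives
    homomorphisms out of a presented group; equality modulo the image of [H] gives the map from the
    free product back to the amalgam, which in general is not a homomorphism. *)
Lemma word_eval_sim w w' : word_congr rel w w' -> sim (word_eval w) (word_eval w').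
Proof.
elim=> {w w'} [w|w w' _|w w' w'' _ h _ h'|u u' v v' _ h _ h'|b s|u v].
- exact: sim_refl.
- exact: sim_sym.
- exact: sim_trans h h'.
- by rewrite !word_eval_cat; exact: simM.
- by case: b => /=; rewrite mulg1 ?mulgV ?mulVg; exact: sim_refl.
- exact: sim_rel.
Qed.

Definition pres_eval (x : P) : K := word_eval (repr x).

Lemma pres_eval_class w : sim (pres_eval (class_of_word rel w)) (word_eval w).
Proof. by apply/word_eval_sim/class_of_wordP; rewrite class_of_word_repr. Qed.

Lemma pres_eval_gen s : sim (pres_eval (gen s)) (f s).
Proof. by apply: sim_trans (pres_eval_class _) _; rewrite /= mulg1. Qed.

Lemma pres_evalM x y : sim (pres_eval (x * y)%g) (pres_eval x * pres_eval y)%g.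
Proof. by rewrite -word_eval_cat; exact: pres_eval_class. Qed.

Lemma pres_evalV x : sim (pres_eval x^-1%g) (pres_eval x)^-1%g.
Proof. by rewrite -word_eval_inv; exact: pres_eval_class. Qed.

Lemma pres_eval1 : sim (pres_eval 1%g) 1%g.
Proof. exact: (pres_eval_class [::]). Qed.

End Words.

Section WordsEq.
Variables (S : choiceType) (rel : seq S -> seq S -> Prop).
Variables (K : groupType) (f : S -> K).
Hypothesis f_rel : forall u v, rel u v ->
  word_eval f (pos_word u) = word_eval f (pos_word v).

Let eqM (x x' y y' : K) : x = x' -> y = y' -> (x * y)%g = (x' * y')%g.
Proof. by move=> -> ->. Qed.

Let eq_tr (x y z : K) : x = y -> y = z -> x = z.
Proof. by move=> ->. Qed.

Lemma pres_hom_gen s : pres_eval f (gen rel s) = f s.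
Proof. exact: (pres_eval_gen (@erefl K) (@esym K) eq_tr eqM f_rel). Qed.

Lemma pres_homM (x y : presented rel) :
  pres_eval f (x * y)%g = (pres_eval f x * pres_eval f y)%g.
Proof. exact: (pres_evalM (@erefl K) (@esym K) eq_tr eqM f_rel). Qed.

Lemma pres_homV (x : presented rel) : pres_eval f x^-1%g = (pres_eval f x)^-1%g.
Proof. exact: (pres_evalV (@erefl K) (@esym K) eq_tr eqM f_rel). Qed.

Lemma pres_hom1 : pres_eval f (1%g : presented rel) = 1%g.
Proof. exact: (pres_eval1 (@erefl K) (@esym K) eq_tr eqM f_rel). Qed.

End WordsEq.

Lemma presented_countable (S : choiceType) (rel : seq S -> seq S -> Prop)
  (k : S -> nat) : injective k -> countable_group (presented rel).
Proof.
move=> ki; exists (fun x => pickle [seq (l.1, k l.2) | l <- repr x]).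
move=> x y /(pcan_inj pickleK)/(inj_map _) h.
rewrite -(class_of_word_repr x) -(class_of_word_repr y) h// => -[b s] [b' s'] /=.
by case=> -> /ki ->.
Qed.

(** * The projection onto the free product and its kernel *)

Section Amalgam.
Variables (I : countType) (H : countZmodType) (G : I -> countZmodType).
Variable iota : forall i : I, {additive H -> G i}.

Local Notation Q := (free_product
  (fun i : I => GRing.to_multiplicative (quotient_by (iota i)))).
Local Notation Gamma := (amalgam (fun i : I => GRing.to_fmultiplicative (iota i))).
Local Notation Qrel := (@free_product_rel I
  (fun i : I => GRing.to_multiplicative (quotient_by (iota i)))).
Local Notation Arel := (@amalgam_rel I _ _ 
  (fun i : I => GRing.to_fmultiplicative (iota i))).
Local Notation GM := (fun i : I => GRing.to_multiplicative (G i)).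
Local Notation QM := (fun i : I => GRing.to_multiplicative (quotient_by (iota i))).

Local Notation amalgam_map := (fun i : I => GRing.to_fmultiplicative (iota i)).

Definition amalgam_base (h : H) : Gamma := gen Arel (inl h).
Definition amalgam_in (i : I) (x : G i) : Gamma := gen Arel (inr (Tagged GM x)).
Definition free_in (i : I) (q : quotient_by (iota i)) : Q := gen Qrel (Tagged QM q).

Lemma amalgam_baseD h k : amalgam_base (h + k) = (amalgam_base h * amalgam_base k)%g.
Proof.
rewrite /amalgam_base /gen -[(_ * _)%g]class_of_word_cat.
exact/esym/(gen_rel (AmalgamMulB amalgam_map _ _)).
Qed.

Lemma amalgam_inD i (x y : G i) : amalgam_in (x + y) = (amalgam_in x * amalgam_in y)%g.
Proof.
rewrite /amalgam_in /gen -[(_ * _)%g]class_of_word_cat.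
exact/esym/(gen_rel (AmalgamMul amalgam_map _ _)).
Qed.

Lemma amalgam_glue i h : amalgam_base h = amalgam_in (iota i h).
Proof. exact: (gen_rel (AmalgamGlue amalgam_map i h)). Qed.

Lemma amalgam_base0 : amalgam_base 0 = 1%g.
Proof.
by apply: (mulgI (amalgam_base 0)); rewrite -amalgam_baseD addr0 mulg1.
Qed.

Lemma amalgam_baseN h : amalgam_base (- h) = (amalgam_base h)^-1%g.
Proof.
by apply: (mulgI (amalgam_base h)); rewrite -amalgam_baseD subrr amalgam_base0 mulgV.
Qed.

(** On a letter of [G i] the gluing relation moves [h] into [G i], which is commutative; the
    elements commuting with [h] form a subgroup. *)
Lemma amalgam_base_central h x : (amalgam_base h * x = x * amalgam_base h)%g.
Proof.
elim/presented_ind: x => [|[k|[i x]]|x y hx hy|x hx].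
- by rewrite mulg1 mul1g.
- by rewrite -[gen _ _]/(amalgam_base k) -!amalgam_baseD addrC.
- rewrite -[gen _ _]/(amalgam_in (x : G i)) (amalgam_glue i).
  by rewrite -!amalgam_inD addrC.
- by rewrite mulgA hx -mulgA hy mulgA.
- by apply: (mulgI x); rewrite mulgA -hx mulgK mulVKg.
Qed.

Lemma free_inD i (x y : quotient_by (iota i)) :
  free_in (x + y) = (free_in x * free_in y)%g.
Proof.
rewrite /free_in /gen -[(_ * _)%g]class_of_word_cat.
exact/esym/(gen_rel (FreeMul _ _)).
Qed.

Lemma free_in0 i : free_in (0 : quotient_by (iota i)) = 1%g.
Proof.
apply: (mulgI (free_in (0 : quotient_by (iota i)))).
by rewrite -free_inD addr0 mulg1.
Qed.

Definition quot_class i (x : G i) : quotient_by (iota i) :=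
  \pi_(quotient_by (iota i))%qT x.

Lemma quot_classD i (x y : G i) : quot_class (x + y) = quot_class x + quot_class y.
Proof. by rewrite /quot_class !piE. Qed.

Lemma quot_classP i (x y : G i) :
  quot_class x = quot_class y <-> exists h, x = y + iota i h.
Proof.
rewrite /quot_class (rwP eqP) -Quotient.idealrBE; split=> [/asboolP[h e]|[h e]].
  by exists h; rewrite e addrC subrK.
by apply/asboolP; exists h; rewrite e addrC addKr.
Qed.

Lemma quot_class_iota i h : quot_class (iota i h) = 0.
Proof.
have -> : (0 : quotient_by (iota i)) = quot_class 0 by rewrite /quot_class !piE.
by apply/quot_classP; exists h; rewrite add0r.
Qed.

Lemma quot_class_repr i (q : quotient_by (iota i)) : quot_class (repr q) = q.
Proof. exact: reprK. Qed.

Let proj_gen (s : (GRing.to_multiplicative H + {i : I & GM i})%type) : Q :=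
  match s with inl _ => 1%g | inr u => free_in (quot_class (tagged u)) end.

Definition amalgam_proj (x : Gamma) : Q := pres_eval proj_gen x.

Let proj_rel u v : Arel u v ->
  word_eval proj_gen (pos_word u) = word_eval proj_gen (pos_word v).
Proof.
case=> [b c|i x y|i b] /=; rewrite ?mulg1//.
  by rewrite -free_inD -quot_classD.
by rewrite [GRing.to_fmultiplicative _ _]/(iota i b) quot_class_iota free_in0.
Qed.

Lemma amalgam_projM x y : amalgam_proj (x * y)%g = (amalgam_proj x * amalgam_proj y)%g.
Proof. exact: (pres_homM proj_rel). Qed.

Lemma amalgam_proj1 : amalgam_proj 1%g = 1%g.
Proof. exact: (pres_hom1 proj_rel). Qed.

Lemma amalgam_projV x : amalgam_proj x^-1%g = (amalgam_proj x)^-1%g.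
Proof. exact: (pres_homV proj_rel). Qed.

Lemma amalgam_proj_base h : amalgam_proj (amalgam_base h) = 1%g.
Proof. exact: (pres_hom_gen proj_rel (inl h)). Qed.

Lemma amalgam_proj_in i (x : G i) : amalgam_proj (amalgam_in x) = free_in (quot_class x).
Proof. exact: (pres_hom_gen proj_rel (inr (Tagged GM x))). Qed.

Lemma amalgam_proj_surj q : exists x, amalgam_proj x = q.
Proof.
elim/presented_ind: q => [|[i q]|q r [x <-] [y <-]|q [x <-]].
- by exists 1%g; exact: amalgam_proj1.
- exists (amalgam_in (repr (q : quotient_by (iota i)))).
  by rewrite amalgam_proj_in quot_class_repr.
- by exists (x * y)%g; rewrite amalgam_projM.
- by exists x^-1%g; rewrite amalgam_projV.
Qed.

(** Arbitrary coset representatives, hence multiplicative only modulo the image of [H], which is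
    what [sim] records. *)
Let lift_gen (s : {i : I & QM i}) : Gamma :=
  amalgam_in (repr (tagged s : quotient_by (iota (tag s)))).

Let sim (x y : Gamma) := exists h, x = (y * amalgam_base h)%g.

Let sim_refl x : sim x x.
Proof. by exists 0; rewrite amalgam_base0 mulg1. Qed.
Let sim_sym x y : sim x y -> sim y x.
Proof. by move=> [h ->]; exists (- h); rewrite amalgam_baseN mulgK. Qed.
Let sim_trans x y z : sim x y -> sim y z -> sim x z.
Proof. by move=> [h ->] [k ->]; exists (k + h); rewrite amalgam_baseD mulgA. Qed.
Let simM x x' y y' : sim x x' -> sim y y' -> sim (x * y)%g (x' * y')%g.
Proof.
move=> [h ->] [k ->]; exists (h + k).
by rewrite amalgam_baseD !mulgA -(mulgA x') amalgam_base_central !mulgA.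
Qed.
Let simV x y : sim x y -> sim x^-1%g y^-1%g.
Proof.
by move=> [h ->]; exists (- h); rewrite invgM amalgam_baseN -amalgam_baseN amalgam_base_central.
Qed.

Let sim_in i (x y : G i) : quot_class x = quot_class y -> sim (amalgam_in x) (amalgam_in y).
Proof. by move=> /quot_classP[h ->]; exists h; rewrite amalgam_inD (amalgam_glue i). Qed.

Let lift_rel u v : Qrel u v ->
  sim (word_eval lift_gen (pos_word u)) (word_eval lift_gen (pos_word v)).
Proof.
case=> i x y /=; rewrite !mulg1 /lift_gen /= -amalgam_inD; apply: sim_in.
by rewrite quot_classD !quot_class_repr.
Qed.

Let lift (q : Q) : Gamma := pres_eval lift_gen q.

(** Checked on generators and propagated along products and inverses, this takes the place of a
    normal form theorem: the kernel of the projection can be read off from it. *)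
Let lift_proj x : sim (lift (amalgam_proj x)) x.
Proof.
elim/presented_ind: x => [|[h|[i x]]|x y hx hy|x hx].
- rewrite amalgam_proj1.
  exact: (pres_eval1 sim_refl sim_sym sim_trans simM lift_rel).
- rewrite amalgam_proj_base.
  apply: sim_trans (pres_eval1 sim_refl sim_sym sim_trans simM lift_rel) _.
  by exists (- h); rewrite -amalgam_baseD subrr amalgam_base0.
- rewrite amalgam_proj_in.
  apply: sim_trans (pres_eval_gen sim_refl sim_sym sim_trans simM lift_rel _) _.
  by apply: sim_in; rewrite quot_class_repr.
- rewrite amalgam_projM.
  apply: sim_trans (pres_evalM sim_refl sim_sym sim_trans simM lift_rel _ _) _.
  exact: simM.
- rewrite amalgam_projV.
  apply: sim_trans (pres_evalV sim_refl sim_sym sim_trans simM lift_rel _) _.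
  exact: simV.
Qed.

Lemma amalgam_proj_ker x y : amalgam_proj x = amalgam_proj y ->
  exists h, x = (y * amalgam_base h)%g.
Proof.
by move=> e; apply: sim_trans (sim_sym (lift_proj x)) _; rewrite e; exact: lift_proj.
Qed.

Section Extension.
Variables (D : zmodType) (chi : H -> D) (phi : forall i, G i -> D).
Hypothesis chiD : forall x y, chi (x + y) = chi x + chi y.
Hypothesis phiD : forall i (x y : G i), phi (x + y) = phi x + phi y.
Hypothesis phi_iota : forall i h, phi (iota i h) = chi h.

(** The universal property of the colimit, with values in an abelian group written additively. *)
Lemma amalgam_extension : exists psi : Gamma -> D,
  [/\ psi 1%g = 0, forall x y, psi (x * y)%g = psi x + psi y &
      forall h, psi (amalgam_base h) = chi h].
Proof.
pose f (s : (GRing.to_multiplicative H + {i : I & GM i})%type) :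
    GRing.to_multiplicative D :=
  match s with inl h => chi h | inr u => phi (tagged u : G (tag u)) end.
have fr u v : Arel u v -> word_eval f (pos_word u) = word_eval f (pos_word v).
  case=> [b c|i x y|i b] /=; rewrite ?mulg1.
  - exact/esym/chiD.
  - exact/esym/phiD.
  - exact/esym/phi_iota.
exists (pres_eval f); split.
- exact: (pres_hom1 fr).
- exact: (pres_homM fr).
- by move=> h; exact: (pres_hom_gen fr (inl h)).
Qed.

End Extension.

Lemma amalgam_countable : countable_group Gamma.
Proof.
apply: (@presented_countable _ _ (fun s : (GRing.to_multiplicative H + {i : I & GM i})%type =>
  match s with
  | inl h => pickle (0%N, pickle (h : H))
  | inr u => pickle (1%N, pickle (Tagged (fun i => G i) (tagged u : G (tag u))))
  end)).
move=> [h|[i x]] [k|[j y]] /(pcan_inj pickleK) [] // /(pcan_inj pickleK).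
  by move=> ->.
by move=> e; congr inr; move: e.
Qed.

Lemma free_product_countable : countable_group Q.
Proof.
apply: (@presented_countable _ _ (fun u : {i : I & QM i} =>
  pickle (Tagged (fun i => G i) (repr (tagged u : quotient_by (iota (tag u))))))).
move=> [i x] [j y] /(pcan_inj pickleK) /= e.
have ij : i = j := f_equal tag e.
case: j / ij y e => y /eqP; rewrite eq_Tagged /= => /eqP e.
by rewrite -(quot_class_repr x) -(quot_class_repr y) e.
Qed.

End Amalgam.

(** * Extension of homomorphisms into divisible groups *)

(* Baer's criterion; partial homomorphisms are encoded by their graphs. *)
Lemma divisible_extension (G D : zmodType) (P0 : set (G * D)) :
  (forall (n : nat) (d : D), (0 < n)%N -> exists v, v *+ n = d) ->
  P0 0 -> (forall p q, P0 p -> P0 q -> P0 (p - q)) ->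
  (forall d, P0 (0, d) -> d = 0) ->
  exists f : G -> D, (forall x y, f (x + y) = f x + f y) /\
    forall x d, P0 (x, d) -> f x = d.
Proof.
move=> div P00 P0B P0f.
(* The inclusion of [P0] is asked only of nonempty graphs, so that the union of the empty chain is
   admissible in Zorn's lemma; maximality excludes the empty graph afterwards. *)
pose good (X : set (G * D)) := [/\ X !=set0 -> P0 `<=` X,
  forall p q, X p -> X q -> X (p - q) & forall d, X (0, d) -> d = 0].
have [F FP tot|A [[A0 AB Af] Amax]] := @Zorn_bigcup _ good.
  split=> [[p [X FX Xp]]|p q [X FX Xp] [Y FY Yq]|d [X FX Xd]].
  - have [/(_ (ex_intro _ p Xp)) h _ _] := FP _ FX.
    by apply: subset_trans h _ => q Xq; exists X.
  - have [XY|YX] := tot _ _ FX FY.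
    + by exists Y => //; have [_ h _] := FP _ FY; apply: h => //; exact: XY.
    + by exists X => //; have [_ h _] := FP _ FX; apply: h => //; exact: YX.
  - by have [_ _] := FP _ FX; apply.
have An0 : A !=set0.
  apply/set0P/negP => /eqP AE; apply: (Amax P0) => //.
    by rewrite AE; split=> // /(_ _ P00).
  by split=> // _ p.
have PA := A0 An0; have A00 : A 0 := PA _ P00.
have AN p : A p -> A (- p) by move=> Ap; rewrite -sub0r; exact: AB.
have AD p q : A p -> A q -> A (p + q).
  by move=> Ap Aq; rewrite -[q]opprK; apply: AB => //; exact: AN.
have AMn p n : A p -> A (p *+ n).
  by move=> Ap; elim: n => [|n IH]; rewrite ?mulr0n// mulrS; exact: AD.
have AMz p (n : int) : A p -> A (p *~ n).
  by move=> Ap; case: n => n; [exact: AMn|apply: AN; exact: AMn].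
have tA g : exists d, A (g, d).
  apply: contrapT => gA.
  (* The integers [n] with [g *~ n] in the domain form an ideal. If it is generated by [m0 > 0], [v]
     solves [v *+ m0 = w] for the value [w] already prescribed at [g *+ m0]; if it is zero, [v = 0]
     will do. *)
  have [v hv] : exists v, forall (n : int) d, A (g *~ n, d) -> d = v *~ n.
    pose isM (m : nat) := `[< (0 < m)%N /\ exists w, A (g *+ m, w) >].
    have [hm|noM] := pselect (exists m, isM m).
      have [m0 /asboolP[m0p [w Aw]] mmin] := ex_minnP hm.
      have [v vE] := div m0 w m0p; exists v => n d Ad.
      have Ar : A (g *~ (n %% m0)%Z, d - w *~ (n %/ m0)%Z).
        have -> : (g *~ (n %% m0)%Z, d - w *~ (n %/ m0)%Z) =
            (g *~ n, d) - (g *+ m0, w) *~ (n %/ m0)%Z.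
          have pE (p : G * D) z : p *~ z = (p.1 *~ z, p.2 *~ z).
            by rewrite [LHS]surjective_pairing !raddfMz.
          rewrite pE /=; congr pair.
          rewrite -[RHS]/(g *~ n - g *+ m0 *~ (n %/ m0)%Z).
          rewrite {2}(divz_eq n m0) [in RHS]mulrzDr (mulrC _ (m0 : int)) mulrzA.
          by rewrite -pmulrn addrC addKr.
        by apply: AB => //; exact: AMz.
      have r0 : (n %% m0)%Z = 0.
        have m0n : (m0 : int) != 0 by rewrite -lt0n.
        have := modz_ge0 n m0n; case e: (n %% m0)%Z => [r|//] _.
        have := ltz_pmod n (d := m0) m0p; rewrite e ltz_nat => rm.
        case: r e rm => // r e rm; have := mmin r.+1; rewrite leqNgt rm => /(_ _)/notF; case.
        by apply/asboolP; split=> //; exists (d - w *~ (n %/ m0)%Z); rewrite e in Ar.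
      move: Ar; rewrite r0 mulr0z => /Af/subr0_eq ->.
      by rewrite -vE {2}(divz_eq n m0) r0 addr0 mulrC mulrzA -pmulrn.
    exists 0 => n d Ad; rewrite mul0rz.
    have [n0|n0|n0] := ltrgtP n 0; last first.
    - by rewrite n0 mulr0z in Ad; exact: Af.
    - case: noM; exists (absz n); apply/asboolP; split; first by rewrite absz_gt0 gt_eqF.
      by exists d; rewrite pmulrn gtz0_abs.
    - case: noM; exists (absz n); apply/asboolP; split; first by rewrite absz_gt0 lt_eqF.
      by exists (- d); rewrite pmulrn ltz0_abs// mulrNz; exact: (AN _ Ad).
  (* Adjoining [(g, v)] to the graph contradicts maximality; that [B] is still single-valued is what
     [hv] provides. *)
  pose B : set (G * D) := [set p | exists q (n : int), A q /\
    p = (q.1 + g *~ n, q.2 + v *~ n)].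
  apply: (Amax B).
    split=> [p Ap|BA]; first by exists p, 0; rewrite !mulr0z !addr0; case: p Ap.
    by apply: gA; exists v; apply: BA; exists 0, 1; rewrite !mulr1z !add0r.
  split=> [_ p /PA Ap|_ _ [p [n [Ap ->]]] [q [k [Aq ->]]]|d [[x e] [n [Ap]]]].
  - by exists p, 0; rewrite !mulr0z !addr0; case: p Ap.
  - exists (p - q), (n - k); split; first exact: AB.
    by rewrite !mulrzBr; congr pair; rewrite /= opprD addrACA.
  - case=> /esym/eqP; rewrite addr_eq0 => /eqP xE ->.
    have := hv (- n) e; rewrite !mulrNz -xE => /(_ Ap) ->.
    by rewrite addNr.
have fct x d e : A (x, d) -> A (x, e) -> d = e.
  move=> h1 h2; apply/subr0_eq/Af.
  by have := AB _ _ h1 h2; rewrite (_ : _ - _ = (0, d - e))//= -(subrr x).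
have [f fA] := choice tA; exists f; split=> [x y|x d Px].
  by apply: fct (fA _) _; exact: (AD _ _ (fA x) (fA y)).
by apply: fct (fA _) _; exact: PA.
Qed.

(** * Monotone classes of bounded functions *)

Section BoundedClass.
Import HBNNSimple.
Context d (T : measurableType d) (R : realType).
Variable A : set (T -> R).

(** The class of the functional monotone class theorem. Limits are pointwise with a uniform bound,
    which is what dominated convergence can follow. *)
Inductive bounded_class : (T -> R) -> Prop :=
| BoundedGen f : A f -> bounded_class f
| BoundedLin a f g : bounded_class f -> bounded_class g ->
    bounded_class (fun x => a * f x + g x)
| BoundedLim (u : nat -> T -> R) f M : (forall n, bounded_class (u n)) ->
    (forall n x, `|u n x| <= M) -> (forall x, u^~ x @ \oo --> f x) ->
    bounded_class f.

Local Notation cls := bounded_class.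

Hypothesis A_bounded : forall f, A f -> exists M : R, forall x, `|f x| <= M.
Hypothesis A_mul : forall f g, A f -> A g -> cls (fun x => f x * g x).
Hypothesis A_one : cls (fun=> 1).
Hypothesis A_generate : forall D : set (set T), sigma_algebra setT D ->
  (forall f a, A f -> D [set x | a < f x]) -> forall X, measurable X -> D X.

Let cls0 : cls (fun=> 0).
Proof.
have := BoundedLin (-1) A_one A_one.
by rewrite (_ : (fun=> _) = fun=> 0)//; apply/funext => x; rewrite mulN1r addNr.
Qed.

Let clsZ a f : cls f -> cls (fun x => a * f x).
Proof.
move=> hf; have := BoundedLin a hf cls0.
by rewrite (_ : (fun x => _) = fun x => a * f x)//; apply/funext => x; rewrite addr0.
Qed.

Let clsD f g : cls f -> cls g -> cls (fun x => f x + g x).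
Proof.
move=> hf hg; have := BoundedLin 1 hf hg.
by rewrite (_ : (fun x => _) = fun x => f x + g x)//; apply/funext => x; rewrite mul1r.
Qed.

Let clsB f g : cls f -> cls g -> cls (fun x => f x - g x).
Proof.
move=> hf hg; have := BoundedLin (-1) hg hf.
by rewrite (_ : (fun x => _) = fun x => f x - g x)//; apply/funext => x; rewrite mulN1r addrC.
Qed.

Let cls_cst a : cls (fun=> a).
Proof.
have := clsZ a A_one; rewrite (_ : (fun x => _) = fun=> a)//.
by apply/funext => x; rewrite mulr1.
Qed.

Let cls_sum n (F : 'I_n -> T -> R) : (forall i, cls (F i)) ->
  cls (fun x => \sum_(i < n) F i x).
Proof.
elim: n F => [|n IH] F h.
  by under eq_fun do rewrite big_ord0; exact: cls0.
by under eq_fun do rewrite big_ord_recr /=; apply: clsD => //; exact: IH.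
Qed.

Let cls_bounded f : cls f -> exists2 M : R, 0 < M & forall x, `|f x| <= M.
Proof.
have pos g : (exists M : R, forall x : T, `|g x| <= M) ->
    exists2 M : R, 0 < M & forall x, `|g x| <= M.
  move=> [M h]; exists (`|M| + 1) => [|x]; first by rewrite ltr_wpDl.
  by rewrite (le_trans (h x))// (le_trans (ler_norm _))// lerDl.
elim=> {f} [f Af|a f g _ [M M0 hM] _ [N N0 hN]|u f M _ _ hM uf]; apply: pos.
- exact: A_bounded.
- exists (`|a| * M + N) => x; rewrite (le_trans (ler_normD _ _))// normrM lerD//.
  by rewrite ler_wpM2l.
- exists M => x; apply: (cvgr_to_le (cvg_norm (uf x))).
  exact: nearW.
Qed.

Let cvg_mul (u : nat -> R) l a : u @ \oo --> l -> (fun n => a * u n) @ \oo --> a * l.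
Proof. by move=> h; apply: cvgM => //; exact: cvg_cst. Qed.

(** Products are handled in two stages: one factor is first kept a generator while the induction
    runs on the other, and is then freed in turn. *)
Let clsMA f g : A f -> cls g -> cls (fun x => f x * g x).
Proof.
move=> Af; elim=> {g} [g Ag|a g h _ IHg _ IHh|u g M _ IH hM ug].
- exact: A_mul.
- have := BoundedLin a IHg IHh.
  by rewrite (_ : (fun x => _) = fun x => f x * (a * g x + h x))//; apply/funext => x; ring.
- have [N hN] := A_bounded Af.
  apply: (BoundedLim (M := `|N| * M) IH) => [n x|x]; last exact: cvg_mul.
  by rewrite normrM ler_pM// (le_trans (hN x))// ler_norm.
Qed.

Let clsM f g : cls f -> cls g -> cls (fun x => f x * g x).
Proof.
move=> + cg; elim=> {f} [f Af|a f h _ IHf _ IHh|u f M _ IH hM uf].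
- exact: clsMA.
- have := BoundedLin a IHf IHh.
  by rewrite (_ : (fun x => _) = fun x => (a * f x + h x) * g x)//; apply/funext => x; ring.
- have [N N0 hN] := cls_bounded cg.
  apply: (BoundedLim (M := M * N) IH) => [n x|x].
    by rewrite normrM ler_pM.
  by under eq_fun do rewrite mulrC; rewrite mulrC; exact: cvg_mul.
Qed.

(* The iteration [p := p + (f ^ 2 - p ^ 2) / 2] started at [0] increases to [|f|]
   when [|f| <= 1]. *)
Fixpoint sqrt_iter (f : T -> R) (n : nat) (x : T) : R :=
  if n is m.+1 then sqrt_iter f m x + 2^-1 * (f x * f x - sqrt_iter f m x * sqrt_iter f m x)
  else 0.

(** With [a = |f x|] and [p] the current iterate, one step multiplies the error [a - p] by
    [1 - (a + p) / 2], which lies between 0 and [1 - a / 2]. *)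
Let sqrt_iter_bound f n x : `|f x| <= 1 ->
  0 <= sqrt_iter f n x <= `|f x| /\ `|f x| - sqrt_iter f n x <= `|f x| * (1 - `|f x| / 2) ^+ n.
Proof.
move=> f1; have f0 := normr_ge0 (f x).
have fE : f x * f x = `|f x| * `|f x| by rewrite -normrM ger0_norm// -expr2 sqr_ge0.
elim: n => [|n [/andP[p0 pf] IH]] /=; first by rewrite lexx f0 subr0 expr0 mulr1.
rewrite fE; set a := `|f x| in f1 f0 pf IH *; set p := sqrt_iter f n x in p0 pf IH *.
split; first by apply/andP; split; nra.
rewrite exprSr mulrA; apply: (@le_trans _ _ ((a - p) * (1 - a / 2))); first by nra.
by rewrite ler_wpM2r//; lra.
Qed.

Let cls_sqrt_iter f n : cls f -> cls (sqrt_iter f n).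
Proof.
move=> cf; elim: n => [|n IH]; first exact: cls0.
rewrite (_ : sqrt_iter f n.+1 = fun x => sqrt_iter f n x +
  2^-1 * (f x * f x - sqrt_iter f n x * sqrt_iter f n x))//.
by apply: clsD => //; apply: clsZ; apply: clsB; exact: clsM.
Qed.

Let geom (a c : R) : 0 <= a < 1 -> (fun n => c * a ^+ n) @ \oo --> 0.
Proof.
by move=> /andP[a0 a1]; apply: (cvg_geometric c); rewrite ger0_norm.
Qed.

Let cls_norm1 f : cls f -> (forall x, `|f x| <= 1) -> cls (fun x => `|f x|).
Proof.
move=> cf f1; apply: (BoundedLim (M := 1) (fun n => cls_sqrt_iter n cf)).
  move=> n x; have [/andP[p0 pf] _] := sqrt_iter_bound n (f1 x).
  by rewrite ger0_norm// (le_trans pf).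
move=> x; have [f0|f0] := eqVneq `|f x| 0.
  have E n : sqrt_iter f n x = 0.
    have [/andP[p0 pf] _] := sqrt_iter_bound n (f1 x).
    by apply/eqP; rewrite eq_le p0 -f0 pf.
  by under eq_fun do rewrite E; rewrite f0; exact: cvg_cst.
have fp : 0 < `|f x| by rewrite lt_def f0 normr_ge0.
apply: (@squeeze_cvgr _ _ _ _ (fun n => `|f x| - `|f x| * (1 - `|f x| / 2) ^+ n) (fun=> `|f x|)).
- apply: nearW => n; have [/andP[p0 pf] h] := sqrt_iter_bound n (f1 x).
  by rewrite pf andbT; lra.
- rewrite -[X in _ --> X]subr0; apply: cvgB; first exact: cvg_cst.
  by apply: geom; have h1 := f1 x; apply/andP; split; lra.
- exact: cvg_cst.
Qed.

Let cls_pos f : cls f -> cls (\1_[set x | 0 < f x]).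
Proof.
move=> cf; have [M M0 hM] := cls_bounded cf.
pose g x := M^-1 * f x; have cg : cls g := clsZ _ cf.
have g1 x : `|g x| <= 1.
  by rewrite normrM gtr0_norm ?invr_gt0// mulrC ler_pdivrMr// mul1r.
(* [h] is the positive part of [f] scaled into the unit interval, so [1 - (1 - h) ^ n] tends to the
   indicator of [0 < f]. *)
pose h x := 2^-1 * (`|g x| + g x).
have ch : cls h by apply/clsZ/clsD => //; exact: cls_norm1.
have h01 x : 0 <= h x <= 1.
  rewrite /h; have := ler_norm (g x); have := ler_norm (- g x); rewrite normrN.
  by have := g1 x => *; apply/andP; split; lra.
have hpos x : 0 < f x -> 0 < h x.
  move=> fx; have gx : 0 < g x by rewrite mulr_gt0// invr_gt0.
  by rewrite /h gtr0_norm// mulr_gt0// addr_gt0.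
have hneg x : f x <= 0 -> h x = 0.
  move=> fx; have gx : g x <= 0 by rewrite pmulr_rle0// invr_gt0.
  by rewrite /h ler0_norm// addNr mulr0.
have cpow n : cls (fun x => (1 - h x) ^+ n).
  elim: n => [|n IH]; first by under eq_fun do rewrite expr0.
  by under eq_fun do rewrite exprS; apply: clsM => //; exact: clsB.
apply: (BoundedLim (M := 1) (fun n => clsB A_one (cpow n))) => [n x|x].
  have /andP[h0 h1] := h01 x.
  have p0 : 0 <= (1 - h x) ^+ n by rewrite exprn_ge0// subr_ge0.
  have p1 : (1 - h x) ^+ n <= 1 by rewrite exprn_ile1 ?subr_ge0// gerBl.
  by rewrite ger0_norm ?subr_ge0// gerBl.
rewrite indicE; have [fx|fx] := ltP 0 (f x).
  rewrite mem_set// -[X in _ --> X]subr0; apply: cvgB; first exact: cvg_cst.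
  rewrite -[X in X @ _](_ : (fun n => 1 * (1 - h x) ^+ n) = _); last first.
    by apply/funext => n; rewrite mul1r.
  by apply: geom; have := hpos x fx; have /andP[] := h01 x => *; apply/andP; split; lra.
rewrite memNset/=; last by rewrite ltNge fx.
under eq_fun do rewrite hneg// subr0 expr1n subrr; exact: cvg_cst.
Qed.

Let cls_setI X Y : cls (\1_X) -> cls (\1_Y) -> cls (\1_(X `&` Y)).
Proof. by move=> cX cY; rewrite indicI; exact: clsM. Qed.

Let cls_setC X : cls (\1_X) -> cls (\1_(~` X)).
Proof.
move=> cX; have := clsB A_one cX; rewrite (_ : (fun x => _) = \1_(~` X))//.
by apply/funext => x; rewrite !indicE in_setC; case: (x \in X); rewrite ?subrr ?subr0.
Qed.

Let cls_sigma : sigma_algebra setT [set X | cls (\1_X)].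
Proof.
split=> /= [|X cX|X cX]; first by rewrite indic0; exact: cls0.
  by rewrite setTD; exact: cls_setC.
pose Y n := \bigcup_(k < n) X k.
have cY n : cls (\1_(Y n)).
  elim: n => [|n IH]; first by rewrite /Y bigcup_mkord big_ord0 indic0; exact: cls0.
  rewrite /Y bigcup_mkord big_ord_recr /= -bigcup_mkord -[_ `|` _]setCK setCU.
  by apply/cls_setC/cls_setI; exact: cls_setC.
apply: (BoundedLim (M := 1) cY) => [n x|x].
  by rewrite indicE; case: (_ \in _); rewrite ?normr1 ?normr0.
have [[k _ Xk]|nX] := pselect ((\bigcup_k X k) x).
  rewrite indicE mem_set; last by exists k.
  apply: cvg_near_cst; exists k.+1 => // n /= kn.
  by rewrite indicE mem_set//; exists k.
rewrite indicE memNset//; apply: cvg_near_cst; apply: nearW => n.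
by rewrite indicE memNset// => -[k _ Xk]; apply: nX; exists k.
Qed.

Let cls_measurable X : measurable X -> cls (\1_X).
Proof.
apply: A_generate cls_sigma _ _ => f a Af /=.
have := cls_pos (clsB (BoundedGen Af) (cls_cst a)).
by under eq_set do rewrite subr_gt0.
Qed.

Lemma bounded_class_measurable (f : T -> R) (M : R) : measurable_fun setT f ->
  (forall x, `|f x| <= M) -> cls f.
Proof.
have nn (g : T -> R) (N : R) : measurable_fun setT g -> (forall x, 0 <= g x <= N) -> cls g.
  move=> mg g0N; have mg' : measurable_fun setT (EFin \o g) by exact/measurable_EFinP.
  have g0 x : setT x -> (0 <= (EFin \o g) x)%E by rewrite lee_fin; case/andP: (g0N x).
  pose sn := nnsfun_approx measurableT mg'; pose s n : T -> R := sn n.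
  have sle n x : 0 <= s n x <= g x.
    apply/andP; split; first exact: fun_ge0.
    by rewrite -lee_fin /s /sn nnsfun_approxE; exact: le_approx.
  apply: (BoundedLim (u := s) (M := N)) => [n|n x|x].
  - have /funext E := fimfunEord (sn n); rewrite /s E.
    by apply: cls_sum => i; apply: clsZ; apply: cls_measurable.
  - have /andP[s0 sg] := sle n x; rewrite ger0_norm// (le_trans sg)//.
    by case/andP: (g0N x).
  - have := cvg_nnsfun_approx measurableT mg' g0 (x := x) I.
    by move/fine_cvgP => [].
(* Adding [M] reduces to the nonnegative case, where simple functions approximate from below. *)
move=> mf hM; have := nn (fun x => f x + M) (M + M) => h.
have : cls (fun x => f x + M).
  apply: h => [|x]; first exact: measurable_funD.
  by have := hM x; rewrite ler_norml => /andP[*]; apply/andP; split; lra.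
move=> /clsB/(_ (cls_cst M)); rewrite (_ : (fun x => _) = f)//.
by apply/funext => x; rewrite addrK.
Qed.

End BoundedClass.

(** * The dual group and its Haar measure *)

Section DualTopology.
Variables (R : realType) (H : zmodType).
Local Notation C := R[i].
Local Notation Re := (@complex.Re R).
Local Notation Im := (@complex.Im R).
Local Notation dual := (dual R H).
Local Notation K := (R[i] : numFieldType).

Lemma dual_eval_continuous (h : H) : continuous (fun chi : dual => (chi : character R H) h : K).
Proof.
move=> chi.
have h1 := @initial_continuous _ _ (@character_val R H : character R H -> {ptws H -> K}) chi.
have h2 := @proj_continuous _ (fun=> K : topologicalType) h
  (character_val (chi : character R H) : {ptws H -> K}).
move=> U /h2 hU.
exact: h1 hU.
Qed.

Lemma normc_lt (z : C) (e : R) : `|z| < e%:C%C -> `|Re z| < e /\ `|Im z| < e.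
Proof.
rewrite normc_def ltcR => h; split; apply: le_lt_trans h.
  by rewrite -sqrtr_sqr ler_wsqrtr// lerDl sqr_ge0.
by rewrite -sqrtr_sqr ler_wsqrtr// lerDr sqr_ge0.
Qed.

Lemma normc_le_ReIm (z : C) : `|z| <= (`|Re z| + `|Im z|)%:C%C.
Proof.
rewrite normc_def lecR -[leRHS]ger0_norm ?addr_ge0// -sqrtr_sqr ler_wsqrtr//.
by rewrite sqrrD !real_normK ?num_real// [leRHS]addrAC lerDl mulrn_wge0// mulr_ge0.
Qed.

Lemma open_dual_part (u : C -> R) (h : H) (a : R) :
  (forall z w, u (z - w) = u z - u w) ->
  (forall z (e : R), `|z| < e%:C%C -> `|u z| < e) ->
  open [set chi : dual | a < u ((chi : character R H) h)].
Proof.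
move=> uB ule; rewrite openE => chi /= ac.
pose e := u ((chi : character R H) h) - a.
have e0 : 0 < e by rewrite subr_gt0.
have ec0 : (0 : K) < e%:C%C by rewrite ltcR.
have /cvgrPdist_lt /(_ _ ec0) := @dual_eval_continuous h chi.
apply: filterS => psi /ule; rewrite uB => /(le_lt_trans (ler_norm _)).
by rewrite /e /= ltrD2l ltrN2.
Qed.

Lemma open_dual_Re (h : H) (a : R) : open [set chi : dual | a < Re ((chi : character R H) h)].
Proof.
apply: open_dual_part => [[? ?] [? ?]|z e /normc_lt[]] //.
Qed.

Lemma open_dual_Im (h : H) (a : R) : open [set chi : dual | a < Im ((chi : character R H) h)].
Proof.
apply: open_dual_part => [[? ?] [? ?]|z e /normc_lt[]] //.
Qed.

Lemma dual_cvg (u : nat -> dual) (chi : dual) :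
  (forall h, (fun n => Re ((u n : character R H) h)) @ \oo --> Re ((chi : character R H) h)) ->
  (forall h, (fun n => Im ((u n : character R H) h)) @ \oo --> Im ((chi : character R H) h)) ->
  u @ \oo --> chi.
Proof.
move=> hr hi U [_ [[P Pop <-] Pchi PU]].
have cv : (fun n => character_val (u n : character R H) : {ptws H -> K}) @ \oo -->
    (character_val (chi : character R H) : {ptws H -> K}).
  apply/cvg_sup => h V [_ [[B Bop <-] Bc BV]].
  have ce : (fun n => (u n : character R H) h : K) @ \oo --> ((chi : character R H) h : K).
    apply/cvgrPdist_lt => e e0.
    have eE : e = (Re e)%:C%C by rewrite RRe_real// gtr0_real.
    have re0 : 0 < Re e / 2 by rewrite divr_gt0// -ltcR -eE.
    have /cvgrPdist_lt/(_ _ re0) h1 := hr h; have /cvgrPdist_lt/(_ _ re0) h2 := hi h.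
    near=> n; apply: le_lt_trans (normc_le_ReIm _) _; rewrite eE ltcR.
    have : `|Re ((chi : character R H) h) - Re ((u n : character R H) h)| < Re e / 2 by near: n.
    have : `|Im ((chi : character R H) h) - Im ((u n : character R H) h)| < Re e / 2 by near: n.
    case: ((chi : character R H) h) ((u n : character R H) h) => [? ?] [? ?] /=; lra.
  have hB : \forall n \near \oo, B ((u n : character R H) h).
    exact: (ce B (open_nbhs_nbhs (conj Bop Bc))).
  suff : \forall n \near \oo, V (character_val (u n : character R H)) by [].
  by apply: filterS hB => n; exact: BV.
have hP : \forall n \near \oo, P (character_val (u n : character R H)).
  exact: (cv P (open_nbhs_nbhs (conj Pop Pchi))).
suff : \forall n \near \oo, U (u n) by [].
by apply: filterS hP => n; exact: PU.
Unshelve. all: by end_near. Qed.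

End DualTopology.

(** * Generation of the Borel sets of the dual by evaluations *)

Section DualBorel.
Variables (R : realType) (H : countZmodType).
Local Notation C := R[i].
Local Notation Re := (@complex.Re R).
Local Notation Im := (@complex.Im R).
Local Notation dual := (dual R H).
Local Notation borel := (borel_dual R H).

Definition coord (b : bool) (h : H) (chi : borel) : R :=
  let z := (chi : character R H) h in if b then Re z else Im z.

(** Rational thresholds and countable [H] leave countably many half-spaces; the strict and the weak
    ones together control a coordinate from both sides. *)
Let halfspace (k : H * bool * bool * rat) : set borel :=
  let: (h, b, s, q) := k in
  [set chi | if s then ratr q < coord b h chi else coord b h chi <= ratr q].

Let box (l : seq (H * bool * bool * rat)) : set borel :=
  [set chi | forall k, k \in l -> halfspace k chi].

(** Otherwise a character outside [U] could be chosen in each box cut out by those of the first [n]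
    half-spaces that contain [chi]; these characters converge to [chi] in every coordinate, hence in
    the dual, although [U] is open. *)
Let open_box (U : set dual) (chi : dual) : open U -> U chi ->
  exists l, box l chi /\ box l `<=` U.
Proof.
move=> Uop Uchi; apply: contrapT => hN.
pose l n := [seq k <- pmap unpickle (iota 0 n) | `[< halfspace k chi >]].
have lchi n : box (l n) chi.
  by move=> k; rewrite mem_filter => /andP[/asboolP].
have /choice[u hu] n : exists psi : dual, box (l n) psi /\ ~ U psi.
  apply: contrapT => hn; apply: hN; exists (l n); split=> // psi bpsi.
  by apply: contrapT => nU; apply: hn; exists psi.
have ev k : halfspace k chi -> \forall n \near \oo, halfspace k (u n).
  move=> kchi; exists (pickle k).+1 => // n /= kn.
  have [bn _] := hu n; apply: bn; rewrite mem_filter; apply/andP; split; first exact/asboolP.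
  by rewrite mem_pmap -(pickleK k) map_f// mem_iota.
have cv b h : (fun n => coord b h (u n)) @ \oo --> coord b h chi.
  apply/cvgrPdist_lt => e e0.
  have lt1 : coord b h chi - e < coord b h chi by rewrite gtrBl.
  have lt2 : coord b h chi < coord b h chi + e by rewrite ltrDl.
  have [q] := rat_in_itvoo lt1; rewrite in_itv /= => /andP[q1 q2].
  have [r] := rat_in_itvoo lt2; rewrite in_itv /= => /andP[r1 r2].
  have := ev (h, b, true, q) q2; have := ev (h, b, false, r) (ltW r1).
  apply: filterS2 => n /= h1 h2; rewrite ltr_distlC; apply/andP; split; lra.
have : u @ \oo --> chi by apply: dual_cvg => h; [exact: (cv true h)|exact: (cv false h)].
move=> /(_ U (open_nbhs_nbhs (conj Uop Uchi))) [n _ /(_ n (leqnn n)) Un].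
by have [] := hu n.
Qed.

(** An open set is the union of the boxes it contains, and there are only countably many boxes. *)
Lemma dual_generate (D : set (set borel)) : sigma_algebra setT D ->
  (forall b h a, D [set chi | a < coord b h chi]) ->
  forall X, measurable X -> D X.
Proof.
move=> [D0 DC DU] Dc; apply: smallest_sub => // U Uop.
have DC' X : D X -> D (~` X) by move=> /DC; rewrite setTD.
have DI X Y : D X -> D Y -> D (X `&` Y).
  move=> DX DY; rewrite -[_ `&` _]setCK setCI -bigcup2E; apply/DC'/DU => i.
  by rewrite /bigcup2; case: ifPn => _; [exact: DC'|case: ifPn => _ //; exact: DC'].
have Dh k : D (halfspace k).
  case: k => [[[h b] [|]] q]; first exact: Dc.
  have := DC' _ (Dc b h (ratr q)); congr (D _); apply/seteqP; split=> chi /=;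
  by rewrite leNgt => /negP.
have Db l : D (box l).
  elim: l => [|k l IH].
    rewrite (_ : box [::] = setT); first by rewrite -setC0; exact: DC'.
    by apply/seteqP; split.
  rewrite (_ : box _ = halfspace k `&` box l); first exact: DI.
  apply/seteqP; split=> chi /=.
    by move=> h; split; [apply: h; rewrite mem_head|move=> j jl; apply: h; rewrite inE jl orbT].
  by move=> [hk hl] j; rewrite inE => /orP[/eqP ->|/hl].
pose F n : set borel := if unpickle n is Some l then
  (if `[< box l `<=` U >] then box l else set0) else set0.
rewrite (_ : U = \bigcup_n F n).
  by apply: DU => n; rewrite /F; case: unpickle => // l; case: ifPn.
apply/seteqP; split=> [chi Uchi|chi [n _]].
  have [l [lchi lU]] := open_box Uop Uchi.
  by exists (pickle l) => //; rewrite /F pickleK asboolT.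
by rewrite /F; case: unpickle => // l; case: ifPn => // /asboolP lU /lU.
Qed.

Lemma measurable_coord b h : measurable_fun setT (coord b h).
Proof.
have cop : forall a, open [set chi : dual | a < coord b h chi].
  by move=> a; case: b; [exact: open_dual_Re|exact: open_dual_Im].
apply: (measurability _ (RGenOInfty.measurableE R)) => //.
move=> _ [_ [a ->] <-]; apply: measurableI => //.
apply: sub_sigma_algebra; rewrite (_ : _ @^-1` _ = [set chi : dual | a < coord b h chi])//.
by apply/seteqP; split=> chi /=; rewrite in_itv /= andbT.
Qed.

End DualBorel.

Section DualMonotoneClass.
Variables (R : realType) (H : countZmodType).
Local Notation C := R[i].
Local Notation Re := (@complex.Re R).
Local Notation Im := (@complex.Im R).
Local Notation borel := (borel_dual R H).
Implicit Types chi : borel.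

Lemma character_D (chi : character R H) (x y : H) : chi (x + y) = chi x * chi y.
Proof. by case: chi => c /= /asboolP[]. Qed.

Lemma character_norm (chi : character R H) (x : H) : `|chi x| = 1.
Proof. by case: chi => c /= /asboolP[]. Qed.

Lemma character_0 (chi : character R H) : chi 0 = 1.
Proof.
have n0 : chi 0 != 0 by rewrite -normr_eq0 character_norm oner_eq0.
by apply: (mulfI n0); rewrite -character_D addr0 mulr1.
Qed.

Lemma character_N (chi : character R H) (x : H) : chi (- x) = (chi x)^*.
Proof.
have n0 : chi x != 0 by rewrite -normr_eq0 character_norm oner_eq0.
by apply: (mulfI n0); rewrite -character_D subrr character_0 -normCK character_norm expr1n.
Qed.

Lemma normsq_char (chi : character R H) (x : H) : normsq (chi x) = 1.
Proof. by apply: complexI; rewrite normsqE character_norm expr1n. Qed.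

Lemma coord_bound b h chi : `|coord b h chi| <= 1.
Proof.
have := normsq_char chi h; rewrite /normsq => e.
rewrite -(ler_pXn2r (n := 2)) ?nnegrE// expr1n real_normK ?num_real// -e.
by case: b; rewrite /coord ?lerDl ?lerDr sqr_ge0.
Qed.

(** The span of the coordinates is already an algebra, by the product-to-sum formulas with [h + k]
    and [h - k], so the monotone class theorem applies to the coordinates directly. *)
Lemma dual_monotone_class (P : (borel -> R) -> Prop) :
  (forall b h, P (coord b h)) ->
  (forall a f g, P f -> P g -> P (fun x => a * f x + g x)) ->
  (forall (u : nat -> borel -> R) f (M : R), (forall n, P (u n)) ->
    (forall n x, `|u n x| <= M) -> (forall n, measurable_fun setT (u n)) ->
    (forall x, u^~ x @ \oo --> f x) -> P f) ->
  forall (f : borel -> R) (M : R), measurable_fun setT f -> (forall x, `|f x| <= M) -> P f.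
Proof.
move=> Pc Pl Pu f M mf fM.
pose A : set (borel -> R) := [set g | exists b h, g = coord b h].
have cM g : bounded_class A g -> measurable_fun setT g.
  elim=> {g} [_ [b [h ->]]|a g k _ mg _ mk|u g N _ mu _ ug].
  - exact: measurable_coord.
  - by apply: measurable_funD => //; exact: measurable_funM.
  - by apply: (measurable_fun_cvg (h := u)) => // x _; exact: ug.
suff : bounded_class A f.
  elim=> {f mf fM} [_ [b [h ->]]|a g k _ hg _ hk|u g N cu hu uN ug].
  - exact: Pc.
  - exact: Pl.
  - by apply: Pu hu uN _ ug => n; exact: cM.
apply: bounded_class_measurable mf fM.
- by move=> _ [b [h ->]]; exists 1 => x; exact: coord_bound.
- move=> _ _ [b [h ->]] [c [k ->]].
  have gA b' h' : bounded_class A (coord b' h') by apply: BoundedGen; exists b', h'.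
  have lin2 (p q : R) b' h' k' : bounded_class A
      (fun x => p * coord b' h' x + q * coord b' k' x).
    apply: BoundedLin => //.
    (* The inner combination is the zero function: [BoundedLin] always adds a second summand. *)
    have := BoundedLin q (gA b' k') (BoundedLin (-1) (gA b' k') (gA b' k')).
    rewrite (_ : (fun x => _) = fun x => q * coord b' k' x)//; apply/funext => x.
    by rewrite mulN1r addNr addr0.
  have chiB x : (x : character R H) (h - k) =
      (x : character R H) h * ((x : character R H) k)^* by rewrite character_D character_N.
  case: b; case: c.
  + rewrite (_ : (fun x => _) =
      fun x => 2^-1 * coord true (h + k) x + 2^-1 * coord true (h - k) x)//.
    apply/funext => x; rewrite /coord chiB character_D.
    by case: ((x : character R H) h) ((x : character R H) k) => [? ?] [? ?] /=; lra.
  + rewrite (_ : (fun x => _) =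
      fun x => 2^-1 * coord false (h + k) x + (- 2^-1) * coord false (h - k) x)//.
    apply/funext => x; rewrite /coord chiB character_D.
    by case: ((x : character R H) h) ((x : character R H) k) => [? ?] [? ?] /=; lra.
  + rewrite (_ : (fun x => _) =
      fun x => 2^-1 * coord false (h + k) x + 2^-1 * coord false (h - k) x)//.
    apply/funext => x; rewrite /coord chiB character_D.
    by case: ((x : character R H) h) ((x : character R H) k) => [? ?] [? ?] /=; lra.
  + rewrite (_ : (fun x => _) =
      fun x => 2^-1 * coord true (h - k) x + (- 2^-1) * coord true (h + k) x)//.
    apply/funext => x; rewrite /coord chiB character_D.
    by case: ((x : character R H) h) ((x : character R H) k) => [? ?] [? ?] /=; lra.
- rewrite (_ : (fun=> 1) = coord true 0); first by apply: BoundedGen; exists true, 0.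
  by apply/funext => x; rewrite /coord character_0.
- move=> D sD hD; apply: dual_generate => // b h a.
  by apply: hD; exists b, h.
Qed.

End DualMonotoneClass.

(** * Invariance of Haar measure and integrals of characters *)

Section Haar.
Variables (R : realType) (H : countZmodType).
Variable mu : {measure set (borel_dual R H) -> \bar R}.
Hypothesis mu_haar : haar mu.
Local Notation C := R[i].
Local Notation Re := (@complex.Re R).
Local Notation Im := (@complex.Im R).
Local Notation borel := (borel_dual R H).

Lemma haar_integrable (f : borel -> R) (M : R) : measurable_fun setT f ->
  (forall x, `|f x| <= M) -> mu.-integrable setT (EFin \o f).
Proof.
move=> mf fM; have [_ mufin _] := mu_haar.
have M0 : 0 <= M by exact: le_trans (normr_ge0 _) (fM (character1 R H)).
apply: measurable_bounded_integrable => //.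
by exists M; split; [exact: num_real|move=> N MN x _; exact: le_trans (fM x) (ltW MN)].
Qed.

Lemma is_character_conj (psi : character R H) :
  `[< is_character (fun x => (psi x)^*) >].
Proof.
by apply/asboolP; split=> [x y|x]; rewrite ?norm_conjC ?character_norm// character_D rmorphM.
Qed.

Definition character_inv (psi : character R H) := Character (is_character_conj psi).

Definition translate (psi : character R H) (chi : borel) : borel :=
  character_mul psi (chi : character R H).

Lemma measurable_translate psi : measurable_fun setT (translate psi).
Proof.
move=> _ X mX; rewrite setTI; move: X mX; apply: dual_generate.
  split=> [|X mX|F mF] /=; first by rewrite preimage_set0.
    by rewrite setTD preimage_setC; exact: measurableC.
  by rewrite preimage_bigcup; exact: bigcup_measurable.
move=> b h a /=.
have -> : translate psi @^-1` [set chi | a < coord b h chi] = 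
   (fun chi => (if b then Re (psi h) else Im (psi h)) * coord true h chi +
     (if b then - Im (psi h) else Re (psi h)) * coord false h chi) @^-1` `]a, +oo[%classic.
  apply/seteqP; split=> chi /=; rewrite in_itv /= andbT /coord /=;
  by case: b (psi h) ((chi : character R H) h) => -[? ?] [? ?] /=;
  rewrite ?mulNr// addrC [X in X + _]mulrC.
rewrite -[X in measurable X]setTI.
have : measurable_fun setT (fun chi => (if b then Re (psi h) else Im (psi h)) * coord true h chi +
     (if b then - Im (psi h) else Re (psi h)) * coord false h chi).
  by apply: measurable_funD; apply: measurable_funM => //; exact: measurable_coord.
by apply => //; exact: measurable_itv.
Qed.

(** [haar] speaks of images; the preimage under translation by [psi] is the image under translation
    by the conjugate character. *)
Lemma haar_translate psi X : measurable X -> mu (translate psi @^-1` X) = mu X.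
Proof.
move=> mX; have [_ _ /(_ (character_inv psi) X mX) <-] := mu_haar; congr (mu _).
have K1 (chi : character R H) x : psi x * ((psi x)^* * chi x) = chi x.
  by rewrite mulrA -normCK character_norm expr1n mul1r.
have K2 (chi : character R H) x : (psi x)^* * (psi x * chi x) = chi x.
  by rewrite mulrA [_^* * _]mulrC -normCK character_norm expr1n mul1r.
apply/seteqP; split=> [chi Xc|_ [chi Xc <-]].
  exists (translate psi chi) => //.
  by apply/val_inj/funext => x; exact: K2.
rewrite /preimage /= (_ : translate _ _ = chi)//.
by apply/val_inj/funext => x; exact: K1.
Qed.

Lemma haar_Rintegral psi (f : borel -> R) (M : R) : measurable_fun setT f ->
  (forall x, `|f x| <= M) ->
  \int[mu]_x f (translate psi x) = \int[mu]_x f x.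
Proof.
move=> mf fM; rewrite /Rintegral; congr fine.
have mt := measurable_translate psi.
have := @integral_pushforward _ _ _ _ R _ mt mu setT (EFin \o f).
rewrite preimage_setT /= => <- //.
- apply: eq_measure_integral => X mX _; exact: haar_translate.
- by apply/measurable_EFinP.
- apply: (@haar_integrable (f \o translate psi) M) => //.
    exact: measurableT_comp.
  by move=> x; exact: fM.
Qed.

Lemma haar_cintegrable (f : borel -> C) (M : R) : measurable_fun setT (Re \o f) ->
  measurable_fun setT (Im \o f) -> (forall x, normsq (f x) <= M ^+ 2) -> 0 <= M ->
  cintegrable mu f.
Proof.
move=> mr mi fM M0.
split; apply/Lfun1_integrable; apply: (@haar_integrable _ M) => // x;
rewrite -(ler_pXn2r (n := 2)) ?nnegrE// real_normK ?num_real// /=;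
by apply: le_trans (fM x); rewrite /normsq ?lerDl ?lerDr sqr_ge0.
Qed.

(** Translating by [psi] multiplies the integrand by [psi h], so by invariance the integral is fixed
    under multiplication by a number other than 1. *)
Lemma cintegral_char (h : H) (psi : character R H) : psi h != 1 ->
  cintegral mu (fun chi => (chi : character R H) h) = 0.
Proof.
move=> ph; set z := cintegral _ _.
have ci : cintegrable mu (fun chi => (chi : character R H) h).
  apply: (@haar_cintegrable _ 1) => //; last by move=> x; rewrite normsq_char expr1n.
    exact: (measurable_coord true h).
  exact: (measurable_coord false h).
have c0 : cintegrable mu (fun=> 0).
  apply: (@haar_cintegrable _ 1) => //; [exact: measurable_cst..|move=> x].
  by rewrite /normsq /= expr0n addr0 expr1n.
(* The summand 0 gives the integrand the shape expected by [cintegralZD]. *)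
have e1 : cintegral mu (fun chi => psi h * (chi : character R H) h + 0) = psi h * z + 0.
  rewrite cintegralZD//; congr (_ + _).
  by apply/eqP; rewrite eq_complex /= /Rintegral !integral0_eq ?eqxx.
have e2 : cintegral mu (fun chi => psi h * (chi : character R H) h + 0) = z.
  under [X in cintegral _ X]eq_fun do rewrite addr0.
  apply/eqP; rewrite eq_complex /=; apply/andP; split; apply/eqP.
    exact: (haar_Rintegral psi (measurable_coord true h) (coord_bound true h)).
  exact: (haar_Rintegral psi (measurable_coord false h) (coord_bound false h)).
move: e1; rewrite e2 addr0 => /eqP; rewrite -subr_eq0 -{1}[z]mul1r -mulrBl mulf_eq0.
by rewrite subr_eq0 eq_sym (negbTE ph) => /eqP.
Qed.

End Haar.

(** * Circle-valued Borel functions *)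

Section CircleAngle.
Variable R : realType.
Local Notation C := R[i].
Local Notation Re := (@complex.Re R).
Local Notation Im := (@complex.Im R).

(* Clamping makes the arccosine monotone on the whole line, hence measurable. *)
Definition acos_clamp (x : R) : R := acos (Num.max (-1) (Num.min 1 x)).

Lemma measurable_acos_clamp : measurable_fun setT acos_clamp.
Proof.
apply: nonincreasing_measurable => // x y xy.
have cl (z : R) : Num.max (-1) (Num.min 1 z) \in `[(-1), 1].
  by rewrite in_itv /= le_max lexx ge_max ge_min lexx /= andbT; lra.
have hacos (z : R) : acos (Num.max (-1) (Num.min 1 z)) \in `[0, pi].
  by have := cl z; rewrite !in_itv /= => h; rewrite acos_ge0// acos_lepi.
rewrite leNgt -(ltr_cos (hacos _) (hacos _)) !acosK// -leNgt.
rewrite ge_max !le_max; apply/andP; split; apply/orP; [left; lra|right].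
rewrite le_min !ge_min; apply/andP; split; apply/orP; [left; lra|by right].
Qed.

(** A Borel argument between minus pi and pi; its jump across the negative axis is harmless for
    measurability. *)
Definition angle (z : C) : R :=
  if 0 <= Im z then acos_clamp (Re z) else - acos_clamp (Re z).

Lemma angleE (z : C) : normsq z = 1 -> cos (angle z) = Re z /\ sin (angle z) = Im z.
Proof.
rewrite /normsq => e.
have hz : -1 <= Re z <= 1.
  by rewrite -ler_norml -(ler_pXn2r (n := 2)) ?nnegrE// expr1n real_normK ?num_real//
    -e lerDl sqr_ge0.
have cz : Num.max (-1) (Num.min 1 (Re z)) = Re z.
  by case/andP: hz => h1 h2; rewrite (min_idPr h2) (max_idPr h1).
have cE : cos (acos_clamp (Re z)) = Re z by rewrite /acos_clamp cz acosK// in_itv.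
have sE : sin (acos_clamp (Re z)) = `|Im z|.
  by rewrite /acos_clamp cz sin_acos// -e addrC addKr sqrtr_sqr.
rewrite /angle; case: ifPn => [h|]; rewrite ?cosN ?sinN cE sE; first by rewrite ger0_norm.
by rewrite -ltNge => h; rewrite ltr0_norm// opprK.
Qed.

Lemma de_moivre (a : R) n :
  (Complex (cos a) (sin a)) ^+ n = Complex (cos (a *+ n)) (sin (a *+ n)).
Proof.
elim: n => [|n IH]; first by rewrite !mulr0n cos0 sin0.
by rewrite exprS IH mulrS cosD sinD /=; congr Complex; rewrite addrC.
Qed.

Lemma nontrivial_root_of_unity (m : nat) : (1 < m)%N ->
  exists z : C, [/\ `|z| = 1, z ^+ m = 1 & z != 1].
Proof.
(* A root of [1 + X + ... + X ^ m] is an [m.+1]-th root of unity, and it is not 1, where the sum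
   takes the nonzero value [m.+1]. *)
case: m => [|m] // m1; pose p : {poly C} := \poly_(i < m.+1) 1.
have sp : size p = m.+1 by rewrite size_poly_eq// oner_eq0.
have : size p != 1%N by rewrite sp; case: m m1 {p sp}.
move=> /closed_rootP[z /rootP pz].
have sE : \sum_(i < m.+1) z ^+ i = 0.
  by rewrite -[RHS]pz /p horner_poly; apply: eq_bigr => i _; rewrite mul1r.
have zE : z ^+ m.+1 = 1 by apply/eqP; rewrite -subr_eq0 subrX1 sE mulr0.
exists z; split=> //.
  by apply/eqP; rewrite -(@pexpr_eq1 _ _ m.+1)// -normrX zE normr1.
apply/eqP => z1; move: pz; rewrite z1 /p horner_poly.
under eq_bigr => i _ do rewrite expr1n mulr1.
by rewrite sumr_const card_ord => /eqP; rewrite pnatr_eq0.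
Qed.

End CircleAngle.

Section CircleFun.
Context d (T : measurableType d) (R : realType).
Local Notation C := R[i].
Local Notation Re := (@complex.Re R).
Local Notation Im := (@complex.Im R).

(** Modulus one is required at every point rather than almost everywhere, so that pointwise
    multiplication gives a group without passing to classes. *)
Definition is_circle_fun (f : T -> C) : Prop :=
  [/\ measurable_fun setT (Re \o f), measurable_fun setT (Im \o f) &
      forall x, normsq (f x) = 1].

Record circle_fun := CircleFun {
  circle_val :> T -> C ; circle_valP : `[< is_circle_fun circle_val >] }.
HB.instance Definition _ := [isSub for circle_val].
HB.instance Definition _ := [Choice of circle_fun by <:].

Lemma normsq1 : normsq (1 : C) = 1.
Proof. by apply: complexI; rewrite normsqE normr1 expr1n. Qed.

Lemma normsqJ (z : C) : normsq z^* = normsq z.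
Proof. by apply: complexI; rewrite !normsqE norm_conjC. Qed.

Lemma measurable_complexM (f g : T -> C) :
  measurable_fun setT (Re \o f) -> measurable_fun setT (Im \o f) ->
  measurable_fun setT (Re \o g) -> measurable_fun setT (Im \o g) ->
  measurable_fun setT (Re \o (fun x => f x * g x)) /\
  measurable_fun setT (Im \o (fun x => f x * g x)).
Proof.
move=> fr fi gr gi; split.
  rewrite (_ : _ \o _ = fun x => Re (f x) * Re (g x) - Im (f x) * Im (g x)).
    by apply: measurable_funB; exact: measurable_funM.
  by apply/funext => x /=; case: (f x) (g x) => ? ? [? ?].
rewrite (_ : _ \o _ = fun x => Re (f x) * Im (g x) + Im (f x) * Re (g x)).
  by apply: measurable_funD; exact: measurable_funM.
by apply/funext => x /=; case: (f x) (g x) => ? ? [? ?].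
Qed.

Lemma measurable_complexJ (f : T -> C) :
  measurable_fun setT (Re \o f) -> measurable_fun setT (Im \o f) ->
  measurable_fun setT (Re \o (fun x => (f x)^*)) /\
  measurable_fun setT (Im \o (fun x => (f x)^*)).
Proof.
move=> fr fi; split.
  by rewrite (_ : _ \o _ = Re \o f)//; apply/funext => x /=; case: (f x).
rewrite (_ : _ \o _ = (fun x => - Im (f x)) ); first exact: measurableT_comp.
by apply/funext => x /=; case: (f x).
Qed.

Lemma circle1_subproof : `[< is_circle_fun (fun=> 1) >].
Proof. by apply/asboolP; split=> [||x]; rewrite ?normsq1//; exact: measurable_cst. Qed.

Lemma circleM_subproof (f g : circle_fun) : `[< is_circle_fun (fun x => f x * g x) >].
Proof.
have [/asboolP[fr fi f1] /asboolP[gr gi g1]] := (circle_valP f, circle_valP g).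
apply/asboolP; have [mr mi] := measurable_complexM fr fi gr gi; split=> // x.
by rewrite normsqM f1 g1 mulr1.
Qed.

Lemma circleV_subproof (f : circle_fun) : `[< is_circle_fun (fun x => (f x)^*) >].
Proof.
have /asboolP[fr fi f1] := circle_valP f.
by apply/asboolP; have [mr mi] := measurable_complexJ fr fi; split=> // x; rewrite normsqJ.
Qed.

Definition circle1 := CircleFun circle1_subproof.
Definition circleM f g := CircleFun (circleM_subproof f g).
Definition circleV f := CircleFun (circleV_subproof f).

Lemma circleMA : associative circleM.
Proof. by move=> f g h; apply/val_inj/funext => x; exact: mulrA. Qed.
Lemma circleMC : commutative circleM.
Proof. by move=> f g; apply/val_inj/funext => x; exact: mulrC. Qed.
Lemma circle1M : left_id circle1 circleM.
Proof. by move=> f; apply/val_inj/funext => x; exact: mul1r. Qed.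
Lemma circleVM : left_inverse circle1 circleV circleM.
Proof.
move=> f; apply/val_inj/funext => x; have /asboolP[_ _ f1] := circle_valP f.
by rewrite /= mulrC normsq_conj f1.
Qed.

(* Pointwise multiplication, written additively. *)
HB.instance Definition _ := GRing.isZmodule.Build circle_fun
  circleMA circleMC circle1M circleVM.

Lemma circle_valM (f g : circle_fun) x : (f + g) x = f x * g x.
Proof. by []. Qed.

Lemma circle_valX (f : circle_fun) n x : (f *+ n) x = f x ^+ n.
Proof. by elim: n => // n IH; rewrite mulrS exprS -IH. Qed.

(** Dividing the Borel angle by [n] selects an [n]-th root at every point measurably; de Moivre's
    formula recovers [f]. *)
Lemma circle_divisible (n : nat) (f : circle_fun) : (0 < n)%N ->
  exists g, g *+ n = f.
Proof.
move=> n0; have /asboolP[fr fi f1] := circle_valP f.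
pose a x := angle (f x) / n%:R.
have ma : measurable_fun setT a.
  apply: measurable_funM; last exact: measurable_cst.
  apply: measurable_fun_ifT.
  - by apply: measurable_fun_ler => //; exact: measurable_cst.
  - exact: (measurableT_comp (@measurable_acos_clamp R) fr).
  - exact: (measurableT_comp (@oppr_measurable R setT)
      (measurableT_comp (@measurable_acos_clamp R) fr)).
have gP : `[< is_circle_fun (fun x => Complex (cos (a x)) (sin (a x))) >].
  apply/asboolP; split=> [||x].
  - apply: (measurableT_comp _ ma); apply: continuous_measurable_fun; exact: continuous_cos.
  - apply: (measurableT_comp _ ma); apply: continuous_measurable_fun; exact: continuous_sin.
  - by rewrite /normsq /= cos2Dsin2.
exists (CircleFun gP); apply/val_inj/funext => x.
rewrite -[LHS]/((CircleFun gP *+ n) x) circle_valX de_moivre.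
have -> : a x *+ n = angle (f x) by rewrite /a -mulr_natr mulfVK// pnatr_eq0 -lt0n.
by have [-> ->] := angleE (f1 x); rewrite -[RHS]/(f x); case: (f x).
Qed.

End CircleFun.

(** * Characters separate points *)

Section Separation.
Variables (R : realType) (H : zmodType).
Local Notation C := R[i].

Lemma separating_character (h : H) : h != 0 -> exists psi : character R H, psi h != 1.
Proof.
(* Circle-valued functions on [unit] are points of the circle, so the divisibility just proved
   covers the circle group as well. *)
move=> h0; pose D : zmodType := circle_fun unit R.
(* [v] is to be the value at [h] of a character of the cyclic group generated by [h]: a nontrivial
   root of unity whose order divides that of [h], or [-1] if [h] has infinite order. *)
have [v [vh v0]] : exists v : D, (forall n : int, h *~ n = 0 -> v *~ n = 0) /\ v tt != 1.
  have cP (z : C) : `|z| = 1 -> `[< is_circle_fun ((fun=> z) : unit -> C) >].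
    move=> z1; apply/asboolP; split=> [||x]; [exact: measurable_cst..|].
    by apply: complexI; rewrite normsqE z1 expr1n.
  pose isM (m : nat) := (0 < m)%N && (h *+ m == 0).
  have [hm|noM] := pselect (exists m, isM m).
    have [m /andP[m0 /eqP hm0] mmin] := ex_minnP hm.
    have m1 : (1 < m)%N.
      case: m m0 hm0 {mmin} => [|[|m]] //= _ e; by rewrite mulr1n in e; rewrite e eqxx in h0.
    have [z [z1 zm zn1]] := nontrivial_root_of_unity R m1.
    exists (CircleFun (cP z z1)); split=> // n hn.
    have r0 : (n %% m)%Z = 0.
      have mn0 : (m : int) != 0 by rewrite -lt0n.
      have := modz_ge0 n mn0; case e: (n %% m)%Z => [r|//] _.
      have := ltz_pmod n (d := m) m0; rewrite e ltz_nat => rm.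
      case: r e rm => // r e rm; have := mmin r.+1; rewrite leqNgt rm => /(_ _)/notF; case.
      apply/andP; split=> //; apply/eqP.
      rewrite pmulrn -e; move: hn; rewrite {1}(divz_eq n m) [in X in X = _]mulrzDr.
      by rewrite (mulrC _ (m : int)) mulrzA -pmulrn hm0 mul0rz add0r.
    rewrite (divz_eq n m) r0 addr0 mulrC mulrzA -pmulrn.
    rewrite (_ : CircleFun _ *+ m = 0) ?mul0rz//.
    by apply/val_inj/funext => x; rewrite -[LHS]/((CircleFun (cP z z1) *+ m) x) circle_valX.
  have z1 : `|-1 : C| = 1 by rewrite normrN normr1.
  exists (CircleFun (cP _ z1)); split=> [n hn|/=]; last first.
    by rewrite -subr_eq0 -opprD oppr_eq0 -(natrD _ 1 1) pnatr_eq0.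
  have [->|n0] := eqVneq n 0; first by rewrite mulr0z.
  case: noM; exists (absz n); rewrite /isM absz_gt0 n0; apply/eqP.
  have [n0'|n0'] := ltP n 0; last by rewrite pmulrn gez0_abs.
  by rewrite pmulrn ltz0_abs// mulrNz hn oppr0.
pose P0 : set (H * D) := [set p | exists n : int, p = (h *~ n, v *~ n)].
have [] := @divisible_extension H D P0.
- by move=> n u; exact: circle_divisible.
- by exists 0; rewrite !mulr0z.
- by move=> _ _ [n ->] [m ->]; exists (n - m); rewrite !mulrzBr.
- by move=> u [n [/esym hn ->]]; exact: vh.
move=> f [fD fP].
have chiP : `[< is_character (fun x => f x tt) >].
  apply/asboolP; split=> [x y|x]; first by rewrite fD.
  have /asboolP[_ _ /(_ tt)] := circle_valP (f x) => e.
  by apply/eqP; rewrite -(@pexpr_eq1 _ _ 2)// -normsqE e.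
exists (Character chiP) => /=.
by rewrite (fP h v)//; exists 1; rewrite !mulr1z.
Qed.

End Separation.

Section CharacterExtension.
Variables (R : realType) (H G : countZmodType) (iota : {additive H -> G}).
Hypothesis iota_inj : injective iota.
Local Notation D := (circle_fun (borel_dual R H) R).

Lemma char_circle (h : H) :
  `[< is_circle_fun (fun chi : borel_dual R H => (chi : character R H) h) >].
Proof.
apply/asboolP; split=> [||x]; last exact: normsq_char.
  exact: (measurable_coord true h).
exact: (measurable_coord false h).
Qed.

Definition char_fun (h : H) : D := CircleFun (char_circle h).

Lemma char_funD h k : char_fun (h + k) = char_fun h + char_fun k.
Proof. by apply/val_inj/funext => chi; exact: character_D. Qed.

Lemma char_fun0 : char_fun 0 = 0.
Proof. by apply/val_inj/funext => chi; exact: character_0. Qed.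

(** Injectivity of [iota] makes the graph sending [iota h] to [char_fun h] single-valued;
    divisibility then extends it to [G]. *)
Lemma char_extension : exists f : G -> D, (forall x y, f (x + y) = f x + f y) /\
  forall h, f (iota h) = char_fun h.
Proof.
pose P0 : set (G * D) := [set p | exists h, p = (iota h, char_fun h)].
have [] := @divisible_extension G D P0.
- by move=> n u; exact: circle_divisible.
- by exists 0; rewrite raddf0 char_fun0.
- move=> _ _ [h ->] [k ->]; exists (h - k); rewrite raddfB; congr pair.
  by apply/eqP; rewrite eq_sym -subr_eq opprK -char_funD subrK.
- by move=> u [h [/esym/eqP]]; rewrite raddf_eq0// => /eqP -> ->; exact: char_fun0.
move=> f [fD fP]; exists f; split=> // h; apply: fP; by exists h.
Qed.

End CharacterExtension.

(** * Multiplication operators *)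

Section Multiplication.
Context d (T : measurableType d) (R : realType).
Variable mu : {measure set T -> \bar R}.
Local Notation C := R[i].
Local Notation Re := (@complex.Re R).
Local Notation Im := (@complex.Im R).
Local Notation L2s := (L2_space mu).
Implicit Types f g : T -> C.

(** Bounded everywhere and not just essentially, so that estimates are pointwise; [LinftyP] brings
    essentially bounded multipliers back to this class. *)
Definition bounded_measurable f :=
  [/\ measurable_fun setT (Re \o f), measurable_fun setT (Im \o f) &
      exists M : R, forall x, normsq (f x) <= M].

Local Notation bm := bounded_measurable.

Definition mulop f (x : L2s) : L2s := L2_of mu (fun t => f t * L2_repr x t).

Lemma bounded_measurableM f g : bm f -> bm g -> bm (fun x => f x * g x).
Proof.
move=> [fr fi [M fM]] [gr gi [N gN]].
have [mr mi] := measurable_complexM fr fi gr gi; split=> //.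
by exists (M * N) => x; rewrite normsqM ler_pM// ?normsq_ge0.
Qed.

Lemma bounded_measurable_conj f : bm f -> bm (fun x => (f x)^*).
Proof.
move=> [fr fi [M fM]]; have [mr mi] := measurable_complexJ fr fi; split=> //.
by exists M => x; rewrite normsqJ.
Qed.

Lemma bounded_measurable_real (u : T -> R) (M : R) : measurable_fun setT u ->
  (forall x, `|u x| <= M) -> bm (fun x => (u x)%:C%C).
Proof.
move=> mu_ uM; split=> //; first exact: measurable_cst.
exists (M ^+ 2) => x; rewrite /normsq /= expr0n addr0 -real_normK ?num_real//.
by rewrite lerXn2r ?nnegrE// (le_trans (normr_ge0 _) (uM x)).
Qed.

Lemma bounded_measurable_cst (c : C) : bm (fun=> c).
Proof. by split; [exact: measurable_cst..|exists (normsq c)]. Qed.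

Lemma bounded_measurable_circle (f : circle_fun T R) : bm f.
Proof. by have /asboolP[mr mi f1] := circle_valP f; split=> //; exists 1 => x; rewrite f1. Qed.

Lemma mul_sq f (v : T -> C) : bm f -> v \in sqintegrable mu ->
  (fun x => f x * v x) \in sqintegrable mu.
Proof.
move=> [fr fi [M fM]] hv; have [vr vi] := sqintegrable_measurable hv.
have [mr mi] := measurable_complexM fr fi vr vi; apply: sqintegrableP => //.
have [vfin _] := L2_normE hv.
have mv : measurable_fun setT (fun x => normsq (v x)) by exact: measurable_normsq.
apply: (@le_lt_trans _ _ (`|M|%:E * \int[mu]_x (normsq (v x))%:E)%E); last first.
  by rewrite lte_mul_pinfty// lee_fin.
rewrite -ge0_integralZl_EFin//; last 2 first.
- by move=> x _; rewrite lee_fin normsq_ge0.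
- exact/measurable_EFinP.
apply: ge0_le_integral => //.
- by move=> x _; rewrite lee_fin normsq_ge0.
- by apply/measurable_EFinP; exact: measurable_normsq.
- by apply/measurable_EFinP; apply: measurable_funM => //; exact: measurable_cst.
- move=> x _; rewrite -EFinM lee_fin normsqM ler_wpM2r ?normsq_ge0//.
  by rewrite (le_trans (fM x)) ?ler_norm.
Qed.

Lemma mulopE f (v : T -> C) : bm f -> v \in sqintegrable mu ->
  mulop f (L2_of mu v) = L2_of mu (fun x => f x * v x).
Proof.
move=> bf hv; apply/L2_of_eq; [exact: mul_sq (L2_repr_sq _)|exact: mul_sq|].
by apply: filterS (L2_repr_of hv) => x ->.
Qed.

Lemma mulop_ae f g : bm f -> measurable_fun setT (Re \o g) ->
  measurable_fun setT (Im \o g) -> {ae mu, forall x, f x = g x} -> mulop g = mulop f.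
Proof.
move=> bf mr mi fg; apply/funext => x.
have sq := mul_sq bf (L2_repr_sq x).
have fg' : {ae mu, forall t, f t * L2_repr x t = g t * L2_repr x t}.
  by apply: filterS fg => t ->.
apply/esym; apply/L2_of_eq => //.
have [vr vi] := sqintegrable_measurable (L2_repr_sq x).
have [pr pi] := measurable_complexM mr mi vr vi; apply: sqintegrableP => //.
have [h _] := L2_normE sq; apply: le_lt_trans h.
rewrite (ae_eq_integral (fun t => (normsq (f t * L2_repr x t))%:E))//.
- by apply/measurable_EFinP; exact: measurable_normsq.
- have [sr si] := sqintegrable_measurable sq.
  by apply/measurable_EFinP; exact: measurable_normsq.
- by apply: filterS fg' => t -> _.
Qed.

Lemma mulopM f g x : bm f -> bm g ->
  mulop f (mulop g x) = mulop (fun t => f t * g t) x.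
Proof.
move=> bf bg; rewrite [mulop g x]/mulop mulopE//; last exact: mul_sq (L2_repr_sq _).
by congr L2_of; apply/funext => t; rewrite mulrA.
Qed.

Lemma mulop_lin a f g x : bm f -> bm g ->
  mulop (fun t => a * f t + g t) x = a *: mulop f x + mulop g x.
Proof.
move=> bf bg; rewrite /mulop -L2_of_lin; [|exact: mul_sq (L2_repr_sq _)..].
by congr L2_of; apply/funext => t; rewrite mulrDl mulrA.
Qed.

Lemma mulop0 x : mulop (fun=> 0) x = 0.
Proof.
have := mulop_lin (-1) x (bounded_measurable_cst 1) (bounded_measurable_cst 1); rewrite scaleN1r addNr => <-.
by congr (mulop _ x); apply/funext => t; rewrite mulN1r addNr.
Qed.

Lemma mulopZ a f x : bm f -> mulop (fun t => a * f t) x = a *: mulop f x.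
Proof.
move=> bf; have := mulop_lin a x bf (bounded_measurable_cst 0); rewrite mulop0 addr0 => <-.
by congr (mulop _ x); apply/funext => t; rewrite addr0.
Qed.

Lemma mulop1 x : mulop (fun=> 1) x = x.
Proof.
by rewrite -[RHS]L2_of_repr; congr L2_of; apply/funext => t; rewrite mul1r.
Qed.

Lemma bounded_measurable_bound f : bm f ->
  exists N : R, forall t, `|Re (f t)| <= N /\ `|Im (f t)| <= N.
Proof.
move=> [_ _ [M fM]]; exists (1 + `|M|).
have bound (u : C -> R) t : (forall z, (u z) ^+ 2 <= normsq z) -> `|u (f t)| <= 1 + `|M|.
  move=> uz; rewrite -(ler_pXn2r (n := 2)) ?nnegrE ?addr_ge0// real_normK ?num_real//.
  have := uz (f t); have := fM t; have := ler_norm M; have := normr_ge0 M; nra.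
by move=> t; split; apply: bound => z; rewrite ?lerDl ?lerDr sqr_ge0.
Qed.

Lemma mulop_ReIm f x : bm f -> mulop f x =
  'i%C *: mulop (fun t => (Im (f t))%:C%C) x + mulop (fun t => (Re (f t))%:C%C) x.
Proof.
move=> bf; have [fr fi _] := bf; have [N hN] := bounded_measurable_bound bf.
rewrite -mulop_lin; [|apply: (@bounded_measurable_real _ N) => // t; by case: (hN t)..].
by congr (mulop _ x); apply/funext => t; rewrite [LHS]complexE addrC.
Qed.

Lemma mulop_adj f x y : bm f ->
  inner L2s (mulop f x) y = inner L2s x (mulop (fun t => (f t)^*) y).
Proof.
move=> bf; rewrite -{1}(L2_of_repr y) -{2}(L2_of_repr x).
rewrite !ip_L2_of ?L2_repr_sq ?mul_sq ?L2_repr_sq//; last exact: bounded_measurable_conj.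
congr cintegral; apply/funext => t.
by rewrite rmorphM /= conjCK; ring.
Qed.

Lemma mulop_linear f : bm f -> linear (mulop f).
Proof.
move=> bf a x y.
rewrite -{1}(L2_of_repr x) -{1}(L2_of_repr y) -L2_of_lin ?L2_repr_sq//.
have h : (fun t => a * L2_repr x t + L2_repr y t) \in sqintegrable mu.
  exact: (sqintegrable_submod mu).2 (L2_repr_sq x) (L2_repr_sq y).
rewrite mulopE// /mulop -L2_of_lin; [|exact: mul_sq (L2_repr_sq _)..].
by congr L2_of; apply/funext => t; ring.
Qed.

Lemma bounded_mulop f : bm f -> bounded_map (mulop f).
Proof.
move=> bf; split; first exact: mulop_linear.
have [fr fi [M fM]] := bf; exists `|M|%:C%C => [|x]; first by rewrite (lecR 0).
pose v := L2_repr x; have hv : v \in sqintegrable mu := L2_repr_sq x.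
have [vr vi] := sqintegrable_measurable hv; have hfv := mul_sq bf hv.
have [mr mi] := sqintegrable_measurable hfv.
have [fin1 e1] := L2_normE hfv; have [fin2 e2] := L2_normE hv.
rewrite [L2_of mu v]L2_of_repr in e2; rewrite [X in X <= _]e1 e2.
rewrite -rmorphM lecR /Rintegral.
have fn (w : T -> C) : (\int[mu]_x (normsq (w x))%:E < +oo)%E ->
    (\int[mu]_x (normsq (w x))%:E)%E \is a fin_num.
  by move=> h; rewrite ge0_fin_numE// integral_ge0// => t _; rewrite lee_fin normsq_ge0.
rewrite -lee_fin EFinM !fineK; [|exact: fn..].
rewrite -ge0_integralZl_EFin//; last 2 first.
- by move=> t _; rewrite lee_fin normsq_ge0.
- by apply/measurable_EFinP; exact: measurable_normsq.
apply: ge0_le_integral => //.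
- by move=> t _; rewrite lee_fin normsq_ge0.
- by apply/measurable_EFinP; exact: measurable_normsq.
- apply/measurable_EFinP.
  by apply: measurable_funM; [exact: measurable_cst|exact: measurable_normsq].
- move=> t _; rewrite -EFinM lee_fin normsqM ler_wpM2r ?normsq_ge0//.
  by rewrite (le_trans (fM t)) ?ler_norm.
Qed.

Lemma Linfty_mulop f : bm f -> Linfty mu (mulop f).
Proof.
move=> [fr fi [M fM]]; exists f; split=> //.
exists (1 + `|M|)%:C%C; apply: aeW => x.
have c0 : (0 : C) <= (1 + `|M|)%:C%C by rewrite (lecR 0) addr_ge0.
rewrite -(ler_pXn2r (n := 2)) ?nnegrE// -normsqE -rmorphXn lecR.
have := fM x; have := ler_norm M; have := normr_ge0 M; nra.
Qed.

(** Cutting [f] off outside the measurable set where [|f| ^ 2 <= N] changes it only on a null set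
    and makes it bounded everywhere. *)
Lemma LinftyP (B : L2s -> L2s) : Linfty mu B -> exists2 f, bm f & B = mulop f.
Proof.
move=> [f [fr fi [M fM] ->]].
pose N := Re M ^+ 2; pose A := [set x | normsq (f x) <= N].
have mA : measurable A.
  have := measurable_normsq fr fi measurableT (measurable_itv `]-oo, N]).
  by rewrite setTI; congr measurable; apply/seteqP; split=> x /=; rewrite in_itv.
have bA : bm (fun x => (\1_A x)%:C%C).
  by apply: (@bounded_measurable_real _ 1) => // x; rewrite indicE; case: (_ \in _); rewrite ?normr1 ?normr0.
have [Ar Ai _] := bA; have [mr mi] := measurable_complexM Ar Ai fr fi.
have bg : bm (fun x => (\1_A x)%:C%C * f x).
  split=> //; exists N => x; rewrite normsqM /normsq /= expr0n addr0 indicE.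
  case: (boolP (x \in A)) => [|_] /=; first by rewrite inE expr1n mul1r.
  by rewrite expr0n mul0r sqr_ge0.
exists (fun x => (\1_A x)%:C%C * f x) => //.
apply: (mulop_ae bg fr fi).
apply: filterS fM => x fxM; rewrite indicE mem_set ?mul1r//.
rewrite /A /= -lecR normsqE /N rmorphXn /=.
have M0 : 0 <= M by exact: le_trans fxM.
by rewrite RRe_real ?ger0_real// lerXn2r ?nnegrE.
Qed.

(** Dominated convergence with majorant [(M + M) ^ 2 * |v| ^ 2]: bounded pointwise limits of
    functions become strong limits of multiplication operators. *)
Lemma mulop_dominated (u : nat -> T -> R) (f : T -> R) (M : R) (x : L2s) (eps : C) :
  (forall n t, `|u n t| <= M) -> (forall n, measurable_fun setT (u n)) ->
  (forall t, u^~ t @ \oo --> f t) -> 0 < eps ->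
  exists N, forall n, (N <= n)%N ->
    let r := mulop (fun t => (f t)%:C%C) x - mulop (fun t => (u n t)%:C%C) x in
    inner L2s r r < eps.
Proof.
move=> uM mu_ uf e0.
have fM t : `|f t| <= M.
  by apply: (cvgr_to_le (cvg_norm (uf t))); exact: nearW.
have mf : measurable_fun setT f.
  by apply: (measurable_fun_cvg (h := u)) => // t _; exact: uf.
have bu n := bounded_measurable_real (mu_ n) (uM n).
have bf := bounded_measurable_real mf fM.
pose v := L2_repr x; have hv : v \in sqintegrable mu := L2_repr_sq x.
have [vr vi] := sqintegrable_measurable hv.
have mv := measurable_normsq vr vi.
have bd n : bm (fun t => (-1) * (u n t)%:C%C + (f t)%:C%C).
  have := @bounded_measurable_real (fun t => f t - u n t) (M + M) _ _.
  under [X in _ -> _ -> bm X]eq_fun do rewrite rmorphB /= addrC -mulN1r.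
  apply; first exact: measurable_funB.
  by move=> t; rewrite (le_trans (ler_normB _ _))// lerD.
have rE n : mulop (fun t => (f t)%:C%C) x - mulop (fun t => (u n t)%:C%C) x =
    L2_of mu (fun t => ((-1) * (u n t)%:C%C + (f t)%:C%C) * v t).
  by rewrite -[RHS]/(mulop _ x) mulop_lin// scaleN1r addrC.
pose F n t := (normsq (v t))* (f t - u n t) ^+ 2.
have F0 n t : 0 <= F n t by apply: mulr_ge0; [exact: normsq_ge0|exact: sqr_ge0].
have FE n t : normsq (((-1) * (u n t)%:C%C + (f t)%:C%C) * v t) = F n t.
  rewrite normsqM mulrC /F; congr (_ * _).
  by rewrite mulN1r addrC -rmorphB /normsq /= expr0n addr0.
have mF n : measurable_fun setT (F n).
  by apply: measurable_funM => //; apply: measurable_funX; exact: measurable_funB.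
have [vfin _] := L2_normE hv.
have : (\int[mu]_t (F n t)%:E)%E @[n --> \oo] --> (\int[mu]_t (0 : R)%:E)%E.
  have := @dominated_convergence _ _ _ mu setT measurableT
     (fun n t => (F n t)%:E) (fun=> 0%E) (fun t => ((M + M) ^+ 2 * normsq (v t))%:E).
  case=> //.
  - by move=> n; apply/measurable_EFinP.
  - apply: aeW => t _; apply: cvg_EFin; first exact: nearW.
    rewrite (_ : 0 = normsq (v t) * (f t - f t) ^+ 2); last by rewrite subrr expr0n mulr0.
    apply: cvgM; first exact: cvg_cst.
    rewrite expr2; apply: cvgM; (apply: cvgB; [exact: cvg_cst|exact: uf]).
  - apply/integrableP; split.
      by apply/measurable_EFinP; apply: measurable_funM => //; exact: measurable_cst.
    rewrite (eq_integral (fun t => ((M + M) ^+ 2)%:E * (normsq (v t))%:E)%E); last first.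
      by move=> t _; rewrite -EFinM gee0_abs// lee_fin mulr_ge0 ?sqr_ge0 ?normsq_ge0.
    rewrite ge0_integralZl_EFin// ?sqr_ge0//; last 2 first.
    + by move=> t _; rewrite lee_fin normsq_ge0.
    + exact/measurable_EFinP.
    by rewrite lte_mul_pinfty// lee_fin sqr_ge0.
  - apply: aeW => t n _; rewrite gee0_abs ?lee_fin ?F0//.
    rewrite /F mulrC ler_wpM2r ?normsq_ge0// -real_normK ?num_real//.
    have MM : 0 <= M + M by rewrite addr_ge0// (le_trans (normr_ge0 _) (fM t)).
    by rewrite lerXn2r ?nnegrE// (le_trans (ler_normB _ _))// lerD.
have eE : eps = (Re eps)%:C%C by rewrite RRe_real// gtr0_real.
have re0 : 0 < Re eps by rewrite -ltcR -eE.
rewrite (_ : (\int[mu]_t (0 : R)%:E)%E = 0%E); last by rewrite integral0_eq.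
move=> /fine_cvgP[_ /cvgrPdist_lt /(_ _ re0) [N _ hN]].
exists N => n /hN hn; rewrite /= rE; have [_ ->] := L2_normE (mul_sq (bd n) hv).
rewrite eE ltcR /Rintegral; under eq_integral => t _ do rewrite FE.
by move: hn => /=; rewrite sub0r normrN; exact: le_lt_trans (ler_norm _).
Qed.

Section FiniteMeasure.
Hypothesis mu_fin : (mu setT < +oo)%E.

Lemma cst1_sq : (fun=> 1) \in sqintegrable mu.
Proof.
apply: sqintegrableP; [exact: measurable_cst..|].
under eq_integral => x _ do rewrite normsq1.
by rewrite integral_cst// mul1e.
Qed.

Definition L2_one : L2s := L2_of mu (fun=> 1).

Lemma mulop_one f : bm f -> mulop f L2_one = L2_of mu f.
Proof.
by move=> bf; rewrite mulopE ?cst1_sq//; congr L2_of; apply/funext => x; rewrite mulr1.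
Qed.

Lemma bounded_measurable_sq f : bm f -> f \in sqintegrable mu.
Proof.
move=> bf; have := mul_sq bf cst1_sq.
by rewrite (_ : (fun x => _) = f)//; apply/funext => x; rewrite mulr1.
Qed.

Lemma ip_mulop_one f g : bm f -> bm g ->
  inner L2s (mulop f L2_one) (mulop g L2_one) = cintegral mu (fun x => f x * (g x)^*).
Proof. by move=> bf bg; rewrite !mulop_one// ip_L2_of ?bounded_measurable_sq. Qed.

(** Truncating [x] where it is large approximates it by bounded functions, each of which is a
    multiplier applied to the constant 1; splitting into real and imaginary parts leaves real
    multipliers. *)
Lemma L2_form_ext (D : L2s -> C) : bounded_form D ->
  (forall (u : T -> R) (M : R), measurable_fun setT u -> (forall x, `|u x| <= M) ->
    D (mulop (fun t => (u t)%:C%C) L2_one) = 0) -> forall x, D x = 0.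
Proof.
move=> hD h x.
have hf f : bm f -> D (mulop f L2_one) = 0.
  move=> bf; have [fr fi _] := bf; have [N hN] := bounded_measurable_bound bf.
  have [bR bI] : (forall t, `|Re (f t)| <= N) /\ (forall t, `|Im (f t)| <= N).
    by split=> t; case: (hN t).
  by rewrite mulop_ReIm// hD.1 (h _ _ fr bR) (h _ _ fi bI) mulr0 addr0.
pose v := L2_repr x; have hv : v \in sqintegrable mu := L2_repr_sq x.
have [vr vi] := sqintegrable_measurable hv; have mv := measurable_normsq vr vi.
pose A (n : nat) := [set t | normsq (v t) <= n%:R].
have mA n : measurable (A n).
  have := mv measurableT _ (measurable_itv `]-oo, n%:R]).
  by rewrite setTI; congr measurable; apply/seteqP; split=> t /=; rewrite in_itv.
have A1 n t : `|\1_(A n) t : R| <= 1.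
  by rewrite indicE; case: (_ \in _); rewrite ?normr1 ?normr0.
have mA1 n : measurable_fun setT (\1_(A n) : T -> R) by [].
have A1cvg t : (fun n => \1_(A n) t : R) @ \oo --> (1 : R).
  apply: cvg_near_cst; exists (Num.bound (normsq (v t))) => // n /= hn.
  rewrite indicE mem_set// /A /= (le_trans (ltW (archi_boundP (normsq_ge0 _))))//.
  by rewrite ler_nat.
apply: bounded_form_dense => // eps e0.
have [n /(_ n (leqnn n)) hn] := mulop_dominated x A1 mA1 A1cvg e0.
exists (mulop (fun t => (\1_(A n) t)%:C%C) x); first by rewrite mulop1 in hn.
have bA := bounded_measurable_real (mA1 n) (A1 n); have [Ar Ai _] := bA.
have bAv : bm (fun t => (\1_(A n) t)%:C%C * v t).
  have [mr mi] := measurable_complexM Ar Ai vr vi; split=> //.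
  exists n%:R => t; rewrite normsqM /normsq /= expr0n addr0 indicE.
  case: (boolP (t \in A n)) => [|_] /=; first by rewrite inE expr1n mul1r.
  by rewrite expr0n mul0r.
by rewrite -(hf _ bAv) mulop_one.
Qed.

End FiniteMeasure.
End Multiplication.

(** * From characters to all bounded multipliers *)

Section MulopClass.
Variables (R : realType) (H : countZmodType).
Variable mu : {measure set (borel_dual R H) -> \bar R}.
Local Notation C := R[i].
Local Notation Re := (@complex.Re R).
Local Notation Im := (@complex.Im R).
Local Notation L2s := (L2_space mu).
Local Notation borel := (borel_dual R H).
Local Notation bm := (@bounded_measurable _ (borel_dual R H) R).
Local Notation mulc h := (mulop (mu := mu) (char_fun R h : borel -> C)).
Local Notation mulr u := (mulop (mu := mu) (fun x => (u x)%:C%C)).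

Let bmc h : bm (char_fun R h) := bounded_measurable_circle (char_fun R h : circle_fun borel R).

(** The coefficient of [z] in [Re z = z / 2 + z^* / 2] and in [Im z = - i z / 2 + i z^* / 2]; in
    both cases that of [z^*] is its conjugate. *)
Let half_char (b : bool) : C := if b then 2^-1 else - 'i%C / 2.

Lemma mulop_coord b h (x : L2s) :
  mulr (coord b h) x = half_char b *: mulc h x + (half_char b)^* *: mulc (- h) x.
Proof.
rewrite -(mulopZ _ _ (bmc (- h))) -mulop_lin//; last first.
  by apply: bounded_measurableM; [exact: bounded_measurable_cst|exact: bmc].
congr (mulop _ x); apply/funext => chi.
have -> : (char_fun R (- h) : borel -> C) chi = ((char_fun R h : borel -> C) chi)^*.
  exact: character_N.
rewrite /coord -[(chi : character R H) h]/((char_fun R h : borel -> C) chi).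
case: ((char_fun R h : borel -> C) chi) => p q.
have h2 : (2 : C)^-1 = (2^-1 : R)%:C%C by rewrite fmorphV rmorph_nat.
by rewrite /half_char; case: b; rewrite h2 /=; apply/eqP; rewrite eq_complex /=;
  apply/andP; split; apply/eqP; field.
Qed.

Lemma form_norm_small (U : innerSpace C) (D : U -> C) : bounded_form D ->
  forall eps : C, 0 < eps -> exists2 del : C, 0 < del &
    forall x, '[x, x] < del -> `|D x| < eps.
Proof.
move=> [_ [K K0 hK]] eps e0; have K1 : 0 < K + 1 by rewrite ltr_wpDl.
exists (eps ^+ 2 / (K + 1)) => [|x]; first by rewrite divr_gt0// exprn_gt0.
rewrite ltr_pdivlMr// => hx; rewrite -(ltr_pXn2r (n := 2)) ?nnegrE ?(ltW e0)//.
apply: le_lt_trans (hK x) _; apply: le_lt_trans hx.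
by rewrite mulrC ler_wpM2l ?ip_ge0// lerDl.
Qed.

(** A coordinate combines a character and its inverse with conjugate coefficients, so the hypothesis
    on characters settles coordinates. The conjugate and the sign in [- h] fit forms obtained by
    moving a multiplier to the other side of an inner product. *)
Lemma mulop_monotone_class (D1 D2 : L2s -> C) (x1 x2 : L2s) :
  bounded_form D1 -> bounded_form D2 ->
  (forall h, D1 (mulc h x1) = (D2 (mulc (- h) x2))^*) ->
  forall (u : borel -> R) (M : R), measurable_fun setT u -> (forall x, `|u x| <= M) ->
    D1 (mulr u x1) = (D2 (mulr u x2))^*.
Proof.
move=> hD1 hD2 hh u M mu_ uM.
(* Admissibility of the multiplier is carried through the induction, because linearity of [mulop] in
   the multiplier asks for it. *)
suff : bm (fun x => (u x)%:C%C) /\ D1 (mulr u x1) = (D2 (mulr u x2))^* by case.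
move: u M mu_ uM; apply: dual_monotone_class.
- move=> b h; split.
    exact: (bounded_measurable_real (measurable_coord b h) (coord_bound b h)).
  have DZ (D : L2s -> C) : bounded_form D -> forall a y, D (a *: y) = a * D y.
    by move=> hD a y; have := hD.1 a y 0; rewrite (bounded_form0 hD) !addr0.
  rewrite !mulop_coord hD1.1 hD2.1 !DZ// !hh opprK !rmorphD !rmorphM /= conjCK.
  by rewrite addrC.
- move=> a f g [bf ef] [bg eg].
  have -> : (fun x => (a * f x + g x)%:C%C) = fun x => a%:C%C * (f x)%:C%C + (g x)%:C%C.
    by apply/funext => x; rewrite rmorphD rmorphM.
  split.
    have [h1 h2 [N1 hN1]] := bounded_measurableM (bounded_measurable_cst _ a%:C%C) bf; have [h3 h4 [N2 hN2]] := bg.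
    split.
    + rewrite (_ : _ \o _ = fun x => Re (a%:C%C * (f x)%:C%C) + g x); first exact: measurable_funD.
      by apply/funext => x.
    + rewrite (_ : _ \o _ = fun x => Im (a%:C%C * (f x)%:C%C) + 0).
        by apply: measurable_funD => //; exact: measurable_cst.
      by apply/funext => x.
    + exists (2 * (N1 + N2)) => x; apply: le_trans (normsqD _ _) _.
      by rewrite ler_wpM2l// lerD.
  rewrite !mulop_lin// hD1.1 hD2.1 ef eg rmorphD rmorphM /=.
  by congr (_ * _ + _); rewrite -[RHS]/((a%:C%C)^*)%C conjc_real.
- move=> u f M hu uM mu_ uf.
  have fM t : `|f t| <= M by apply: (cvgr_to_le (cvg_norm (uf t))); exact: nearW.
  have mf : measurable_fun setT f.
    by apply: (measurable_fun_cvg (h := u)) => // t _; exact: uf.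
  split; first exact: bounded_measurable_real mf fM.
  apply/eqP; rewrite -subr_eq0 -normr_eq0; apply/negPn/negP => n0.
  set z := `|_| in n0; have z0 : 0 < z by rewrite lt_def n0 normr_ge0.
  have z2 : 0 < z / 2 by rewrite divr_gt0.
  have [d1 d10 hd1] := form_norm_small hD1 z2.
  have [d2 d20 hd2] := form_norm_small hD2 z2.
  have [N1 hN1] := mulop_dominated x1 uM mu_ uf d10.
  have [N2 hN2] := mulop_dominated x2 uM mu_ uf d20.
  pose n := maxn N1 N2; have [_ en] := hu n.
  have /hd1 := hN1 n (leq_maxl _ _); have /hd2 := hN2 n (leq_maxr _ _).
  rewrite !bounded_form_B// en => h2 h1.
  have : z < z / 2 + z / 2.
    rewrite /z; apply: le_lt_trans (ltrD h1 h2).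
    rewrite -(norm_conjC (D2 _ - _)) -(normrN (_^*)).
    apply: le_trans (ler_normD _ _); rewrite rmorphB opprB /=.
    by rewrite addrA subrK.
  by rewrite -splitr ltxx.
Qed.

End MulopClass.

(** * The isomorphism *)

Section CentralExtension.
Variables (R : realType) (H : countZmodType) (Gamma Q : groupType).
Context {Gamma_countable : countable_group Gamma} {Q_countable : countable_group Q}.
Local Notation C := R[i].
Local Notation borel := (borel_dual R H).
Local Notation D := (circle_fun borel R).
Variables (p : Gamma -> Q) (j : H -> Gamma) (psi : Gamma -> D).
Hypothesis pM : forall x y, p (x * y)%g = (p x * p y)%g.
Hypothesis pj : forall h, p (j h) = 1%g.
Hypothesis p_surj : forall q, exists x, p x = q.
Hypothesis p_ker : forall x y, p x = p y -> exists h, x = (y * j h)%g.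
Hypothesis j0 : j 0 = 1%g.
Hypothesis jN : forall h, j (- h) = (j h)^-1%g.
Hypothesis psiM : forall x y, psi (x * y)%g = psi x + psi y.
Hypothesis psij : forall h, psi (j h) = char_fun R h.
Variable mu : {measure set borel -> \bar R}.
Hypothesis mu_haar : haar mu.
Variable W : innerSpace C.
Local Notation E := (ell2 R Q).
Local Notation F := (ell2 R Gamma).
Local Notation L2s := (L2_space mu).
Local Notation bm := (@bounded_measurable _ borel R).
Variable t : {bilinear E -> L2s -> W}.
Hypothesis t_tensor : hilbert_tensor t.

Local Notation M f := (mulop (mu := mu) (f : borel -> C)).
Local Notation lam := left_regular.

Let tensor_ip := ip_tensor t_tensor.
Let bpsi g : bm (psi g) := bounded_measurable_circle (psi g).

Let p1 : p 1%g = 1%g. Proof. by rewrite -j0 pj. Qed.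

Let pV x : p x^-1%g = (p x)^-1%g.
Proof. by apply: (mulgI (p x)); rewrite -pM !mulgV. Qed.

Let psi1 : psi 1%g = 0.
Proof. by apply: (addrI (psi 1%g)); rewrite -psiM mulg1 addr0. Qed.

Let psiV g : psi g^-1%g = - psi g.
Proof. by apply: (addrI (psi g)); rewrite -psiM mulgV psi1 subrr. Qed.

Let MM g h (x : L2s) : M (psi (g * h)%g) x = M (psi g) (M (psi h) x).
Proof. by rewrite mulopM// psiM. Qed.

Let M1 (x : L2s) : M (psi 1%g) x = x.
Proof. by rewrite psi1 -[RHS]mulop1. Qed.

Let Mconj g : (fun x => ((psi g : borel -> C) x)^*) = psi g^-1%g :> (borel -> C).
Proof. by rewrite psiV. Qed.

Let Madj g (x y : L2s) : '[M (psi g) x, y] = '[x, M (psi g^-1%g) y].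
Proof. by rewrite (mulop_adj x y (bpsi g)) (Mconj g). Qed.

Let MK g (x : L2s) : M (psi g^-1%g) (M (psi g) x) = x.
Proof. by rewrite -MM mulVg M1. Qed.

Let mu_fin : (mu setT < +oo)%E. Proof. by case: mu_haar. Qed.

Let one : L2s := L2_one mu.

Let c2 : C := '[one, one].

Let c2_gt0 : 0 < c2.
Proof.
have [m0 _ _] := mu_haar.
rewrite /c2; have [_ ->] := L2_normE (cst1_sq mu_fin).
rewrite (ltcR 0) /Rintegral.
under eq_integral => x _ do rewrite normsq1.
by rewrite integral_cst// mul1e fine_gt0// m0.
Qed.

(** Compensates for the norm of the constant function 1, whose square is the total mass. *)
Let c : C := sqrtC c2^-1.

Let cc : c * c^* = c2^-1.
Proof. by rewrite -normCK ger0_norm ?sqrtCK// sqrtC_ge0 invr_ge0 ltW. Qed.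

Let e (g : Gamma) : W := c *: t (delta R (p g)) (M (psi g) one).

(** If [p g] and [p h] differ, the first tensor factors are orthogonal. Otherwise [g = h * j k], and
    the second factors pair to the integral of the evaluation at [k], which vanishes for [k != 0]
    because characters separate points. *)
Let e_ortho g h : '[e g, e h] = (g == h)%:R.
Proof.
rewrite ipZl ipZr tensor_ip ip_deltas mulrA cc.
have [->|gh] := eqVneq g h.
  by rewrite Madj MK eqxx mul1r mulVf// gt_eqF.
case: eqVneq => [/p_ker[k gE]|_]; last by rewrite mul0r mulr0.
have k0 : k != 0 by apply: contra_neq gh => k0; rewrite gE k0 j0 mulg1.
have [chi hchi] := separating_character R k0.
rewrite (ip_mulop_one mu_fin (bpsi g) (bpsi h)).
have -> : (fun x : borel => psi g x * (psi h x)^*) = fun x => (x : character R H) k.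
  apply/funext => x; rewrite gE psiM psij circle_valM mulrAC normsq_conj.
  by have /asboolP[_ _ ->] := circle_valP (psi h); rewrite mul1r.
by rewrite (cintegral_char mu_haar hchi) !mulr0.
Qed.

Let e_total (w : W) : (forall g, '[w, e g] = 0) -> w = 0.
Proof.
move=> h; apply: (tensor_ext t_tensor) => u v; rewrite ip0r.
have cn0 : c != 0 by rewrite sqrtC_eq0 invr_eq0 gt_eqF.
have h' g : '[t (delta R (p g)) (M (psi g) one), w] = 0.
  rewrite ipC; apply/eqP; rewrite conjC_eq0; have /eqP := h g.
  by rewrite ipZr mulf_eq0 conjC_eq0 (negbTE cn0).
apply: (ell2_form_ext (D := fun u => '[t u v, w])).
  exact: (bounded_form_comp (bounded_tensorl t_tensor v) (bounded_form_ip w)).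
move=> q; have [g <-] := p_surj q.
(* Writing [v] as [M (psi g) v'] brings in the basis vectors over [p g]: multiplying [psi g] by the
   characters of [H] runs through the [psi (g * j k)]. *)
rewrite -[v](MK g^-1%g) invgK; set v' := M (psi g^-1%g) v.
have hD : bounded_form (fun y : L2s => '[t (delta R (p g)) (M (psi g) y), w]).
  have h1 := bounded_form_comp (bounded_tensorr t_tensor (delta R (p g))) (bounded_form_ip w).
  exact: (bounded_form_comp (bounded_mulop mu (bpsi g)) h1).
apply: (L2_form_ext mu_fin hD) => u0 N mu0 u0N.
(* Compared with the zero form, vanishing on characters propagates to vanishing on all bounded real
   multipliers. *)
have hD0 : bounded_form (fun _ : L2s => 0 : C).
  by split=> [a x y|]; [rewrite mulr0 addr0|exists 0 => // x; rewrite normr0 expr0n mul0r].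
rewrite (mulop_monotone_class (x2 := one) hD hD0 _ mu0 u0N) ?conjC0// => k.
rewrite -psij -MM.
by have := h' (g * j k)%g; rewrite pM pj mulg1.
Qed.

Section WithUnitary.
Variables (V : W -> F) (V' : F -> W).
Hypotheses (VK : cancel V V') (V'K : cancel V' V) (lV : linear V).
Hypothesis Viso : forall w w', '[V w, V w'] = '[w, w'].
Hypothesis Ve : forall w g, '[V w, delta R g] = '[w, e g].

Let lV' : linear V'.
Proof. by move=> a x y; apply: (can_inj VK); rewrite lV !V'K. Qed.

Let V'iso x y : '[V' x, V' y] = '[x, y].
Proof. by rewrite -Viso !V'K. Qed.

Let act (g : Gamma) : W -> W := V' \o lam g \o V.

(** Compare coefficients in the basis [e]: [lam g] turns [h] into [g^-1 * h], and since [p] and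
    [psi] are homomorphisms the shift separates into the two tensor factors. *)
Let act_tensor g u v : act g (t u v) = t (lam (p g) u) (M (psi g) v).
Proof.
apply: (can_inj VK); rewrite /act /= V'K; apply: ell2_ext => h.
rewrite left_regular_delta !Ve !ipZr !tensor_ip left_regular_delta Madj -MM.
by rewrite pM pV.
Qed.

Let act_bounded g : bounded_map (act g).
Proof.
have [ll [N N0 hN]] := left_regular_bounded R g.
split=> [a x y|]; first by rewrite /act /= lV ll lV'.
by exists N => // x; rewrite /act /= V'iso -[X in _ <= _ * X]Viso.
Qed.

Let act_adj g x y : '[act g x, y] = '[x, act g^-1%g y].
Proof. by rewrite /act /= -Viso V'K left_regular_adj -[RHS]Viso V'K. Qed.

(** * Operators commuting with the transported translations *)

Section Commuting.
Variable T : W -> W.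
Hypothesis T_bounded : bounded_map T.
Hypothesis T_act : forall g x, T (act g x) = act g (T x).

Let act_central k u v : act (j k) (t u v) = t u (M (char_fun R k) v).
Proof.
rewrite act_tensor pj psij; congr (t _ _).
by apply: ell2_ext => q; rewrite left_regular_delta invg1 mul1g.
Qed.

Let T_form w : bounded_form (fun x => '[T x, w]).
Proof. exact: (bounded_form_comp T_bounded (bounded_form_ip w)). Qed.

(** Translations by [j k] act on the second factor alone, as multiplication by characters, so
    commutation with them is the hypothesis of the monotone class comparison. *)
Let T_real (f : borel -> R) N u v u' v' : measurable_fun setT f ->
  (forall x, `|f x| <= N) ->
  '[T (t u (M (fun x => (f x)%:C%C) v)), t u' v'] =
  '[T (t u v), t u' (M (fun x => (f x)%:C%C) v')].
Proof.
move=> mf fN; rewrite [RHS]ipC.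
have D1 : bounded_form (fun y : L2s => '[T (t u y), t u' v']).
  exact: (bounded_form_comp (bounded_tensorr t_tensor u) (T_form _)).
have D2 : bounded_form (fun y : L2s => '[t u' y, T (t u v)]).
  exact: (bounded_form_comp (bounded_tensorr t_tensor u') (bounded_form_ip _)).
apply: (mulop_monotone_class D1 D2 _ mf fN) => k.
by rewrite -ipC -act_central T_act act_adj -jN act_central.
Qed.

Let T_mul f u v u' v' : bm f ->
  '[T (t u (M f v)), t u' v'] = '[T (t u v), t u' (M (fun x => (f x)^*) v')].
Proof.
move=> bf; have [fr fi _] := bf; have [N hN] := bounded_measurable_bound bf.
have bR x : `|complex.Re (f x)| <= N by case: (hN x).
have bI x : `|complex.Im (f x)| <= N by case: (hN x).
have JR : (fun x => (complex.Re (f x)^*)%:C%C) = fun x => (complex.Re (f x))%:C%C.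
  by apply/funext => x /=; case: (f x).
have JI : (fun x => (complex.Im (f x)^*)%:C%C) = fun x => (-1) * (complex.Im (f x))%:C%C.
  by apply/funext => x /=; rewrite mulN1r -rmorphN; case: (f x).
rewrite (mulop_ReIm v bf) (mulop_ReIm v' (bounded_measurable_conj bf)) JR JI (mulopZ _ _ (bounded_measurable_real fi bI)).
set m1 := mulop _ v; set m2 := mulop _ v; set m3 := mulop _ v'; set m4 := mulop _ v'.
have lt1 := (bounded_tensorr t_tensor u).1; have lt2 := (bounded_tensorr t_tensor u').1.
rewrite scalerA lt1 lt2 T_bounded.1 ipDl ipZl (T_real _ _ _ _ fr bR) (T_real _ _ _ _ fi bI).
rewrite ipDr ipZr; congr (_ * _ + _).
by apply/eqP; rewrite eq_complex /=; apply/andP; split; apply/eqP; ring.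
Qed.

(** [lam q] on the first factor is the translation by some [g] over [q] corrected by the multiplier
    [psi g^-1], and multipliers have just been shown to pass through [T]. *)
Let T_lam q u v u' v' :
  '[T (t (lam q u) v), t u' v'] = '[T (t u v), t (lam q^-1%g u') v'].
Proof.
have [g <-] := p_surj q.
rewrite -{1}[v](MK g^-1%g) invgK -act_tensor T_act act_adj act_tensor pV.
by rewrite (T_mul _ _ _ _ (bpsi g^-1%g)) Mconj invgK -MM mulgV M1.
Qed.

(** The slice [X] of [T] between [v] and [v'] commutes with every [lam q], hence with [A], which
    lies in their double commutant. *)
Let T_slice A A' u v u' v' : group_vN R Q A -> adjoint_op A A' ->
  '[T (t (A u) v), t u' v'] = '[T (t u v), t (A' u') v'].
Proof.
move=> [_ hA] AA'; have [Z Zb hZ] := adjoint_exists (bounded_tensorl t_tensor v').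
pose X u := Z (T (t u v)).
have XE u1 u2 : '[X u1, u2] = '[T (t u1 v), t u2 v'].
  by rewrite ipC -hZ -ipC.
have Xb : bounded_map X.
  exact: (bounded_comp Zb (bounded_comp T_bounded (bounded_tensorl t_tensor v))).
have Xl q : X \o lam q = lam q \o X.
  apply/funext => u1; apply: ip_extl => u2 /=.
  by rewrite XE T_lam left_regular_adj XE.
have XC : commutant (range (@left_regular R Q) `|`
    [set B | exists2 A0, range (@left_regular R Q) A0 & adjoint_op A0 B]) X.
  split; first exact/bounded_opP.
  move=> B [[q _ <-] //|[_ [q _ <-] hB]].
  rewrite (_ : B = lam q^-1%g)//; apply/funext => u1.
  by apply: ip_extr => u2; rewrite -hB left_regular_adj.
have /(congr1 (fun F0 => F0 u)) /= AX := hA X XC.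
by rewrite -XE -AX AA' XE.
Qed.

Let tensor_gens : set (W -> W) := [set T0 | bounded_op T0 /\ exists A B,
  [/\ group_vN R Q A, Linfty mu B & forall u v, T0 (t u v) = t (A u) (B v)]].

(** [T0] and its adjoint are explicit on elementary tensors, where [T_mul] and [T_slice] carry the
    second and the first factor across [T]. *)
Lemma commute_tensor_gens T0 : tensor_gens T0 -> T \o T0 = T0 \o T.
Proof.
move=> [/bounded_opP bT0 [A [B [hA hB hT0]]]].
have [f bf Bf] := LinftyP hB.
have [A' A'b AA'] : exists2 A' : E -> E, bounded_map A' & adjoint_op A A'.
  by apply: adjoint_exists; apply/bounded_opP; case: hA.
pose fJ : borel -> C := fun x => (f x)^*.
have T0_adj z u v : '[T0 z, t u v] = '[z, t (A' u) (M fJ v)].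
  apply/subr0_eq.
  apply: (tensor_form_ext t_tensor (D := fun z => '[T0 z, t u v] - '[z, t (A' u) (M fJ v)])).
    apply: bounded_formB; last exact: bounded_form_ip.
    exact: (bounded_form_comp bT0 (bounded_form_ip _)).
  by move=> u1 v1; rewrite hT0 !tensor_ip AA' Bf (mulop_adj _ _ bf) subrr.
apply/funext => z; apply: (tensor_ext t_tensor) => u v /=.
rewrite ipC [RHS]ipC; congr (_ ^*); apply/subr0_eq.
apply: (tensor_form_ext t_tensor (D := fun z => '[T (T0 z), t u v] - '[T0 (T z), t u v])).
  apply: bounded_formB.
    exact: (bounded_form_comp (bounded_comp T_bounded bT0) (bounded_form_ip _)).
  exact: (bounded_form_comp (bounded_comp bT0 T_bounded) (bounded_form_ip _)).
move=> u1 v1; rewrite T0_adj hT0 Bf (T_mul _ _ _ _ bf).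
by rewrite (T_slice _ _ _ _ hA AA') subrr.
Qed.

End Commuting.

Let act_gens g : [set T0 | bounded_op T0 /\ exists A B,
  [/\ group_vN R Q A, Linfty mu B & forall u v, T0 (t u v) = t (A u) (B v)]] (act g).
Proof.
split; first exact/bounded_opP/act_bounded.
exists (lam (p g)), (M (psi g)); split; [|exact: Linfty_mulop|exact: act_tensor].
split; first exact/bounded_opP/left_regular_bounded.
by move=> B [_ hB]; apply/esym/hB; left; exists (p g).
Qed.

(** The translations are themselves tensor generators, by [act_gens], which gives one inclusion of
    commutants; [commute_tensor_gens] gives the other. *)
Lemma vN_isomorphic_from_unitary : vN_isomorphic (group_vN R Gamma)
  (vN_tensor t (group_vN R Q) (Linfty mu)).
Proof.
apply: (vN_isomorphic_unitary VK V'K lV Viso) => T /bounded_opP bT.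
have bV : bounded_map V by split=> //; exists 1 => // x; rewrite Viso mul1r.
have bV' : bounded_map V' by split=> //; exists 1 => // x; rewrite V'iso mul1r.
have adj_lam g (B : F -> F) : adjoint_op (lam g) B -> B = lam g^-1%g.
  by move=> hB; apply/funext => x; apply: ip_extr => y; rewrite -hB left_regular_adj.
split=> [[_ hT]|[_ hT]]; split; [|move=> A hA| |move=> A hA].
- by apply/bounded_opP; apply: bounded_comp bV'; exact: bounded_comp bV bT.
- have cl g : (V \o T \o V') \o lam g = lam g \o (V \o T \o V').
    apply/funext => x /=; have := hT _ (or_introl (act_gens g)).
    move/(congr1 (fun F0 => F0 (V' x))); rewrite /act /= !V'K => ->.
    by rewrite V'K.
  by case: hA => [[g _ <-]|[_ [g _ <-] /adj_lam ->]]; exact: cl.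
- exact/bounded_opP.
- have T_act g x : T (act g x) = act g (T x).
    have := hT _ (or_introl (ex_intro2 _ _ g I erefl)).
    move/(congr1 (fun F0 => V' (F0 (V x)))); rewrite /act /= !VK => ->.
    by [].
  case: hA => [hA|[T0 hT0 hA]]; first exact: commute_tensor_gens bT T_act _ hA.
  (* Here [A] is the adjoint of a generator [T0], and [T] commutes with it because the adjoint [T']
     of [T] commutes with [T0]. That adjoint is formed on [ell2] and carried back to [W]. *)
  have [Z bZ hZ] := adjoint_exists (bounded_comp (bounded_comp bV bT) bV').
  pose T' := V' \o Z \o V.
  have TT' x y : '[T x, y] = '[x, T' y].
    by rewrite -Viso -{1}[x]VK -[V (T _)]/(((V \o T) \o V') (V x)) hZ -V'iso VK.
  have T'T x y : '[x, T y] = '[T' x, y] by rewrite ipC TT' -ipC.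
  have bT' : bounded_map T' by apply: bounded_comp bV; exact: bounded_comp bV' bZ.
  have T'_act g x : T' (act g x) = act g (T' x).
    apply: ip_extr => z; rewrite -TT' -{1}[g]invgK -act_adj -T_act TT' act_adj.
    by rewrite invgK.
  have T'T0 := commute_tensor_gens bT' T'_act hT0.
  apply/funext => x; apply: ip_extr => z /=.
  rewrite T'T -!hA [RHS]T'T.
  by have := congr1 (fun F0 => F0 z) T'T0; rewrite /= => ->.
Qed.

End WithUnitary.

Lemma central_extension_vN_isomorphic : vN_isomorphic (group_vN R Gamma)
  (vN_tensor t (group_vN R Q) (Linfty mu)).
Proof.
have [hW _ _] := t_tensor.
have [V [V' [VK V'K lV Viso Ve]]] := parseval hW e_ortho e_total.
exact: (vN_isomorphic_from_unitary VK V'K lV Viso Ve).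
Qed.

End CentralExtension.

Theorem theorem3p12 (R : realType) (I : countType) (H : countZmodType)
    (G : I -> countZmodType) (iota : forall i : I, {additive H -> G i})
    (iota_inj : forall i : I, injective (iota i))
    (mu : {measure set (borel_dual R H) -> \bar R}) (mu_haar : haar mu)
    (W : innerSpace R[i])
    (t : {bilinear
        ell2 R (free_product
          (fun i : I => GRing.to_multiplicative (quotient_by (iota i)))) ->
        L2_space mu -> W})
    (t_tensor : hilbert_tensor t) :
  vN_isomorphic
    (group_vN R (amalgam
      (fun i : I => GRing.to_fmultiplicative (iota i))))
    (vN_tensor t
      (group_vN R (free_product
        (fun i : I => GRing.to_multiplicative (quotient_by (iota i)))))
      (Linfty mu)).
Proof.
pose D : zmodType := circle_fun (borel_dual R H) R.
(* The extensions to the [G i] are chosen independently; they agree on [H], which is the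
   compatibility that gluing requires. *)
have ext i : {f : G i -> D | (forall x y, f (x + y) = f x + f y) /\
    forall h, f (iota i h) = char_fun R h}.
  exact/cid/char_extension/iota_inj.
have [psi [psi1 psiM psij]] := amalgam_extension (iota := iota) (D := D)
  (@char_funD R H) (fun i => (svalP (ext i)).1)
  (fun i => (svalP (ext i)).2).
have cG := amalgam_countable iota; have cQ := free_product_countable iota.
exact: (@central_extension_vN_isomorphic R H _ _ cG cQ
  (@amalgam_proj I H G iota) (@amalgam_base I H G iota) psi
  (@amalgam_projM I H G iota) (@amalgam_proj_base I H G iota)
  (@amalgam_proj_surj I H G iota) (@amalgam_proj_ker I H G iota)
  (@amalgam_base0 I H G iota) (@amalgam_baseN I H G iota) psiM psij
  mu mu_haar W t t_tensor).
Qed.
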